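(* Let $\mathcal{S}$ be the class of functions $f(z)=z+a_2z^2+a_3z^3+\cdots$ that are analytic and univalent (injective) in the open unit disc $\mathbb{D}=\{z\in\mathbb{C}:|z|<1\}$. For $f\in\mathcal{S}$ write $H_2(2)=H_2(2)(f)=a_2a_4-a_3^2$ and $H_3(1)=H_3(1)(f)=a_3(a_2a_4-a_3^2)-a_4(a_4-a_2a_3)+a_5(a_3-a_2^2)$. Let $$A=\sup_{f\in\mathcal{S}}|H_2(2)(f)|,\qquad B=\sup_{f\in\mathcal{S}}|H_3(1)(f)|$$ be the best constants such that $|H_2(2)(f)|\le A$ and $|H_3(1)(f)|\le B$ for all $f\in\mathcal{S}$. Then $$1\le A\le \frac{11}{3}\qquad\text{and}\qquad \frac{4}{9}\le B\le \frac{32+\sqrt{285}}{15}.$$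
   Context: For $f(z)=z+a_2z^2+a_3z^3+\cdots$ analytic in $\mathbb{D}$ (with $a_1=1$) and integers $q,n\ge 1$, the $q$th Hankel determinant $H_q(n)$ of $f$ is the determinant of the $q\times q$ matrix whose $(i,j)$ entry is $a_{n+i+j-2}$, $1\le i,j\le q$. Thus $H_2(2)=a_2a_4-a_3^2$ is the second Hankel determinant, and the third Hankel determinant is $$H_3(1)=\begin{vmatrix} 1 & a_2 & a_3 \\ a_2 & a_3 & a_4 \\ a_3 & a_4 & a_5 \end{vmatrix}=a_3(a_2a_4-a_3^2)-a_4(a_4-a_2a_3)+a_5(a_3-a_2^2).$$ *)

(* Defs.v *)
(* Stdlib reals with Coquelicot's complex numbers and power series. *)
From Stdlib Require Import Reals.
From Coquelicot Require Import Coquelicot.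

Definition in_disc (z : C) : Prop := Cmod z < 1.

(* [f : C -> C] is total; only its values on the unit disc matter.
   [ex_derive] is taken over the absolute ring [C], hence is complex
   differentiability. *)
Definition analytic_on_disc (f : C -> C) : Prop :=
  forall z : C, in_disc z ->
    ex_derive (K := C_AbsRing) (V := C_NormedModule) f z.

Definition univalent_on_disc (f : C -> C) : Prop :=
  forall z w : C, in_disc z -> in_disc w -> f z = f w -> z = w.

(* f(z) = a_0 + a_1 z + a_2 z^2 + ... for |z| < 1; such an [a] is determined
   by the restriction of [f] to the disc. *)
Definition expansion_on_disc (f : C -> C) (a : nat -> C) : Prop :=
  forall z : C, in_disc z ->
    is_pseries (K := C_AbsRing) (V := C_NormedModule) a z (f z).

(* [classS f a]: f is in the class S and (a_n) are its Taylor coefficients. *)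
Definition classS (f : C -> C) (a : nat -> C) : Prop :=
  analytic_on_disc f /\ univalent_on_disc f /\
  expansion_on_disc f a /\ a 0%nat = RtoC 0 /\ a 1%nat = RtoC 1.

Definition hankel22 (a : nat -> C) : C :=
  (a 2%nat * a 4%nat - a 3%nat * a 3%nat)%C.

(* The determinant of the matrix (a_(i+j-1)), 1 <= i, j <= 3, for a_1 = 1. *)
Definition hankel31 (a : nat -> C) : C :=
  (a 3%nat * (a 2%nat * a 4%nat - a 3%nat * a 3%nat)
   - a 4%nat * (a 4%nat - a 2%nat * a 3%nat)
   + a 5%nat * (a 3%nat - a 2%nat * a 2%nat))%C.

(* The supremum over S of |H(f)|, where H is given by the coefficients of f;
   it lives in [Rbar], so that finiteness is not presupposed. *)
Definition supS (H : (nat -> C) -> C) : Rbar :=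
  Lub_Rbar (fun x : R =>
    exists (f : C -> C) (a : nat -> C), classS f a /\ x = Cmod (H a)).

(* Main.v *)
Require Import Defs.
From Stdlib Require Import Reals Lra Lia Psatz Classical.
From Coquelicot Require Import Coquelicot.
Open Scope R_scope.

(* Write 1/f(u) = 1/u + h_1 + b_1 u + b_2 u^2 + ... Hankel determinants of f become those of the
   reciprocal series: H_2(2) = h_1 b_2 - b_1^2 and H_3(1) = b_1 b_3 - b_2^2. So the upper bounds
   follow from Gronwall's area theorem, sum n |b_n|^2 <= 1, and the crude bound |h_1| <= 5: if
   |h_1| > 5 then |u/f(u)| > 1 on |u| = 1/2, against the mean value property of f(u)/u.

   For the area theorem put G(v) = 1/f(e^v) - h_1 on a strip -L <= Re v <= y1 < 0, where G is
   injective modulo 2 pi i. Then the integral of |G'|^2 psi(G) is at most that of psi over the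
   plane; this is proved by smearing the points of a grid in the strip with a small bump in the
   image and bounding the resulting density through linearization at one contributing point.
   With psi(w) = max(0, 1 - |w|^2/T), T = e^(2L), one may replace psi by 1 - |w|^2/T, after which
   only the circle means of |G'|^2 and |G G'|^2 enter; let L -> oo and then y1 -> 0.

   The power series of 1/f converges in the whole disc by Cauchy estimates, obtained from discrete
   circle means of a holomorphic function being asymptotically independent of the radius.

   The lower bounds come from z/(1 - z^2) and z (1 - z^3)^(-2/3). *)

(** Planar and contour integrals are replaced by finite grid sums, with holomorphy entering through
    uniform second-order bounds. The area argument needs one inequality only, that no point is
    covered more than once, so neither surjectivity nor a planar change of variables is required.
    The obstacle is the pole: a punctured disc has an image of infinite area, and cutting at Re v =
    -L leaves terms of order e^(2L). The weight psi takes the place of an outer boundary curve. With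
    T = k e^(2L), and after division by 2 pi e^(2L), the plane integral of psi is k/4, the |G'|^2
    term gives 1/2 and the |G G'|^2 term gives -1/(4k). As k + 1/k >= 2 with equality only at k = 1,
    the choice T = e^(2L) is the one for which the divergent terms cancel and leave Gronwall's sum.
    A paraboloid serves both as weight and as bump: it is Lipschitz, its volume is elementary and,
    being quadratic in |w|, it leads to mean squares on circles, for which a Bessel-type lower bound
    is enough. *)

Ltac via l := eapply Rle_trans; [apply l|].

Ltac unscal := unfold scal; simpl; unfold mult; simpl.

Lemma Rinv_pos_le x : 0 < x -> 0 <= / x.
Proof. intros H; left; apply Rinv_0_lt_compat, H. Qed.

(** * Finite real and complex sums, elementary modulus inequalities *)

Fixpoint rsum (f : nat -> R) (n : nat) : R :=
  match n with O => 0 | S m => rsum f m + f m end.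

Fixpoint csum (f : nat -> C) (n : nat) : C :=
  match n with O => RtoC 0 | S m => (csum f m + f m)%C end.

Lemma rsum_ext f g n : (forall i, (i < n)%nat -> f i = g i) -> rsum f n = rsum g n.
Proof.
  induction n as [|n IH]; intros H; simpl; auto.
  rewrite IH, H; auto; intros; apply H; lia.
Qed.

Lemma rsum_le f g n : (forall i, (i < n)%nat -> f i <= g i) -> rsum f n <= rsum g n.
Proof.
  induction n as [|n IH]; intros H; simpl; [lra|].
  apply Rplus_le_compat; [apply IH; intros; apply H; lia | apply H; lia].
Qed.

Lemma rsum_const c n : rsum (fun _ => c) n = INR n * c.
Proof.
  induction n as [|n IH]; [simpl; ring|].
  rewrite S_INR; simpl rsum; rewrite IH; ring.
Qed.

Lemma rsum_nonneg f n : (forall i, (i < n)%nat -> 0 <= f i) -> 0 <= rsum f n.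
Proof.
  intros H; rewrite <- (Rmult_0_r (INR n)), <- (rsum_const 0); apply rsum_le; auto.
Qed.

Lemma rsum_plus f g n : rsum (fun i => f i + g i) n = rsum f n + rsum g n.
Proof. induction n as [|n IH]; simpl; [ring | rewrite IH; ring]. Qed.

Lemma rsum_scal c f n : rsum (fun i => c * f i) n = c * rsum f n.
Proof. induction n as [|n IH]; simpl; [ring | rewrite IH; ring]. Qed.

Lemma rsum_minus f g n : rsum (fun i => f i - g i) n = rsum f n - rsum g n.
Proof. induction n as [|n IH]; simpl; [ring | rewrite IH; ring]. Qed.

Lemma rsum_swap (f : nat -> nat -> R) n m :
  rsum (fun i => rsum (f i) m) n = rsum (fun j => rsum (fun i => f i j) n) m.
Proof.
  induction n as [|n IH]; simpl.
  - rewrite (rsum_const 0); ring.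
  - rewrite IH, <- rsum_plus; reflexivity.
Qed.

Lemma rsum_add f n m : rsum f (n + m) = rsum f n + rsum (fun i => f (n + i)%nat) m.
Proof.
  induction m as [|m IH]; simpl.
  - rewrite Nat.add_0_r; ring.
  - rewrite Nat.add_succ_r; simpl; rewrite IH; ring.
Qed.

Lemma rsum_le_upto f n m :
  (n <= m)%nat -> (forall i, (i < m)%nat -> 0 <= f i) -> rsum f n <= rsum f m.
Proof.
  intros H Hf; replace m with (n + (m - n))%nat by lia; rewrite rsum_add.
  assert (0 <= rsum (fun i => f (n + i)%nat) (m - n)); [|lra].
  apply rsum_nonneg; intros; apply Hf; lia.
Qed.

Lemma rsum_term_le f n i :
  (i < n)%nat -> (forall j, (j < n)%nat -> 0 <= f j) -> f i <= rsum f n.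
Proof.
  intros Hi Hf; apply Rle_trans with (rsum f (S i)); [|apply rsum_le_upto; auto; lia].
  simpl; assert (0 <= rsum f i); [|lra].
  apply rsum_nonneg; intros; apply Hf; lia.
Qed.

Lemma csum_ext f g n : (forall i, (i < n)%nat -> f i = g i) -> csum f n = csum g n.
Proof.
  induction n as [|n IH]; intros H; simpl; auto.
  rewrite IH, H; auto; intros; apply H; lia.
Qed.

Lemma csum_plus f g n : csum (fun i => f i + g i)%C n = (csum f n + csum g n)%C.
Proof. induction n as [|n IH]; simpl; [ring | rewrite IH; ring]. Qed.

Lemma csum_scal c f n : csum (fun i => c * f i)%C n = (c * csum f n)%C.
Proof. induction n as [|n IH]; simpl; [ring | rewrite IH; ring]. Qed.

Lemma csum_zero n : csum (fun _ => RtoC 0) n = RtoC 0.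
Proof. induction n as [|n IH]; simpl; [auto | rewrite IH; ring]. Qed.

Lemma csum_swap (f : nat -> nat -> C) n m :
  csum (fun i => csum (f i) m) n = csum (fun j => csum (fun i => f i j) n) m.
Proof.
  induction n as [|n IH]; simpl.
  - symmetry; apply csum_zero.
  - rewrite IH, <- csum_plus; reflexivity.
Qed.

Lemma csum_first f n : csum f (S n) = (f O + csum (fun i => f (S i)) n)%C.
Proof.
  induction n as [|n IH]; [simpl; ring|].
  change (csum f (S (S n))) with (csum f (S n) + f (S n))%C.
  rewrite IH; simpl; ring.
Qed.

Lemma csum_re f n : Re (csum f n) = rsum (fun i => Re (f i)) n.
Proof. induction n as [|n IH]; simpl; [auto | unfold Re in *; simpl; rewrite IH; auto]. Qed.

Lemma csum_im f n : Im (csum f n) = rsum (fun i => Im (f i)) n.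
Proof. induction n as [|n IH]; simpl; [auto | unfold Im in *; simpl; rewrite IH; auto]. Qed.

Lemma Cmod_csum f n : Cmod (csum f n) <= rsum (fun i => Cmod (f i)) n.
Proof.
  induction n as [|n IH]; simpl; [rewrite Cmod_0; lra|].
  via Cmod_triangle; lra.
Qed.

Lemma Ceq_re_im (x y : C) : Re x = Re y -> Im x = Im y -> x = y.
Proof. destruct x, y; unfold Re, Im; simpl; intros; subst; auto. Qed.

Lemma Cmod_minus_le (x y : C) : Cmod (x - y) <= Cmod x + Cmod y.
Proof. unfold Cminus; rewrite <- (Cmod_opp y); apply Cmod_triangle. Qed.

Lemma Cmod_minus_sym (x y : C) : Cmod (x - y) = Cmod (y - x).
Proof. rewrite <- Cmod_opp; f_equal; ring. Qed.

Lemma Cmod_minus_ge (x y : C) : Cmod x - Cmod y <= Cmod (x - y).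
Proof.
  generalize (Cmod_triangle (x - y) y); replace (x - y + y)%C with x by ring; lra.
Qed.

Lemma Rabs_im_le_Cmod (x : C) : Rabs (Im x) <= Cmod x.
Proof. eapply Rle_trans; [apply Rmax_r | apply (Rmax_Cmod x)]. Qed.

Lemma Rabs_re_le_Cmod (x : C) : Rabs (Re x) <= Cmod x.
Proof. apply re_le_Cmod. Qed.

Lemma Cmod_le_re_im (x : C) : Cmod x <= Rabs (Re x) + Rabs (Im x).
Proof.
  apply Rsqr_incr_0_var.
  - rewrite !Rsqr_pow2, Cmod2_alt.
    rewrite <- (pow2_abs (Re x)), <- (pow2_abs (Im x)).
    generalize (Rabs_pos (Re x)) (Rabs_pos (Im x)); nra.
  - generalize (Rabs_pos (Re x)) (Rabs_pos (Im x)); lra.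
Qed.

(** * Absolutely convergent complex series *)

Definition asum (u : nat -> C) : Prop := ex_series (fun n => Cmod (u n)).

(** Componentwise real [Series], hence total; it is known to be the sum only for summable [u], so
    the algebraic rules below assume [asum]. *)
Definition CSer (u : nat -> C) : C :=
  (Series (fun n => Re (u n)), Series (fun n => Im (u n))).

Lemma ex_series_le_R (a b : nat -> R) :
  (forall n, Rabs (a n) <= b n) -> ex_series b -> ex_series a.
Proof. intros H; apply (ex_series_le (K := R_AbsRing) (V := R_CompleteNormedModule)); exact H. Qed.

Lemma asum_le u b : (forall n, Cmod (u n) <= b n) -> ex_series b -> asum u.
Proof.
  intros H; apply ex_series_le_R; intros n.
  rewrite Rabs_pos_eq; [apply H | apply Cmod_ge_0].
Qed.

Lemma asum_re u : asum u -> ex_series (fun n => Rabs (Re (u n))).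
Proof.
  apply ex_series_le_R; intros n; rewrite Rabs_Rabsolu; apply Rabs_re_le_Cmod.
Qed.

Lemma asum_im u : asum u -> ex_series (fun n => Rabs (Im (u n))).
Proof.
  apply ex_series_le_R; intros n; rewrite Rabs_Rabsolu; apply Rabs_im_le_Cmod.
Qed.

Lemma asum_ext u v : (forall n, u n = v n) -> asum u -> asum v.
Proof. intros H; apply ex_series_ext; intros n; rewrite H; auto. Qed.

Lemma asum_plus u v : asum u -> asum v -> asum (fun n => u n + v n)%C.
Proof.
  intros Hu Hv; eapply asum_le; [|apply (ex_series_plus _ _ Hu Hv)].
  intros n; apply Cmod_triangle.
Qed.

Lemma asum_scal c u : asum u -> asum (fun n => c * u n)%C.
Proof.
  intros Hu; eapply asum_le; [|apply (ex_series_scal_l (Cmod c) _ Hu)].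
  intros n; rewrite Cmod_mult; apply Rle_refl.
Qed.

Lemma CSer_ext u v : (forall n, u n = v n) -> CSer u = CSer v.
Proof. intros H; unfold CSer; f_equal; apply Series_ext; intros n; rewrite H; auto. Qed.

Lemma CSer_plus u v : asum u -> asum v ->
  CSer (fun n => u n + v n)%C = (CSer u + CSer v)%C.
Proof.
  intros Hu Hv; apply Ceq_re_im; unfold CSer, Re, Im; simpl;
  apply Series_plus; apply ex_series_Rabs; apply asum_re || apply asum_im; auto.
Qed.

Lemma CSer_scal c u : asum u -> CSer (fun n => c * u n)%C = (c * CSer u)%C.
Proof.
  intros Hu; generalize (ex_series_Rabs _ (asum_re _ Hu)) (ex_series_Rabs _ (asum_im _ Hu)).
  intros Hr Hi; unfold CSer; destruct c as [c d]; unfold Cmult; simpl.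
  unfold Re, Im in *; f_equal.
  - rewrite <- !Series_scal_l, <- Series_minus; auto;
    apply (ex_series_scal_l (V := R_NormedModule)); auto.
  - rewrite <- !Series_scal_l, <- Series_plus; auto;
    apply (ex_series_scal_l (V := R_NormedModule)); auto.
Qed.

Lemma CSer_minus u v : asum u -> asum v ->
  CSer (fun n => u n - v n)%C = (CSer u - CSer v)%C.
Proof.
  intros Hu Hv.
  rewrite (CSer_ext _ (fun n => u n + (RtoC (-1)) * v n)%C) by (intros; ring).
  rewrite CSer_plus, CSer_scal; auto; [ring | apply asum_scal; auto].
Qed.

Lemma CSer_incr_1 u : asum u -> CSer u = (u O + CSer (fun n => u (S n)))%C.
Proof.
  intros Hu; apply Ceq_re_im; unfold CSer, Re, Im; simpl;
  apply Series_incr_1; apply ex_series_Rabs; apply asum_re || apply asum_im; auto.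
Qed.

Lemma asum_S_inv u : asum (fun n => u (S n)) -> asum u.
Proof. apply (ex_series_incr_1 (fun n => Cmod (u n))). Qed.

(** Multiplication by the unimodular number conj(s)/|s| makes the sum real and nonnegative, so only
    real parts have to be compared termwise; s = 0 is treated apart. *)
Lemma Cmod_CSer u : asum u -> Cmod (CSer u) <= Series (fun n => Cmod (u n)).
Proof.
  intros Hu; set (s := CSer u).
  destruct (Req_dec (Cmod s) 0) as [H0|H0].
  { rewrite H0, <- (Rmult_0_l (Series (fun _ => 0))), <- Series_scal_l.
    apply Series_le; auto; intros n; generalize (Cmod_ge_0 (u n)); lra. }
  set (e := (Cconj s / RtoC (Cmod s))%C).
  assert (HN : RtoC (Cmod s) <> 0) by (intros H; apply H0; apply RtoC_inj; auto).
  assert (He : Cmod e = 1).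
  { unfold e; rewrite Cmod_div by auto; rewrite Cmod_conj, Cmod_R, Rabs_pos_eq by apply Cmod_ge_0.
    field; auto. }
  assert (Hs : (e * s)%C = RtoC (Cmod s)).
  { replace (e * s)%C with ((s * Cconj s) / RtoC (Cmod s))%C by (unfold e; field; auto).
    rewrite <- Cmod2_conj, RtoC_pow; field; auto. }
  assert (H : Cmod s = Re (CSer (fun n => e * u n)%C)).
  { rewrite CSer_scal by auto; fold s; rewrite Hs; auto. }
  rewrite H; unfold CSer, Re at 1; simpl fst.
  via Rle_abs.
  assert (Heu : asum (fun n => e * u n)%C) by (apply asum_scal; auto).
  eapply Rle_trans; [apply Series_Rabs; apply (asum_re _ Heu)|].
  apply Series_le; auto; intros n; split; [apply Rabs_pos|].
  apply (Rle_trans _ (Cmod (e * u n))); [apply (Rabs_re_le_Cmod (e * u n))|].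
  rewrite Cmod_mult, He; lra.
Qed.

Lemma asum_shift u n : asum u -> asum (fun k => u (n + k)%nat).
Proof. apply (ex_series_incr_n (fun n => Cmod (u n))). Qed.

Lemma CSer_split u n : asum u -> CSer u = (csum u n + CSer (fun k => u (n + k)%nat))%C.
Proof.
  intros Hu; induction n as [|n IH].
  { rewrite (CSer_ext (fun k => u (0 + k)%nat) u) by auto; simpl; ring. }
  rewrite IH, (CSer_incr_1 (fun k => u (n + k)%nat)) by (apply asum_shift; auto).
  rewrite Nat.add_0_r; simpl.
  rewrite (CSer_ext (fun k => u (n + S k)%nat) (fun k => u (S (n + k)))); [ring|].
  intros k; f_equal; lia.
Qed.

Lemma sum_f_R0_rsum f n : sum_f_R0 f n = rsum f (S n).
Proof. induction n as [|n IH]; simpl in *; [ring | rewrite IH; ring]. Qed.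

Definition cconv (u v : nat -> C) (n : nat) : C :=
  csum (fun k => u k * v (n - k)%nat)%C (S n).

Lemma Series_mult_R (a b : nat -> R) :
  ex_series (fun n => Rabs (a n)) -> ex_series (fun n => Rabs (b n)) ->
  is_series (fun n => rsum (fun k => a k * b (n - k)%nat) (S n)) (Series a * Series b).
Proof.
  intros Ha Hb.
  eapply is_series_ext; [intros n; apply sum_f_R0_rsum|].
  apply is_series_mult; auto; apply Series_correct; apply ex_series_Rabs; auto.
Qed.

Lemma asum_conv u v : asum u -> asum v -> asum (cconv u v).
Proof.
  intros Hu Hv.
  assert (E : forall w, asum w -> ex_series (fun n => Rabs (Cmod (w n)))).
  { intros w; apply ex_series_ext; intros n; rewrite Rabs_pos_eq; auto using Cmod_ge_0. }
  eapply asum_le; [|eexists; apply (Series_mult_R _ _ (E u Hu) (E v Hv))].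
  intros n; unfold cconv; via Cmod_csum.
  apply rsum_le; intros; rewrite Cmod_mult; lra.
Qed.

Lemma CSer_conv u v : asum u -> asum v -> CSer (cconv u v) = (CSer u * CSer v)%C.
Proof.
  intros Hu Hv.
  generalize (asum_re _ Hu) (asum_im _ Hu) (asum_re _ Hv) (asum_im _ Hv).
  intros Ru Iu Rv Iv.
  apply Ceq_re_im; unfold CSer; unfold Re at 1, Im at 1; simpl fst; simpl snd.
  - apply is_series_unique.
    eapply is_series_ext; [|apply (is_series_minus _ _ _ _ (Series_mult_R _ _ Ru Rv) (Series_mult_R _ _ Iu Iv))].
    intros n; unfold cconv; rewrite csum_re.
    transitivity (rsum (fun i => Re (u i) * Re (v (n - i)%nat) - Im (u i) * Im (v (n - i)%nat)) (S n));
      [symmetry; apply rsum_minus with (n := S n)|].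
    apply rsum_ext with (n := S n); intros i _; unfold Re, Im, Cmult; simpl; ring.
  - apply is_series_unique.
    eapply is_series_ext; [|apply (is_series_plus _ _ _ _ (Series_mult_R _ _ Ru Iv) (Series_mult_R _ _ Iu Rv))].
    intros n; unfold cconv; rewrite csum_im.
    transitivity (rsum (fun i => Re (u i) * Im (v (n - i)%nat) + Im (u i) * Re (v (n - i)%nat)) (S n));
      [symmetry; apply rsum_plus with (n := S n)|].
    apply rsum_ext with (n := S n); intros i _; unfold Re, Im, Cmult; simpl; ring.
Qed.

(** * Power series in the disc *)

Definition absconv (r : R) (a : nat -> C) : Prop :=
  ex_series (fun n => Cmod (a n) * r ^ n).

Definition conv1 (a : nat -> C) : Prop := forall r, 0 <= r < 1 -> absconv r a.

Definition CPS (a : nat -> C) (z : C) : C := CSer (fun n => a n * z ^ n)%C.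

Lemma asum_CPS r a z : absconv r a -> Cmod z <= r -> asum (fun n => a n * z ^ n)%C.
Proof.
  intros Ha Hz; eapply asum_le; [|apply Ha].
  intros n; cbv beta; rewrite Cmod_mult, Cmod_pow.
  apply Rmult_le_compat_l; [apply Cmod_ge_0|].
  apply pow_incr; split; [apply Cmod_ge_0 | auto].
Qed.

Lemma CPS_ext a b z : (forall n, a n = b n) -> CPS a z = CPS b z.
Proof. intros H; apply CSer_ext; intros n; rewrite H; auto. Qed.

Lemma Cmod_CPS_le r a z : absconv r a -> Cmod z <= r ->
  Cmod (CPS a z) <= Series (fun n => Cmod (a n) * r ^ n).
Proof.
  intros Ha Hz; eapply Rle_trans; [apply Cmod_CSer, (asum_CPS r); auto|].
  apply Series_le; auto; intros n; split; [apply Cmod_ge_0|].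
  rewrite Cmod_mult, Cmod_pow.
  apply Rmult_le_compat_l; [apply Cmod_ge_0|].
  apply pow_incr; split; [apply Cmod_ge_0 | auto].
Qed.

Lemma absconv_plus r a b : absconv r a -> absconv r b -> 0 <= r ->
  absconv r (fun n => a n + b n)%C.
Proof.
  intros Ha Hb Hr; apply ex_series_le_R with (2 := ex_series_plus _ _ Ha Hb).
  intros n; assert (0 <= r ^ n) by (apply pow_le; auto).
  rewrite Rabs_pos_eq by (apply Rmult_le_pos; auto using Cmod_ge_0).
  generalize (Cmod_triangle (a n) (b n)); unfold plus; simpl; nra.
Qed.

Lemma absconv_scal r c a : absconv r a -> 0 <= r -> absconv r (fun n => c * a n)%C.
Proof.
  intros Ha Hr; apply ex_series_le_R with (2 := ex_series_scal_l (Cmod c) _ Ha).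
  intros n; assert (0 <= r ^ n) by (apply pow_le; auto).
  rewrite Rabs_pos_eq by (apply Rmult_le_pos; auto using Cmod_ge_0).
  rewrite Cmod_mult; unscal; lra.
Qed.

Lemma CPS_plus r a b z : absconv r a -> absconv r b -> Cmod z <= r ->
  CPS (fun n => a n + b n)%C z = (CPS a z + CPS b z)%C.
Proof.
  intros Ha Hb Hz; unfold CPS; rewrite <- CSer_plus by (apply (asum_CPS r); auto).
  apply CSer_ext; intros; ring.
Qed.

Lemma CPS_scal r c a z : absconv r a -> Cmod z <= r ->
  CPS (fun n => c * a n)%C z = (c * CPS a z)%C.
Proof.
  intros Ha Hz; unfold CPS; rewrite <- CSer_scal by (apply (asum_CPS r); auto).
  apply CSer_ext; intros; ring.
Qed.

(** Convergence at radius r is summability at the single point r, so closure under Cauchy products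
    can be read off from the result on sequences. *)
Lemma absconv_asum r a : 0 <= r -> absconv r a <-> asum (fun n => a n * RtoC r ^ n)%C.
Proof.
  intros Hr; split; intros H.
  - apply (asum_CPS r); auto; rewrite Cmod_R, Rabs_pos_eq; lra.
  - eapply ex_series_ext; [|apply H]; intros n; cbv beta.
    rewrite Cmod_mult, Cmod_pow, Cmod_R, Rabs_pos_eq; auto.
Qed.

Lemma cconv_pow a b z n :
  cconv (fun k => a k * z ^ k)%C (fun k => b k * z ^ k)%C n = (cconv a b n * z ^ n)%C.
Proof.
  unfold cconv; rewrite (Cmult_comm (csum _ _)), <- csum_scal.
  apply csum_ext; intros i Hi.
  replace (z ^ n)%C with (z ^ i * z ^ (n - i))%C; [ring|].
  rewrite <- Cpow_add_r; f_equal; lia.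
Qed.

Lemma absconv_cconv r a b : 0 <= r -> absconv r a -> absconv r b -> absconv r (cconv a b).
Proof.
  intros Hr Ha Hb; apply absconv_asum; auto.
  apply absconv_asum in Ha; apply absconv_asum in Hb; auto.
  eapply asum_ext; [|apply (asum_conv _ _ Ha Hb)].
  intros n; apply cconv_pow.
Qed.

Lemma CPS_mult r a b z : absconv r a -> absconv r b -> Cmod z <= r ->
  CPS (cconv a b) z = (CPS a z * CPS b z)%C.
Proof.
  intros Ha Hb Hz; unfold CPS; rewrite <- CSer_conv by (apply (asum_CPS r); auto).
  apply CSer_ext; intros n; symmetry; apply cconv_pow.
Qed.

Lemma absconv_shift r a : 0 < r -> absconv r a -> absconv r (fun n => a (S n)).
Proof.
  intros Hr Ha.
  apply (ex_series_incr_1 (fun n => Cmod (a n) * r ^ n)) in Ha.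
  eapply ex_series_ext; [|apply (ex_series_scal_r (/ r) _ Ha)].
  intros n; simpl; field; lra.
Qed.

Lemma absconv_unshift r a : absconv r (fun n => a (S n)) -> absconv r a.
Proof.
  intros Ha.
  apply (ex_series_incr_1 (fun n => Cmod (a n) * r ^ n)).
  eapply ex_series_ext; [|apply (ex_series_scal_r r _ Ha)].
  intros n; simpl; ring.
Qed.

Lemma CPS_step r a z : 0 < r -> absconv r a -> Cmod z <= r ->
  CPS a z = (a O + z * CPS (fun n => a (S n)) z)%C.
Proof.
  intros Hr Ha Hz; unfold CPS at 1; rewrite CSer_incr_1 by (apply (asum_CPS r); auto).
  unfold CPS; rewrite <- CSer_scal by (apply (asum_CPS r); auto using absconv_shift).
  simpl; f_equal; [ring | apply CSer_ext; intros; ring].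
Qed.

Lemma CPS_zero z : CPS (fun _ => RtoC 0) z = RtoC 0.
Proof.
  apply Ceq_re_im; unfold CPS, CSer; simpl;
  rewrite (Series_ext _ (fun n => 0 * 0)), Series_scal_l; try ring;
  intros n; unfold Re, Im, Cmult; simpl; ring.
Qed.

Lemma absconv_zero r : absconv r (fun _ => RtoC 0).
Proof.
  apply ex_series_ext with (fun n => scal 0 ((/ 2) ^ n)).
  { intros n; rewrite Cmod_0; unscal; ring. }
  apply (ex_series_scal_l (V := R_NormedModule)), ex_series_geom.
  rewrite Rabs_pos_eq; lra.
Qed.

Lemma conv1_shift a : conv1 a -> conv1 (fun n => a (S n)).
Proof.
  intros Ha r Hr; destruct (Req_dec r 0) as [->|Hr0].
  - apply ex_series_incr_1; apply ex_series_ext with (2 := absconv_zero 0).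
    intros n; simpl; rewrite Cmod_0; ring.
  - apply absconv_shift; [lra | apply Ha; auto].
Qed.

Lemma conv1_plus a b : conv1 a -> conv1 b -> conv1 (fun n => a n + b n)%C.
Proof. intros Ha Hb r Hr; apply absconv_plus; auto; lra. Qed.

Lemma conv1_scal c a : conv1 a -> conv1 (fun n => c * a n)%C.
Proof. intros Ha r Hr; apply absconv_scal; auto; lra. Qed.

Lemma conv1_cconv a b : conv1 a -> conv1 b -> conv1 (cconv a b).
Proof. intros Ha Hb r Hr; apply absconv_cconv; auto; lra. Qed.

Lemma conv1_unshift a : conv1 (fun n => a (S n)) -> conv1 a.
Proof. intros Ha r Hr; apply absconv_unshift, Ha; auto. Qed.

(** * Termwise derivatives and the calculus of second-order bounds *)

Lemma INR_pow_bound r s : 0 < r < s -> exists K, 0 < K /\ forall n, INR n * r ^ n <= K * s ^ n.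
Proof.
  intros Hrs; exists (r / (s - r)); split; [apply Rdiv_lt_0_compat; lra|].
  intros n.
  (* Bernoulli's inequality for the ratio s/r: the factor n is absorbed by a larger radius. *)
  assert (H : 1 + INR n * ((s - r) / r) <= (1 + (s - r) / r) ^ n)
    by (apply poly; apply Rdiv_lt_0_compat; lra).
  replace (1 + (s - r) / r) with (s / r) in H by (field; lra).
  replace (s ^ n) with ((s / r) ^ n * r ^ n) by (rewrite <- Rpow_mult_distr; f_equal; field; lra).
  assert (0 < r ^ n) by (apply pow_lt; lra).
  assert (INR n * ((s - r) / r) <= (s / r) ^ n) by lra.
  assert (INR n <= r / (s - r) * (s / r) ^ n).
  { apply Rmult_le_reg_r with ((s - r) / r); [apply Rdiv_lt_0_compat; lra|].
    eapply Rle_trans; [eassumption|]; right; field; lra. }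
  rewrite <- Rmult_assoc; apply Rmult_le_compat_r; lra.
Qed.

(** The Euler operator u d/du on coefficients: it keeps the index in place, and under u = e^v it is
    differentiation in v. *)
Definition ud (a : nat -> C) (n : nat) : C := (RtoC (INR n) * a n)%C.

Lemma conv1_ud a : conv1 a -> conv1 (ud a).
Proof.
  intros Ha r Hr.
  assert (H : forall r, 0 < r < 1 -> absconv r (ud a)).
  { clear r Hr; intros r Hr.
    destruct (INR_pow_bound r ((r + 1) / 2)) as [K [HK H]]; [lra|].
    apply ex_series_le_R with (2 := ex_series_scal_l K _ (Ha ((r + 1) / 2) ltac:(lra))).
    intros n; assert (0 < r ^ n) by (apply pow_lt; lra).
    rewrite Rabs_pos_eq by (apply Rmult_le_pos; auto using Cmod_ge_0; lra).
    unfold ud; rewrite Cmod_mult, Cmod_R, Rabs_pos_eq by apply pos_INR.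
    unscal.
    replace (INR n * Cmod (a n) * r ^ n) with (Cmod (a n) * (INR n * r ^ n)) by ring.
    replace (K * (Cmod (a n) * ((r + 1) / 2) ^ n)) with (Cmod (a n) * (K * ((r + 1) / 2) ^ n)) by ring.
    apply Rmult_le_compat_l; auto using Cmod_ge_0. }
  destruct (Req_dec r 0) as [->|Hr0]; [|apply H; lra].
  apply ex_series_incr_1; apply ex_series_ext with (2 := absconv_zero 0).
  intros n; simpl; rewrite Cmod_0; ring.
Qed.

Definition dcoef (a : nat -> C) (n : nat) : C := (RtoC (INR (S n)) * a (S n))%C.

Lemma conv1_dcoef a : conv1 a -> conv1 (dcoef a).
Proof. intros Ha; apply (conv1_shift (ud a)), conv1_ud, Ha. Qed.

Lemma CPS_ud a z : conv1 a -> Cmod z < 1 -> CPS (ud a) z = (z * CPS (dcoef a) z)%C.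
Proof.
  intros Ha Hz; generalize (Cmod_ge_0 z); intros Hz0.
  rewrite (CPS_step ((1 + Cmod z) / 2)); [|lra| apply conv1_ud; auto; lra |lra].
  unfold ud at 1; simpl INR; unfold dcoef, ud; ring.
Qed.

(* Stands in for holomorphy: it is stable under sums, products, quotients and composition,
   and its uniformity on S is what the Riemann sum arguments use. *)
Definition T2 (S : C -> Prop) (f f' : C -> C) : Prop :=
  exists M, 0 < M /\ (forall z, S z -> Cmod (f z) <= M /\ Cmod (f' z) <= M) /\
    forall z w, S z -> S w -> Cmod (f w - f z - f' z * (w - z)) <= M * Cmod (w - z) ^ 2.

(** Induction: the remainder for n + 1 is w times that for n, plus n z^(n-1) (w - z)^2, and n^2 + n
    <= (n + 1)^2. The factor r^2 on the left avoids the exponent n - 2, which truncated subtraction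
    would spoil for n < 2. *)
Lemma Cpow_lip r z w n : 0 < r -> Cmod z <= r -> Cmod w <= r ->
  r ^ 2 * Cmod (w ^ n - z ^ n - RtoC (INR n) * z ^ (pred n) * (w - z))
    <= INR n ^ 2 * r ^ n * Cmod (w - z) ^ 2.
Proof.
  intros Hr Hz Hw; induction n as [|n IH].
  { replace (w ^ 0 - z ^ 0 - RtoC (INR 0) * z ^ (pred 0) * (w - z))%C with (RtoC 0) by (simpl; ring).
    rewrite Cmod_0; simpl; lra. }
  set (E := (w ^ n - z ^ n - RtoC (INR n) * z ^ (pred n) * (w - z))%C) in *.
  assert (Hn : (w ^ S n - z ^ S n - RtoC (INR (S n)) * z ^ (pred (S n)) * (w - z)
            = w * E + RtoC (INR n) * z ^ (pred n) * ((w - z) * (w - z)))%C).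
  { unfold E; rewrite S_INR, RtoC_plus; simpl pred; simpl Cpow.
    destruct n as [|n]; simpl; ring. }
  rewrite Hn.
  set (d := Cmod (w - z)) in *; assert (0 <= d) by apply Cmod_ge_0.
  assert (H1 : Cmod (w * E) <= r * Cmod E).
  { rewrite Cmod_mult; apply Rmult_le_compat_r; auto using Cmod_ge_0. }
  assert (H2 : r * Cmod (RtoC (INR n) * z ^ (pred n) * ((w - z) * (w - z))) <= INR n * r ^ n * d ^ 2).
  { rewrite !Cmod_mult, Cmod_pow, Cmod_R, Rabs_pos_eq by apply pos_INR.
    fold d; destruct n as [|n]; [simpl; nra|]; simpl pred.
    assert (Cmod z ^ n <= r ^ n) by (apply pow_incr; split; auto using Cmod_ge_0).
    replace (r * (INR (S n) * Cmod z ^ n * (d * d))) with ((INR (S n) * r * d ^ 2) * Cmod z ^ n) by ring.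
    replace (INR (S n) * r ^ S n * d ^ 2) with ((INR (S n) * r * d ^ 2) * r ^ n) by (simpl; ring).
    apply Rmult_le_compat_l; auto.
    generalize (pos_INR (S n)); intros; repeat apply Rmult_le_pos; try lra. }
  eapply Rle_trans; [apply Rmult_le_compat_l; [nra | apply Cmod_triangle]|].
  set (X := Cmod (RtoC (INR n) * z ^ (pred n) * ((w - z) * (w - z)))) in *.
  rewrite S_INR; simpl (r ^ S n).
  generalize (pos_INR n); intros Hn0.
  assert (0 < r ^ n) by (apply pow_lt; auto).
  assert (0 <= r * r ^ n * d ^ 2) by (repeat apply Rmult_le_pos; nra).
  assert (r ^ 2 * Cmod (w * E) <= r * (INR n ^ 2 * r ^ n * d ^ 2)).
  { apply Rle_trans with (r * (r ^ 2 * Cmod E)); [|apply Rmult_le_compat_l; lra].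
    replace (r * (r ^ 2 * Cmod E)) with (r ^ 2 * (r * Cmod E)) by ring.
    apply Rmult_le_compat_l; nra. }
  assert (r ^ 2 * X <= r * (INR n * r ^ n * d ^ 2)).
  { replace (r ^ 2 * X) with (r * (r * X)) by ring; apply Rmult_le_compat_l; lra. }
  nra.
Qed.

(** The termwise remainders of [Cpow_lip] are summed; their majorant is the series of n^2 |a_n| r^n,
    that is of [ud (ud a)], which converges because [ud] preserves [conv1]. *)
Lemma CPS_T2 a r : conv1 a -> 0 < r < 1 -> T2 (fun z => Cmod z <= r) (CPS a) (CPS (dcoef a)).
Proof.
  intros Ha Hr.
  assert (Hd := conv1_dcoef a Ha); assert (Hu := conv1_ud _ (conv1_ud a Ha)).
  set (A := Series (fun n => Cmod (a n) * r ^ n)).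
  set (B := Series (fun n => Cmod (dcoef a n) * r ^ n)).
  set (D := Series (fun n => Cmod (ud (ud a) n) * r ^ n)).
  assert (P : forall u, absconv r u -> 0 <= Series (fun n => Cmod (u n) * r ^ n)).
  { intros u Hcu; via Cmod_ge_0.
    apply (Cmod_CPS_le r u 0 Hcu); rewrite Cmod_0; lra. }
  assert (0 <= A) by (apply P, Ha; lra).
  assert (0 <= B) by (apply P, Hd; lra).
  assert (0 <= D) by (apply P, Hu; lra).
  assert (0 < / r ^ 2) by (apply Rinv_0_lt_compat; nra).
  assert (0 <= D * / r ^ 2) by (apply Rmult_le_pos; lra).
  exists (A + B + D * / r ^ 2 + 1); split; [lra|]; split.
  - intros z Hz; split.
    + apply Rle_trans with A; [apply Cmod_CPS_le; auto; apply Ha; lra | lra].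
    + apply Rle_trans with B; [apply Cmod_CPS_le; auto; apply Hd; lra | lra].
  - intros z w Hz Hw.
    assert (Sw := asum_CPS r a w (Ha r ltac:(lra)) Hw).
    assert (Sz := asum_CPS r a z (Ha r ltac:(lra)) Hz).
    assert (Sd := asum_CPS r _ z (Hd r ltac:(lra)) Hz).
    (* For n = 0 the exponent [pred 0] is 0, but the factor [INR 0] removes the term. *)
    set (t := fun n => (a n * (RtoC (INR n) * z ^ (pred n)))%C).
    assert (St : asum t).
    { apply asum_S_inv; eapply asum_ext; [|apply Sd]; intros n; unfold t, dcoef; simpl pred; ring. }
    assert (Et : CSer t = CPS (dcoef a) z).
    { rewrite CSer_incr_1 by auto; unfold t at 1; simpl INR; unfold CPS.
      rewrite (CSer_ext (fun n => t (S n)) (fun n => dcoef a n * z ^ n)%C); [ring|].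
      intros n; unfold t, dcoef; simpl pred; ring. }
    assert (E : (CPS a w - CPS a z - CPS (dcoef a) z * (w - z) =
       CSer (fun n => a n * w ^ n - a n * z ^ n - (w - z) * t n))%C).
    { rewrite CSer_minus, CSer_minus, CSer_scal, Et; auto.
      - unfold CPS; ring.
      - eapply asum_ext; [|apply (asum_plus _ _ Sw (asum_scal (RtoC (-1)) _ Sz))].
        intros; simpl; ring.
      - apply asum_scal; auto. }
    assert (F : forall n, Cmod (a n * w ^ n - a n * z ^ n - (w - z) * t n)
       <= (/ r ^ 2 * Cmod (w - z) ^ 2) * (Cmod (ud (ud a) n) * r ^ n)).
    { intros n; replace (a n * w ^ n - a n * z ^ n - (w - z) * t n)%C with
        (a n * (w ^ n - z ^ n - RtoC (INR n) * z ^ (pred n) * (w - z)))%C by (unfold t; ring).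
      unfold ud; rewrite !Cmod_mult, !Cmod_R, !Rabs_pos_eq by apply pos_INR.
      generalize (Cpow_lip r z w n ltac:(lra) Hz Hw); intros HL.
      set (X := Cmod (w ^ n - z ^ n - RtoC (INR n) * z ^ (pred n) * (w - z))) in *.
      replace (/ r ^ 2 * Cmod (w - z) ^ 2 * (INR n * (INR n * Cmod (a n)) * r ^ n)) with
        (Cmod (a n) * (/ r ^ 2 * (INR n ^ 2 * r ^ n * Cmod (w - z) ^ 2))) by ring.
      apply Rmult_le_compat_l; [apply Cmod_ge_0|].
      apply Rmult_le_reg_l with (r ^ 2); [nra|].
      rewrite <- Rmult_assoc, Rinv_r, Rmult_1_l; auto; nra. }
    rewrite E.
    assert (G := ex_series_scal_l (/ r ^ 2 * Cmod (w - z) ^ 2) _ (Hu r ltac:(lra))).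
    eapply Rle_trans; [apply Cmod_CSer; eapply asum_le; [apply F | apply G]|].
    eapply Rle_trans; [apply Series_le; [|apply G]|].
    { intros n; split; [apply Cmod_ge_0 | apply F]. }
    cbv beta; unscal; rewrite Series_scal_l; fold D.
    simpl (_ ^ 2); set (d := Cmod (w - z)); assert (0 <= d) by apply Cmod_ge_0.
    assert (0 <= d * (d * 1)) by nra.
    replace (/ (r * (r * 1)) * (d * (d * 1)) * D) with ((D * / (r * (r * 1))) * (d * (d * 1))) by ring.
    apply Rmult_le_compat_r; auto. simpl in *; lra.
Qed.

(** S need not be convex, so there is no mean value argument: close points use the second-order
    bound, points more than 1 apart the bound on |f|; the constant 2 M covers both. *)
Lemma T2_lip S f f' : T2 S f f' ->
  exists L, 0 < L /\ forall z w, S z -> S w -> Cmod (f w - f z) <= L * Cmod (w - z).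
Proof.
  intros [M [HM [Hb H]]]; exists (2 * M); split; [lra|].
  intros z w Hz Hw; assert (Hd := Cmod_ge_0 (w - z)).
  destruct (Rle_dec (Cmod (w - z)) 1) as [H1|H1].
  - replace (f w - f z)%C with ((f w - f z - f' z * (w - z)) + f' z * (w - z))%C by ring.
    via Cmod_triangle; rewrite Cmod_mult.
    assert (A1 := H z w Hz Hw); assert (A2 := proj2 (Hb z Hz)).
    assert (M * Cmod (w - z) ^ 2 <= M * Cmod (w - z)) by (apply Rmult_le_compat_l; nra).
    assert (Cmod (f' z) * Cmod (w - z) <= M * Cmod (w - z)) by (apply Rmult_le_compat_r; auto).
    lra.
  - via Cmod_minus_le.
    assert (A1 := proj1 (Hb z Hz)); assert (A2 := proj1 (Hb w Hw)); nra.
Qed.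

(** Adding the expansions at z and at w cancels the values of f and leaves (f' w - f' z)(w - z), of
    modulus at most 2 M |w - z|^2. *)
Lemma T2_lip' S f f' : T2 S f f' ->
  exists L, 0 < L /\ forall z w, S z -> S w -> Cmod (f' w - f' z) <= L * Cmod (w - z).
Proof.
  intros [M [HM [Hb H]]]; exists (2 * M); split; [lra|].
  intros z w Hz Hw; assert (Hd := Cmod_ge_0 (w - z)).
  destruct (Req_dec (Cmod (w - z)) 0) as [H0|H0].
  { assert (w = z) by (apply Ceq_minus, Cmod_eq_0; auto).
    subst; replace (f' z - f' z)%C with (RtoC 0) by ring; rewrite H0, Cmod_0; lra. }
  apply Rmult_le_reg_r with (Cmod (w - z)); [lra|].
  rewrite <- Cmod_mult.
  replace ((f' w - f' z) * (w - z))%C with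
    ((f w - f z - f' z * (w - z)) + (f z - f w - f' w * (z - w)))%C by ring.
  via Cmod_triangle.
  assert (A1 := H z w Hz Hw); assert (A2 := H w z Hw Hz); rewrite (Cmod_minus_sym z w) in A2; nra.
Qed.

Lemma T2_subset (S S' : C -> Prop) f f' : (forall z, S z -> S' z) -> T2 S' f f' -> T2 S f f'.
Proof.
  intros HS [M [HM [Hb H]]]; exists M; split; auto; split; intros; auto.
Qed.

Lemma T2_ext S f f' g g' : (forall z, S z -> f z = g z) -> (forall z, S z -> f' z = g' z) ->
  T2 S f f' -> T2 S g g'.
Proof.
  intros E E' [M [HM [Hb H]]]; exists M; split; auto; split.
  - intros z Hz; rewrite <- E, <- E'; auto.
  - intros z w Hz Hw; rewrite <- !E, <- E'; auto.
Qed.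

Lemma T2_const S c : T2 S (fun _ => c) (fun _ => RtoC 0).
Proof.
  exists (Cmod c + 1); assert (H := Cmod_ge_0 c); split; [lra|]; split.
  - intros z _; rewrite Cmod_0; lra.
  - intros z w _ _; replace (c - c - 0 * (w - z))%C with (RtoC 0) by ring.
    rewrite Cmod_0; assert (H' := Cmod_ge_0 (w - z)); apply Rmult_le_pos; [lra | nra].
Qed.

Lemma T2_id S K : (forall z, S z -> Cmod z <= K) -> T2 S (fun z => z) (fun _ => RtoC 1).
Proof.
  intros HS; exists (Rabs K + 1); assert (H := Rabs_pos K); split; [lra|]; split.
  - intros z Hz; rewrite Cmod_1; generalize (HS z Hz) (Rle_abs K); lra.
  - intros z w _ _; replace (w - z - 1 * (w - z))%C with (RtoC 0) by ring.
    rewrite Cmod_0; assert (H' := Cmod_ge_0 (w - z)); apply Rmult_le_pos; [lra | nra].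
Qed.

Lemma T2_plus S f f' g g' : T2 S f f' -> T2 S g g' ->
  T2 S (fun z => f z + g z)%C (fun z => f' z + g' z)%C.
Proof.
  intros [M [HM [Hb H]]] [N [HN [Gb G]]]; exists (M + N); split; [lra|]; split.
  - intros z Hz; destruct (Hb z Hz), (Gb z Hz); split;
    (eapply Rle_trans; [apply Cmod_triangle|lra]).
  - intros z w Hz Hw.
    replace (f w + g w - (f z + g z) - (f' z + g' z) * (w - z))%C with
      ((f w - f z - f' z * (w - z)) + (g w - g z - g' z * (w - z)))%C by ring.
    via Cmod_triangle.
    generalize (H z w Hz Hw) (G z w Hz Hw); lra.
Qed.

Lemma T2_mult S f f' g g' : T2 S f f' -> T2 S g g' ->
  T2 S (fun z => f z * g z)%C (fun z => f' z * g z + f z * g' z)%C.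
Proof.
  intros Hf Hg.
  destruct (T2_lip _ _ _ Hf) as [Lf [HLf Lf']], (T2_lip _ _ _ Hg) as [Lg [HLg Lg']].
  destruct Hf as [M [HM [Hb H]]], Hg as [N [HN [Gb G]]].
  exists (3 * M * N + Lf * Lg).
  assert (0 < M * N) by (apply Rmult_lt_0_compat; auto).
  assert (0 < Lf * Lg) by (apply Rmult_lt_0_compat; auto).
  split; [lra|]; split.
  - intros z Hz; destruct (Hb z Hz), (Gb z Hz).
    assert (Hxy : forall x y, Cmod x <= M -> Cmod y <= N -> Cmod (x * y) <= M * N).
    { intros; rewrite Cmod_mult; apply Rmult_le_compat; auto using Cmod_ge_0. }
    split; [assert (A0 := Hxy (f z) (g z)); intuition lra|].
    via Cmod_triangle.
    assert (A1 := Hxy (f' z) (g z)); assert (A2 := Hxy (f z) (g' z)); intuition lra.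
  - intros z w Hz Hw; set (d := Cmod (w - z)); assert (0 <= d) by apply Cmod_ge_0.
    replace (f w * g w - f z * g z - (f' z * g z + f z * g' z) * (w - z))%C with
      ((f w - f z) * (g w - g z) + (f w - f z - f' z * (w - z)) * g z
        + f z * (g w - g z - g' z * (w - z)))%C by ring.
    assert (A1 := H z w Hz Hw); assert (A2 := G z w Hz Hw).
    assert (A3 := Lf' z w Hz Hw); assert (A4 := Lg' z w Hz Hw).
    destruct (Hb z Hz), (Gb z Hz).
    via Cmod_triangle.
    eapply Rle_trans; [apply Rplus_le_compat_r, Cmod_triangle|].
    rewrite !Cmod_mult; fold d in A1, A2, A3, A4.
    assert (B1 : Cmod (f w - f z) * Cmod (g w - g z) <= (Lf * d) * (Lg * d))
      by (apply Rmult_le_compat; auto using Cmod_ge_0).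
    assert (B2 : Cmod (f w - f z - f' z * (w - z)) * Cmod (g z) <= (M * d ^ 2) * N)
      by (apply Rmult_le_compat; auto using Cmod_ge_0).
    assert (B3 : Cmod (f z) * Cmod (g w - g z - g' z * (w - z)) <= M * (N * d ^ 2))
      by (apply Rmult_le_compat; auto using Cmod_ge_0).
    assert (0 <= M * N * d ^ 2) by (apply Rmult_le_pos; nra).
    nra.
Qed.

Lemma T2_inv S f f' c : 0 < c -> (forall z, S z -> c <= Cmod (f z)) -> T2 S f f' ->
  T2 S (fun z => / f z)%C (fun z => - f' z * (/ f z * / f z))%C.
Proof.
  intros Hc Hfc Hf.
  destruct (T2_lip _ _ _ Hf) as [Lf [HLf Lf']].
  destruct Hf as [M [HM [Hb H]]].
  assert (Hc' : 0 < / c) by (apply Rinv_0_lt_compat; auto).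
  assert (Hnz : forall z, S z -> f z <> 0).
  { intros z Hz E; generalize (Hfc z Hz); rewrite E, Cmod_0; lra. }
  assert (Hi : forall z, S z -> Cmod (/ f z) <= / c).
  { intros z Hz; rewrite Cmod_inv by auto; apply Rinv_le_contravar; auto. }
  assert (0 < M * (/ c * / c)) by (repeat apply Rmult_lt_0_compat; auto).
  assert (0 < Lf * Lf * (/ c * (/ c * / c))) by (repeat apply Rmult_lt_0_compat; auto).
  exists (M * (/ c * / c) + Lf * Lf * (/ c * (/ c * / c)) + / c); split; [lra|]; split.
  - intros z Hz; split; [generalize (Hi z Hz); lra|].
    rewrite !Cmod_mult, Cmod_opp.
    assert (Cmod (f' z) * (Cmod (/ f z) * Cmod (/ f z)) <= M * (/ c * / c)); [|lra].
    destruct (Hb z Hz); repeat apply Rmult_le_compat; auto using Cmod_ge_0.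
    apply Rmult_le_pos; apply Cmod_ge_0.
  - intros z w Hz Hw; set (d := Cmod (w - z)); assert (0 <= d) by apply Cmod_ge_0.
    (* The remainder of 1/f is that of f over -f(z)^2, plus the quadratic term (f w - f z)^2 / (f(w)
       f(z)^2). *)
    replace (/ f w - / f z - - f' z * (/ f z * / f z) * (w - z))%C with
      (- (f w - f z - f' z * (w - z)) * (/ f z * / f z)
        + (f w - f z) * (f w - f z) * (/ f w * (/ f z * / f z)))%C by (field; auto).
    assert (A1 := H z w Hz Hw); assert (A3 := Lf' z w Hz Hw); fold d in A1, A3.
    via Cmod_triangle; rewrite !Cmod_mult, Cmod_opp.
    assert (B1 : Cmod (f w - f z - f' z * (w - z)) * (Cmod (/ f z) * Cmod (/ f z)) <=
       (M * d ^ 2) * (/ c * / c)).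
    { repeat apply Rmult_le_compat; auto using Cmod_ge_0; apply Rmult_le_pos; apply Cmod_ge_0. }
    assert (B2 : Cmod (f w - f z) * Cmod (f w - f z) * (Cmod (/ f w) * (Cmod (/ f z) * Cmod (/ f z)))
      <= ((Lf * d) * (Lf * d)) * (/ c * (/ c * / c))).
    { repeat apply Rmult_le_compat; auto using Cmod_ge_0; repeat apply Rmult_le_pos; apply Cmod_ge_0. }
    assert (0 <= / c * d ^ 2) by (apply Rmult_le_pos; nra).
    nra.
Qed.

Lemma T2_comp S S' f f' g g' : (forall z, S z -> S' (f z)) -> T2 S f f' -> T2 S' g g' ->
  T2 S (fun z => g (f z)) (fun z => g' (f z) * f' z)%C.
Proof.
  intros HS Hf Hg.
  destruct (T2_lip _ _ _ Hf) as [Lf [HLf Lf']].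
  destruct Hf as [M [HM [Hb H]]], Hg as [N [HN [Gb G]]].
  assert (0 < M * N) by (apply Rmult_lt_0_compat; auto).
  assert (0 < N * (Lf * Lf)) by (repeat apply Rmult_lt_0_compat; auto).
  exists (N + M * N + N * (Lf * Lf)); split; [lra|]; split.
  - intros z Hz; destruct (Hb z Hz), (Gb (f z) (HS z Hz)); split; [lra|].
    rewrite Cmod_mult; assert (Cmod (g' (f z)) * Cmod (f' z) <= N * M); [|lra].
    apply Rmult_le_compat; auto using Cmod_ge_0.
  - intros z w Hz Hw; set (d := Cmod (w - z)); assert (0 <= d) by apply Cmod_ge_0.
    assert (A1 := H z w Hz Hw); assert (A3 := Lf' z w Hz Hw); fold d in A1, A3.
    assert (A2 := G (f z) (f w) (HS z Hz) (HS w Hw)).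
    replace (g (f w) - g (f z) - g' (f z) * f' z * (w - z))%C with
      ((g (f w) - g (f z) - g' (f z) * (f w - f z)) + g' (f z) * (f w - f z - f' z * (w - z)))%C by ring.
    via Cmod_triangle; rewrite !Cmod_mult.
    assert (B1 : Cmod (g' (f z)) * Cmod (f w - f z - f' z * (w - z)) <= N * (M * d ^ 2)).
    { apply Rmult_le_compat; auto using Cmod_ge_0; apply Gb; auto. }
    assert (B2 : Cmod (f w - f z) ^ 2 <= (Lf * d) ^ 2) by (apply pow_incr; auto using Cmod_ge_0).
    assert (N * Cmod (f w - f z) ^ 2 <= N * (Lf * d) ^ 2) by (apply Rmult_le_compat_l; lra).
    assert (0 <= N * d ^ 2) by (apply Rmult_le_pos; nra).
    nra.
Qed.

(** * Comparison with Coquelicot's complex series and complex derivative *)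

Lemma sum_n_C_re (u : nat -> C) n : fst (sum_n u n) = sum_n (fun k => fst (u k)) n.
Proof.
  induction n as [|n IH]; [rewrite !sum_O; auto|].
  rewrite !sum_Sn, <- IH; reflexivity.
Qed.

Lemma sum_n_C_im (u : nat -> C) n : snd (sum_n u n) = sum_n (fun k => snd (u k)) n.
Proof.
  induction n as [|n IH]; [rewrite !sum_O; auto|].
  rewrite !sum_Sn, <- IH; reflexivity.
Qed.

Lemma is_series_C (u : nat -> C) (l : C) :
  is_series (K := C_AbsRing) (V := C_NormedModule) u l <->
  is_series (fun n => Re (u n)) (Re l) /\ is_series (fun n => Im (u n)) (Im l).
Proof.
  unfold is_series; split.
  - intros H; assert (H' := proj1 (filterlim_locally (U := C_UniformSpace) (sum_n u) l) H); clear H.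
    split; apply (filterlim_locally (U := R_UniformSpace)); intros eps;
    generalize (H' eps); apply filter_imp; intros n [H1 H2].
    + unfold Re; rewrite <- sum_n_C_re; exact H1.
    + unfold Im; rewrite <- sum_n_C_im; exact H2.
  - intros [H1 H2].
    assert (H1' := proj1 (filterlim_locally (U := R_UniformSpace) _ _) H1).
    assert (H2' := proj1 (filterlim_locally (U := R_UniformSpace) _ _) H2).
    apply (filterlim_locally (U := C_UniformSpace)); intros eps.
    generalize (filter_and _ _ (H1' eps) (H2' eps)); apply filter_imp; intros n [A1 A2].
    split.
    + unfold Re in A1; rewrite <- sum_n_C_re in A1; exact A1.
    + unfold Im in A2; rewrite <- sum_n_C_im in A2; exact A2.
Qed.

Lemma is_series_CSer u : asum u -> is_series (K := C_AbsRing) (V := C_NormedModule) u (CSer u).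
Proof.
  intros Hu; apply is_series_C; split; apply Series_correct, ex_series_Rabs;
  [apply asum_re | apply asum_im]; auto.
Qed.

Lemma pow_n_Cpow (z : C) n : pow_n (K := C_AbsRing) z n = (z ^ n)%C.
Proof. induction n as [|n IH]; simpl; [auto | rewrite IH; auto]. Qed.

Lemma conv1_is_pseries a z : conv1 a -> Cmod z < 1 ->
  is_pseries (K := C_AbsRing) (V := C_NormedModule) a z (CPS a z).
Proof.
  intros Ha Hz; assert (Hz0 := Cmod_ge_0 z).
  assert (S := asum_CPS (Cmod z) a z (Ha _ (conj Hz0 Hz)) (Rle_refl _)).
  unfold is_pseries; apply is_series_ext with (fun n => a n * z ^ n)%C.
  - intros n; rewrite Cmult_comm, <- pow_n_Cpow; reflexivity.
  - apply is_series_CSer, S.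
Qed.

Lemma is_lim_seq_bounded (u : nat -> R) (l : R) : is_lim_seq u l -> exists K, forall n, Rabs (u n) <= K.
Proof.
  intros H; apply is_lim_seq_spec in H; destruct (H (mkposreal 1 Rlt_0_1)) as [N HN]; simpl in HN.
  exists (rsum (fun i => Rabs (u i)) N + Rabs l + 1); intros n.
  assert (0 <= rsum (fun i => Rabs (u i)) N) by (apply rsum_nonneg; intros; apply Rabs_pos).
  assert (H1 := Rabs_pos l).
  destruct (Compare_dec.le_lt_dec N n) as [Hn|Hn].
  - generalize (HN n Hn) (Rabs_triang (u n - l) l); replace (u n - l + l) with (u n) by ring; lra.
  - generalize (rsum_term_le (fun i => Rabs (u i)) N n Hn ltac:(intros; apply Rabs_pos)); lra.
Qed.

(** Abel's lemma. [is_pseries] gives plain convergence only; at the larger radius s = (1 + r) / 2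
    the terms tend to 0, hence are bounded, and a multiple of (r / s)^n is a majorant. *)
Lemma expansion_conv1 f a : expansion_on_disc f a -> conv1 a.
Proof.
  intros H r Hr; set (s := (1 + r) / 2).
  assert (Hs : in_disc (RtoC s)) by (unfold in_disc, s; rewrite Cmod_R, Rabs_pos_eq; lra).
  generalize (H _ Hs); unfold is_pseries; rewrite is_series_C; intros [H1 H2].
  assert (B : forall v l, is_series v l -> exists K, forall n : nat, Rabs (v n) <= K).
  { intros v l Hv; apply (is_lim_seq_bounded v 0), ex_series_lim_0; exists l; auto. }
  destruct (B _ _ H1) as [K1 HK1], (B _ _ H2) as [K2 HK2].
  assert (E : forall n, Cmod (a n) * s ^ n <= K1 + K2).
  { intros n; assert (A1 := HK1 n); assert (A2 := HK2 n); rewrite pow_n_Cpow in A1, A2.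
    change (Rabs (Re (RtoC s ^ n * a n)) <= K1) in A1.
    change (Rabs (Im (RtoC s ^ n * a n)) <= K2) in A2.
    replace (Cmod (a n) * s ^ n) with (Cmod (RtoC s ^ n * a n)).
    - eapply Rle_trans; [apply Cmod_le_re_im | lra].
    - rewrite Cmod_mult, Cmod_pow, Cmod_R, Rabs_pos_eq; [ring | unfold s; lra]. }
  assert (Hq : Rabs (r / s) < 1).
  { assert (0 <= r / s) by (apply Rmult_le_pos; [lra | apply Rinv_pos_le; unfold s; lra]).
    rewrite Rabs_pos_eq by auto.
    apply Rmult_lt_reg_r with s; unfold s in *; [lra|].
    unfold Rdiv; rewrite Rmult_assoc, Rinv_l; lra. }
  apply ex_series_le_R with (2 := ex_series_scal_l (K1 + K2) _ (ex_series_geom _ Hq)).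
  intros n; assert (0 <= r ^ n) by (apply pow_le; lra).
  rewrite Rabs_pos_eq by (apply Rmult_le_pos; auto using Cmod_ge_0).
  unscal.
  assert (Hsn : 0 < s ^ n) by (apply pow_lt; unfold s; lra).
  assert (0 <= (r / s) ^ n).
  { apply pow_le; apply Rmult_le_pos; [lra | apply Rinv_pos_le; unfold s; lra]. }
  replace (Cmod (a n) * r ^ n) with ((Cmod (a n) * s ^ n) * (r / s) ^ n).
  - apply Rmult_le_compat_r; auto.
  - rewrite Rmult_assoc, <- Rpow_mult_distr; do 2 f_equal; field; unfold s; lra.
Qed.

Lemma expansion_CPS f a z : expansion_on_disc f a -> Cmod z < 1 -> f z = CPS a z.
Proof.
  intros H Hz; generalize (H z Hz) (conv1_is_pseries a z (expansion_conv1 f a H) Hz).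
  unfold is_pseries; rewrite !is_series_C; intros [A1 A2] [B1 B2].
  apply Ceq_re_im.
  - rewrite <- (is_series_unique _ _ A1); apply is_series_unique, B1.
  - rewrite <- (is_series_unique _ _ A2); apply is_series_unique, B2.
Qed.

Lemma T2_ex_derive S f f' z : T2 S f f' -> S z -> (exists d : posreal, forall w, Cmod (w - z) < d -> S w) ->
  ex_derive (K := C_AbsRing) (V := C_NormedModule) f z.
Proof.
  intros [M [HM [_ H]]] Hz [d Hd]; exists (f' z); split; [apply is_linear_scal_l|].
  intros x Hx; rewrite <- (is_filter_lim_locally_unique (K := C_AbsRing) (V := AbsRing_NormedModule C_AbsRing) _ _ Hx); intros eps.
  assert (He : 0 < Rmin d (eps / M)).
  { apply Rmin_glb_lt; [apply cond_pos | apply Rdiv_lt_0_compat; [apply cond_pos | auto]]. }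
  exists (mkposreal _ He); intros w Hw; simpl in Hw.
  change (Cmod (w - z) < Rmin d (eps / M)) in Hw.
  change (Cmod (f w - f z - (w - z) * f' z) <= eps * Cmod (w - z)).
  rewrite (Cmult_comm (w - z)).
  eapply Rle_trans; [apply H; auto; apply Hd; eapply Rlt_le_trans; [apply Hw | apply Rmin_l]|].
  assert (Hw' := Rlt_le_trans _ _ _ Hw (Rmin_r _ _)).
  assert (M * Cmod (w - z) <= eps).
  { replace (pos eps) with (M * (eps / M)) by (field; lra); apply Rmult_le_compat_l; lra. }
  replace (M * Cmod (w - z) ^ 2) with (M * Cmod (w - z) * Cmod (w - z)) by ring.
  apply Rmult_le_compat_r; auto using Cmod_ge_0.
Qed.

Lemma conv1_analytic a : conv1 a -> analytic_on_disc (CPS a).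
Proof.
  intros Ha z Hz; unfold in_disc in Hz; assert (Hz0 := Cmod_ge_0 z).
  apply (T2_ex_derive (fun w => Cmod w <= (1 + Cmod z) / 2) _ (CPS (dcoef a))); [|lra|].
  - apply CPS_T2; auto; lra.
  - assert (Hd : 0 < (1 - Cmod z) / 2) by lra; exists (mkposreal _ Hd); intros w Hw; simpl in Hw.
    replace w with ((w - z) + z)%C by ring.
    via Cmod_triangle; lra.
Qed.

(* Chopping a segment into n pieces bounds the variation by O(1/n). *)
Lemma T2_zero_derivative_const (S : C -> Prop) (f f' : C -> C) (z : C) :
  (forall t, 0 <= t <= 1 -> S (RtoC t * z)%C) -> (forall w, S w -> f' w = 0) ->
  T2 S f f' -> f z = f 0.
Proof.
  intros HS H0 [M [HM [_ H]]].
  assert (B : forall n, Cmod (f z - f 0) <= M * Cmod z ^ 2 * / INR (Datatypes.S n)).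
  { intros n; set (N := Datatypes.S n).
    assert (HN : 0 < INR N) by (apply lt_0_INR; unfold N; lia).
    assert (Hin : forall k, (k <= N)%nat -> 0 <= INR k / INR N <= 1).
    { intros k Hk; apply le_INR in Hk; assert (Hk0 := pos_INR k); split.
      - apply Rmult_le_pos; auto; apply Rinv_pos_le; auto.
      - apply Rmult_le_reg_r with (INR N); auto; unfold Rdiv; rewrite Rmult_assoc, Rinv_l; lra. }
    assert (G : forall k, (k <= N)%nat ->
       Cmod (f (RtoC (INR k / INR N) * z) - f 0)%C <= INR k * (M * Cmod z ^ 2 * / INR N ^ 2)).
    { induction k as [|k IH]; intros Hk.
      - simpl INR; unfold Rdiv; rewrite Rmult_0_l; replace (0 * z)%C with (RtoC 0) by ring.
        replace (f 0 - f 0)%C with (RtoC 0) by ring; rewrite Cmod_0; lra.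
      - assert (Hk' : (k <= N)%nat) by lia; specialize (IH Hk').
        set (p := (RtoC (INR k / INR N) * z)%C) in *.
        set (q := (RtoC (INR (Datatypes.S k) / INR N) * z)%C) in *.
        assert (Hp : S p) by (apply HS; auto); assert (Hq : S q) by (apply HS; auto).
        assert (A := H p q Hp Hq); rewrite (H0 p Hp) in A.
        replace (f q - f p - 0 * (q - p))%C with (f q - f p)%C in A by ring.
        assert (E : (q - p)%C = (RtoC (/ INR N) * z)%C).
        { unfold p, q; rewrite S_INR.
          replace ((INR k + 1) / INR N) with (INR k / INR N + / INR N) by (field; lra).
          rewrite RtoC_plus; ring. }
        rewrite E, Cmod_mult, Cmod_R, Rabs_pos_eq in A by (apply Rinv_pos_le; auto).
        replace (f q - f 0)%C with ((f q - f p) + (f p - f 0))%C by ring.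
        via Cmod_triangle; rewrite S_INR.
        replace (M * (/ INR N * Cmod z) ^ 2) with (M * Cmod z ^ 2 * / INR N ^ 2) in A by (field; lra).
        lra. }
    specialize (G N (Nat.le_refl _)).
    replace (RtoC (INR N / INR N) * z)%C with z in G
      by (unfold Rdiv; rewrite Rinv_r by lra; ring).
    via G; right; field; lra. }
  apply Ceq_minus, Cmod_eq_0, Rle_antisym; [|apply Cmod_ge_0].
  apply Rnot_lt_le; intros Hpos.
  set (K := M * Cmod z ^ 2) in *.
  destruct (nfloor_ex (K / Cmod (f z - f 0))) as [n Hn].
  { apply Rmult_le_pos; [unfold K; assert (0 <= Cmod z ^ 2) by (apply pow_le, Cmod_ge_0); nra|].
    apply Rinv_pos_le; auto. }
  specialize (B n); rewrite S_INR in B; assert (Hn0 := pos_INR n).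
  assert (Cmod (f z - f 0) * (INR n + 1) <= K).
  { replace K with (K * / (INR n + 1) * (INR n + 1)) by (field; lra).
    apply Rmult_le_compat_r; lra. }
  assert (K < (INR n + 1) * Cmod (f z - f 0)).
  { replace K with (K / Cmod (f z - f 0) * Cmod (f z - f 0)) by (field; lra).
    apply Rmult_lt_compat_r; lra. }
  lra.
Qed.

(** The gauge f t / (2 L) makes every x close to t satisfy f x >= f t / 2, and [compactness_value]
    bounds from below the gauges that have to be used. Stating the Lipschitz condition through
    [close_n] lets one lemma serve in dimensions 2 and 4. *)
Lemma lip_pos_min n (a b : Compactness.Tn n R) (f : Compactness.Tn n R -> R) L :
  0 < L -> (forall x, bounded_n n a b x -> 0 < f x) ->
  (forall x t d, bounded_n n a b x -> bounded_n n a b t -> 0 < d -> close_n n d x t ->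
      f t <= f x + L * d) ->
  exists c, 0 < c /\ forall x, bounded_n n a b x -> c <= f x.
Proof.
  intros HL Hf Hlip.
  (* A gauge must be positive off the box as well, where f may fail to be; the value 1 is
     arbitrary. *)
  assert (Hd : forall t, 0 < (if Rlt_dec 0 (f t) then f t / (2 * L) else 1)).
  { intros t; destruct (Rlt_dec 0 (f t)); [apply Rdiv_lt_0_compat; lra | lra]. }
  destruct (compactness_value n a b (fun t => mkposreal _ (Hd t))) as [d H].
  exists (L * d); split; [apply Rmult_lt_0_compat; auto; apply cond_pos|].
  (* The nearby point t exists only under a double negation, which is harmless in a proof by
     contradiction. *)
  intros x Hx; apply Rnot_lt_le; intros Hlt; apply (H x Hx); intros [t [Ht [Hc Hle]]].
  assert (A := Hlip x t _ Hx Ht (cond_pos _) Hc); simpl in A, Hle, Hc.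
  destruct (Rlt_dec 0 (f t)) as [Hp|Hn]; [|apply Hn, Hf, Ht].
  assert (L * (f t / (2 * L)) = f t / 2) by (field; lra).
  assert (L * d <= L * (f t / (2 * L))) by (apply Rmult_le_compat_l; lra).
  lra.
Qed.

(** * Circle means *)

Definition cis (t : R) : C := (cos t, sin t).

Lemma cis_add s t : cis (s + t) = (cis s * cis t)%C.
Proof. unfold cis, Cmult; simpl; rewrite cos_plus, sin_plus; f_equal; ring. Qed.

Lemma cis_0 : cis 0 = RtoC 1.
Proof. unfold cis; rewrite cos_0, sin_0; auto. Qed.

Lemma Cmod_cis t : Cmod (cis t) = 1.
Proof.
  unfold Cmod, cis; simpl; replace (_ + _) with 1; [apply sqrt_1|].
  generalize (sin2_cos2 t); unfold Rsqr; lra.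
Qed.

Lemma cis_pow t n : (cis t ^ n)%C = cis (INR n * t).
Proof.
  induction n as [|n IH]; [simpl; rewrite Rmult_0_l, cis_0; auto|].
  rewrite S_INR; simpl; rewrite IH, <- cis_add; f_equal; ring.
Qed.

Lemma cis_period t n : cis (t + 2 * INR n * PI) = cis t.
Proof. unfold cis; rewrite cos_period, sin_period; auto. Qed.

Lemma Cconj_cis t : Cconj (cis t) = cis (- t).
Proof. unfold cis, Cconj; simpl; rewrite cos_neg, sin_neg; auto. Qed.

Lemma cis_neq_1 t : t <> 0 -> Rabs t < 2 * PI -> cis t <> RtoC 1.
Proof.
  intros H0 Ht E; assert (Ec : cos t = 1) by (injection E; auto).
  replace t with (2 * (t / 2)) in Ec by field; rewrite cos_2a_sin in Ec.
  assert (Hs : sin (t / 2) = 0) by nra.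
  destruct (Rle_dec 0 t) as [Hp|Hn].
  - rewrite Rabs_pos_eq in Ht by auto.
    generalize (sin_gt_0 (t / 2) ltac:(lra) ltac:(lra)); lra.
  - rewrite Rabs_left in Ht by lra.
    generalize (sin_gt_0 (- (t / 2)) ltac:(lra) ltac:(lra)); rewrite sin_neg; lra.
Qed.

Lemma Rabs_sin_le x : Rabs (sin x) <= Rabs x.
Proof.
  assert (P : forall y, 0 <= y -> Rabs (sin y) <= y).
  { intros y Hy; destruct (Req_dec y 0) as [->|Hy0]; [rewrite sin_0, Rabs_R0; lra|].
    apply Rabs_le; split; [|left; apply sin_lt_x; lra].
    destruct (Rle_dec y 1) as [H1|H1].
    - assert (0 < sin y) by (apply sin_gt_0; [lra | generalize PI2_1; lra]); lra.
    - generalize (SIN_bound y); lra. }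
  destruct (Rle_dec 0 x) as [Hx|Hx].
  - rewrite (Rabs_pos_eq x) by auto; apply P; auto.
  - rewrite (Rabs_left x) by lra; rewrite <- (Rabs_Ropp (sin x)), <- sin_neg; apply P; lra.
Qed.

Lemma cis_minus_1 t : Cmod (cis t - 1) <= Rabs t.
Proof.
  apply Rsqr_incr_0_var; [|apply Rabs_pos].
  rewrite <- Rsqr_abs, Rsqr_pow2, Cmod2_alt.
  assert (E : Re (cis t - 1) = cos t - 1 /\ Im (cis t - 1) = sin t).
  { unfold cis, Re, Im; simpl; split; ring. }
  destruct E as [-> ->].
  replace ((cos t - 1) ^ 2 + sin t ^ 2) with (2 - 2 * cos t)
    by (generalize (sin2_cos2 t); unfold Rsqr; nra).
  replace (cos t) with (cos (2 * (t / 2))) by (f_equal; field); rewrite cos_2a_sin.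
  assert (H := Rabs_sin_le (t / 2)); apply Rsqr_le_abs_1 in H; unfold Rsqr in *; nra.
Qed.

Lemma cis_lip s t : Cmod (cis s - cis t) <= Rabs (s - t).
Proof.
  replace (cis s - cis t)%C with (cis t * (cis (s - t) - 1))%C.
  - rewrite Cmod_mult, Cmod_cis, Rmult_1_l; apply cis_minus_1.
  - replace s with (t + (s - t)) at 2 by ring; rewrite cis_add; ring.
Qed.

Definition ang (N j : nat) : R := 2 * PI * INR j / INR N.

Notation circ r N j := (RtoC r * cis (ang N j))%C.

Definition mean (N : nat) (f : nat -> C) : C := (RtoC (/ INR N) * csum f N)%C.

Lemma ang_bound N j : (0 < N)%nat -> (j <= N)%nat -> 0 <= ang N j <= 2 * PI.
Proof.
  intros HN Hj; apply lt_0_INR in HN; apply le_INR in Hj.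
  assert (H := PI_RGT_0); assert (Hj0 := pos_INR j); unfold ang; split.
  - apply Rmult_le_pos; [nra | apply Rinv_pos_le; auto].
  - apply Rmult_le_reg_r with (INR N); auto; unfold Rdiv; rewrite Rmult_assoc, Rinv_l; nra.
Qed.

Lemma mean_ext N f g : (forall j, (j < N)%nat -> f j = g j) -> mean N f = mean N g.
Proof. intros H; unfold mean; f_equal; apply csum_ext; auto. Qed.

Lemma mean_plus N f g : mean N (fun j => f j + g j)%C = (mean N f + mean N g)%C.
Proof. unfold mean; rewrite csum_plus; ring. Qed.

Lemma mean_scal N c f : mean N (fun j => c * f j)%C = (c * mean N f)%C.
Proof. unfold mean; rewrite csum_scal; ring. Qed.

Lemma mean_minus N f g : mean N (fun j => f j - g j)%C = (mean N f - mean N g)%C.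
Proof.
  rewrite (mean_ext N _ (fun j => f j + RtoC (-1) * g j)%C) by (intros; ring).
  rewrite mean_plus, mean_scal; ring.
Qed.

Lemma mean_csum N f m :
  mean N (fun j => csum (fun n => f n j) m) = csum (fun n => mean N (f n)) m.
Proof. unfold mean; rewrite csum_swap, csum_scal; auto. Qed.

Lemma Cmod_mean_le N f K : (0 < N)%nat -> (forall j, (j < N)%nat -> Cmod (f j) <= K) ->
  Cmod (mean N f) <= K.
Proof.
  intros HN H; apply lt_0_INR in HN as HN'.
  unfold mean; rewrite Cmod_mult, Cmod_R, Rabs_pos_eq by (apply Rinv_pos_le; auto).
  apply Rmult_le_reg_l with (INR N); auto; rewrite <- Rmult_assoc, Rinv_r, Rmult_1_l by lra.
  via Cmod_csum; rewrite <- rsum_const; apply rsum_le; auto.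
Qed.

Lemma csum_geom z n : (csum (fun j => z ^ j) n * (z - 1) = z ^ n - 1)%C.
Proof.
  induction n as [|n IH]; simpl; [ring|].
  replace ((csum (fun j => z ^ j) n + z ^ n) * (z - 1))%C with
    (csum (fun j => z ^ j) n * (z - 1) + z ^ n * (z - 1))%C by ring.
  rewrite IH; ring.
Qed.

(** A geometric sum whose ratio is an N-th root of unity; the ratio is not 1, because 0 < |n - k| <
    N keeps its angle nonzero and strictly between -2 pi and 2 pi. *)
Lemma mean_cis_neq N n k : (n < N)%nat -> (k < N)%nat -> n <> k ->
  mean N (fun j => cis (INR n * ang N j) * cis (- (INR k * ang N j)))%C = RtoC 0.
Proof.
  intros Hn Hk Hnk; assert (HN : 0 < INR N) by (apply lt_0_INR; lia).
  set (t := (INR n - INR k) * (2 * PI / INR N)).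
  assert (HP := PI_RGT_0).
  assert (Hd : 0 < Rabs (INR n - INR k) < INR N).
  { apply lt_INR in Hn, Hk; assert (H1 := pos_INR n); assert (H2 := pos_INR k); split.
    - apply Rabs_pos_lt; intros H; apply Hnk, INR_eq; lra.
    - apply Rabs_def1; lra. }
  assert (Hz : cis t <> RtoC 1).
  { assert (Hp : 0 < 2 * PI / INR N) by (apply Rdiv_lt_0_compat; lra).
    apply cis_neq_1.
    - unfold t; apply Rmult_integral_contrapositive; split; [|lra].
      intros H; rewrite H, Rabs_R0 in Hd; lra.
    - unfold t; rewrite Rabs_mult, (Rabs_pos_eq (2 * PI / INR N)) by lra.
      apply Rlt_le_trans with (INR N * (2 * PI / INR N)); [apply Rmult_lt_compat_r; lra|].
      right; field; lra. }
  assert (HzN : (cis t ^ N)%C = RtoC 1).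
  { rewrite cis_pow; unfold t.
    (* [cis_period] adds only nonnegative multiples of 2 pi, so the two signs are removed
       separately. *)
    replace (INR N * ((INR n - INR k) * (2 * PI / INR N))) with (- (2 * INR k * PI) + 2 * INR n * PI)
      by (field; lra).
    rewrite cis_period, <- (cis_period _ k).
    replace (- (2 * INR k * PI) + 2 * INR k * PI) with 0 by ring; apply cis_0. }
  unfold mean; rewrite (csum_ext _ (fun j => cis t ^ j)%C).
  - assert (G := csum_geom (cis t) N); rewrite HzN in G.
    assert (Z : csum (fun j => cis t ^ j)%C N = RtoC 0).
    { apply NNPP; intros Hc.
      apply (Cmult_neq_0 _ _ Hc (Cminus_eq_contra _ _ Hz)); rewrite G; ring. }
    rewrite Z; ring.
  - intros j _; rewrite cis_pow, <- cis_add; f_equal; unfold t, ang; field; lra.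
Qed.

Lemma mean_cis_eq N k : (0 < N)%nat ->
  mean N (fun j => cis (INR k * ang N j) * cis (- (INR k * ang N j)))%C = RtoC 1.
Proof.
  intros HN; apply lt_0_INR in HN.
  unfold mean; rewrite (csum_ext _ (fun j => RtoC 1 ^ j)%C).
  - assert (E : forall n, csum (fun j => RtoC 1 ^ j)%C n = RtoC (INR n)).
    { induction n as [|n IH]; [auto|]; rewrite S_INR, RtoC_plus; simpl csum.
      rewrite IH, Cpow_1_l; auto. }
    rewrite E, <- RtoC_mult, Rinv_l; auto; lra.
  - intros j _; rewrite <- cis_add, Rplus_opp_r, cis_0, Cpow_1_l; auto.
Qed.

Lemma series_tail_small (u : nat -> R) eps : ex_series u -> 0 < eps ->
  exists M0, forall M, (M0 <= M)%nat -> Rabs (Series (fun k => u (M + k)%nat)) <= eps.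
Proof.
  intros Hu He; assert (H := Series_correct _ Hu).
  assert (H' := proj1 (filterlim_locally (U := R_UniformSpace) _ _) H (mkposreal _ He)).
  destruct H' as [N HN]; exists (S N); intros M HM.
  destruct M as [|M]; [lia|].
  assert (A := HN M ltac:(lia)); change (Rabs (sum_n u M - Series u) < eps) in A.
  rewrite (Series_incr_n u (S M)) in A; auto; [|lia].
  simpl pred in A; rewrite <- sum_n_Reals in A.
  rewrite Rabs_minus_sym in A.
  match type of A with Rabs ?x < _ => replace x with (Series (fun k => u (S M + k)%nat)) in A by ring end.
  lra.
Qed.

Lemma csum_single (c : nat -> C) k m : (k < m)%nat -> (forall n, (n < m)%nat -> n <> k -> c n = 0) ->
  csum c m = c k.
Proof.
  induction m as [|m IH]; intros Hk H; [lia|]; simpl.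
  destruct (Nat.eq_dec k m) as [->|Hkm].
  - rewrite (csum_ext _ (fun _ => RtoC 0)), csum_zero; [ring|].
    intros i Hi; apply H; lia.
  - rewrite IH, (H m); try lia; [ring|]; intros; apply H; lia.
Qed.

Lemma Cmod_rcis r t : 0 <= r -> Cmod (RtoC r * cis t) = r.
Proof. intros; rewrite Cmod_mult, Cmod_cis, Cmod_R, Rabs_pos_eq; auto; ring. Qed.

(** Discrete Fourier coefficients. For indices below M <= N orthogonality is exact and only n = k
    survives; aliasing comes from the tail alone, which is at most eps on the circle whatever N
    is. *)
Lemma mean_CPS a r k eps : 0 <= r -> absconv r a -> 0 < eps ->
  exists N0, (0 < N0)%nat /\ forall N, (N0 <= N)%nat ->
   Cmod (mean N (fun j => CPS a (circ r N j) * cis (- (INR k * ang N j)))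
         - a k * RtoC r ^ k)%C <= eps.
Proof.
  intros Hr Ha He; destruct (series_tail_small _ eps Ha He) as [M0 HM0].
  set (M := (M0 + S k)%nat); specialize (HM0 M ltac:(lia)).
  exists M; split; [lia|]; intros N HN.
  assert (HN0 : (0 < N)%nat) by lia.
  set (T := fun j => CSer (fun n => a (M + n)%nat * (circ r N j) ^ (M + n))%C).
  rewrite (mean_ext N _ (fun j => csum (fun n => (a n * RtoC r ^ n) *
      (cis (INR n * ang N j) * cis (- (INR k * ang N j)))) M + T j * cis (- (INR k * ang N j)))%C).
  - rewrite mean_plus, mean_csum, (csum_single _ k); [| lia |].
    + rewrite mean_scal, mean_cis_eq by auto.
      replace (a k * RtoC r ^ k * 1 + mean N (fun j => T j * cis (- (INR k * ang N j))) - a k * RtoC r ^ k)%C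
        with (mean N (fun j => T j * cis (- (INR k * ang N j)))%C) by ring.
      apply Cmod_mean_le; auto; intros j _.
      rewrite Cmod_mult, Cmod_cis, Rmult_1_r.
      assert (Hs : asum (fun n => a n * (circ r N j) ^ n)%C)
        by (apply (asum_CPS r); auto; rewrite Cmod_rcis; lra).
      unfold T; eapply Rle_trans; [apply Cmod_CSer; apply (asum_shift _ M) in Hs; exact Hs|].
      via Rle_abs.
      rewrite (Series_ext _ (fun n => Cmod (a (M + n)%nat) * r ^ (M + n))); [exact HM0|].
      intros n; rewrite Cmod_mult, Cmod_pow, Cmod_rcis; auto.
    + intros n Hn Hnk; rewrite mean_scal, mean_cis_neq by lia; ring.
  - intros j _; unfold CPS.
    assert (Hs : asum (fun n => a n * (circ r N j) ^ n)%C)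
      by (apply (asum_CPS r); auto; rewrite Cmod_rcis; lra).
    rewrite (CSer_split _ M Hs), Cmult_plus_distr_r; f_equal.
    rewrite Cmult_comm, <- csum_scal; apply csum_ext; intros n _.
    rewrite Cpow_mult_l, cis_pow; ring.
Qed.

Lemma mean_CPS_0 a r eps : 0 <= r -> absconv r a -> 0 < eps ->
  exists N0, (0 < N0)%nat /\ forall N, (N0 <= N)%nat ->
   Cmod (mean N (fun j => CPS a (circ r N j)) - a O)%C <= eps.
Proof.
  intros Hr Ha He; destruct (mean_CPS a r 0 eps Hr Ha He) as [N0 [HN0 H]].
  exists N0; split; auto; intros N HN; specialize (H N HN); simpl in H.
  rewrite (mean_ext N _ (fun j => CPS a (circ r N j))%C) in H.
  - replace (a O * 1)%C with (a O) in H by ring; auto.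
  - intros j _; rewrite Rmult_0_l, Ropp_0, cis_0; ring.
Qed.

Definition annulus (r0 r1 : R) (z : C) : Prop :=
  exists r t, r0 <= r <= r1 /\ 0 <= t <= 2 * PI /\ z = (RtoC r * cis t)%C.

Lemma csum_cyclic g N : g N = g O -> csum (fun j => g (S j)) N = csum g N.
Proof.
  intros H; assert (E := csum_first g N); simpl in E; rewrite H in E.
  replace (csum (fun j => g (S j)) N) with ((g O + csum (fun j => g (S j)) N) - g O)%C by ring.
  rewrite <- E; ring.
Qed.

(* The tangential derivative averages out over the circle, so by conformality the radial one does too. *)
Lemma circle_mean_invariant f f' r0 r1 : 0 < r0 <= r1 -> T2 (annulus r0 r1) f f' ->
  exists K, forall N, (2 <= N)%nat ->
   Cmod (mean N (fun j => f (circ r1 N j)%C) - mean N (fun j => f (circ r0 N j)%C))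
     <= K / INR N.
Proof.
  intros Hr [M [HM [_ H]]].
  set (K := (r1 - r0) / r0 * (M * r1 ^ 2 * (2 * PI)) + M * (r1 - r0) ^ 2).
  exists K; intros N HN2; assert (HN : 0 < INR N) by (apply lt_0_INR; lia).
  assert (HP := PI_RGT_0).
  assert (HNi : 0 < / INR N) by (apply Rinv_0_lt_compat; auto).
  set (D := (r1 - r0) / INR N).
  assert (HD : 0 <= D) by (apply Rmult_le_pos; lra).
  set (m := fun r => mean N (fun j => f (circ r N j))).
  assert (Hin : forall r j, r0 <= r <= r1 -> (j <= N)%nat -> annulus r0 r1 (circ r N j)).
  { intros r j Hr' Hj; exists r, (ang N j); repeat split; try lra; apply ang_bound; auto; lia. }
  set (w := cis (2 * PI / INR N)).
  assert (Hw : Cmod (w - 1) <= 2 * PI / INR N).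
  { via cis_minus_1; rewrite Rabs_pos_eq; [lra|].
    apply Rmult_le_pos; lra. }
  (* N >= 2 makes w differ from 1; the estimate of the tangential mean divides by |w - 1|. *)
  assert (Hw0 : 0 < Cmod (w - 1)).
  { apply Cmod_gt_0, Cminus_eq_contra, cis_neq_1.
    - apply Rgt_not_eq, Rdiv_lt_0_compat; lra.
    - rewrite Rabs_pos_eq by (apply Rmult_le_pos; lra).
      apply (le_INR 2) in HN2; simpl in HN2.
      apply Rmult_lt_reg_r with (INR N); auto; unfold Rdiv; rewrite Rmult_assoc, Rinv_l; nra. }
  assert (Hstep : forall j, cis (ang N (S j)) = (cis (ang N j) * w)%C).
  { intros j; unfold w; rewrite <- cis_add; f_equal; unfold ang; rewrite S_INR; field; lra. }
  assert (HL : forall r, r0 <= r <= r1 ->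
    Cmod (mean N (fun j => f' (circ r N j) * (circ r N j))%C)
      <= M * r1 ^ 2 * (2 * PI) / INR N).
  { intros r Hr'; set (L := mean N _).
    (* The values of f cancel over a full turn, so (w - 1) L consists of second-order errors, each
       O(|w - 1|^2); division by |w - 1| leaves L = O(1/N). *)
    assert (E : ((w - 1) * L = - mean N (fun j => f (circ r N (S j))
        - f (circ r N j) - f' (circ r N j) *
          (circ r N (S j) - circ r N j)))%C).
    { unfold L; rewrite <- mean_scal, !mean_minus.
      assert (Ec : mean N (fun j => f (circ r N (S j)))%C
          = mean N (fun j => f (circ r N j))%C).
      { unfold mean; f_equal; apply (csum_cyclic (fun j => f (circ r N j))).
        do 2 f_equal; unfold ang; simpl INR.
        replace (2 * PI * INR N / INR N) with (0 + 2 * INR 1 * PI) by (simpl; field; lra).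
        rewrite cis_period; f_equal; field; lra. }
      rewrite Ec.
      match goal with |- ?a = (- (?b - ?b - ?c))%C => replace (- (b - b - c))%C with c by ring end.
      apply mean_ext; intros j _; rewrite Hstep; ring. }
    assert (B : Cmod ((w - 1) * L) <= M * r1 ^ 2 * Cmod (w - 1) ^ 2).
    { rewrite E, Cmod_opp; apply Cmod_mean_le; [lia|]; intros j Hj.
      eapply Rle_trans; [apply H; apply Hin; auto; lia|].
      replace (circ r N (S j) - circ r N j)%C
        with (circ r N j * (w - 1))%C by (rewrite Hstep; ring).
      rewrite (Cmod_mult (_ * _)), Cmod_rcis by lra.
      rewrite Rpow_mult_distr, <- Rmult_assoc; apply Rmult_le_compat_r; [apply pow_le; lra|].
      apply Rmult_le_compat_l; [lra|]; apply pow_incr; lra. }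
    rewrite Cmod_mult in B.
    apply Rle_trans with (M * r1 ^ 2 * Cmod (w - 1)).
    - apply Rmult_le_reg_l with (Cmod (w - 1)); auto; nra.
    - unfold Rdiv; rewrite (Rmult_assoc (M * r1 ^ 2)).
      apply Rmult_le_compat_l; auto; apply Rmult_le_pos; [lra | nra]. }
  (* Passing from radius r to r + D displaces each node z by (D / r) z, so the mean changes by (D /
     r) L + O(D^2) = O(1/N^2); the N steps from r0 to r1 add up to O(1/N). *)
  assert (HS : forall k, (k < N)%nat ->
    Cmod (m (r0 + INR (S k) * D) - m (r0 + INR k * D)) <= K / INR N ^ 2).
  { intros k Hk.
    assert (HkN : INR k * D + D <= r1 - r0).
    { apply le_INR in Hk; rewrite S_INR in Hk.
      replace (r1 - r0) with (INR N * D) by (unfold D; field; lra); nra. }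
    assert (Hk0 : 0 <= INR k * D) by (apply Rmult_le_pos; auto; apply pos_INR).
    set (r := r0 + INR k * D).
    replace (r0 + INR (S k) * D) with (r + D) by (unfold r; rewrite S_INR; ring).
    assert (Hr1 : r0 <= r <= r1) by (unfold r; lra).
    assert (Hr2 : r0 <= r + D <= r1) by (unfold r; lra).
    set (L := mean N (fun j => f' (circ r N j) * (circ r N j))%C).
    assert (B : Cmod (m (r + D) - m r - RtoC (D / r) * L) <= M * D ^ 2).
    { unfold m, L; rewrite <- mean_scal, <- !mean_minus.
      apply Cmod_mean_le; [lia|]; intros j Hj.
      assert (A := H (circ r N j) (RtoC (r + D) * cis (ang N j))%C
        (Hin r j Hr1 ltac:(lia)) (Hin (r + D) j Hr2 ltac:(lia))).
      replace (RtoC (r + D) * cis (ang N j) - circ r N j)%C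
        with (circ D N j)%C in A by (rewrite RtoC_plus; ring).
      rewrite (Cmod_rcis D) in A by auto.
      replace (RtoC (D / r) * (f' (circ r N j) * (circ r N j)))%C
        with (f' (circ r N j) * (circ D N j))%C; [exact A|].
      rewrite RtoC_div by lra; field; intros Hx; apply RtoC_inj in Hx; lra. }
    set (p := m (r + D)) in *; set (q := m r) in *.
    replace (p - q)%C with ((p - q - RtoC (D / r) * L) + RtoC (D / r) * L)%C by ring.
    via Cmod_triangle.
    assert (B2 : Cmod (RtoC (D / r) * L) <= (D / r0) * (M * r1 ^ 2 * (2 * PI) / INR N)).
    { rewrite Cmod_mult, Cmod_R, Rabs_pos_eq by (apply Rmult_le_pos; auto; apply Rinv_pos_le; lra).
      apply Rmult_le_compat; auto using Cmod_ge_0.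
      - apply Rmult_le_pos; auto; apply Rinv_pos_le; lra.
      - apply Rmult_le_compat_l; auto; apply Rinv_le_contravar; lra.
      - apply HL; auto. }
    eapply Rle_trans; [apply Rplus_le_compat; [apply B | apply B2]|].
    right; unfold K, D; field; lra. }
  assert (G : forall k, (k <= N)%nat -> Cmod (m (r0 + INR k * D) - m r0) <= INR k * (K / INR N ^ 2)).
  { induction k as [|k IH]; intros Hk.
    - simpl INR; rewrite Rmult_0_l, Rplus_0_r; replace (m r0 - m r0)%C with (RtoC 0) by ring.
      rewrite Cmod_0; lra.
    - assert (A1 := HS k ltac:(lia)); assert (A2 := IH ltac:(lia)).
      set (p := m (r0 + INR (S k) * D)) in *; set (q := m (r0 + INR k * D)) in *.
      replace (p - m r0)%C with ((p - q) + (q - m r0))%C by ring.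
      via Cmod_triangle. 
      apply Rle_trans with (K / INR N ^ 2 + INR k * (K / INR N ^ 2)); [lra|].
      rewrite S_INR; lra. }
  specialize (G N (Nat.le_refl _)).
  replace (r0 + INR N * D) with r1 in G by (unfold D; field; lra).
  fold (m r1) (m r0); via G; right; field; lra.
Qed.

Lemma T2_pow S K k : (forall z, S z -> Cmod z <= K) -> exists d, T2 S (fun z => z ^ k)%C d.
Proof.
  intros HK; induction k as [|k [d IH]].
  - exists (fun _ => RtoC 0); exact (T2_const S (RtoC 1)).
  - eexists; exact (T2_mult _ _ _ _ _ (T2_id S K HK) IH).
Qed.

Lemma annulus_Cmod r0 r1 z : 0 <= r0 -> annulus r0 r1 z -> r0 <= Cmod z <= r1.
Proof. intros H0 [r [t [Hr [_ ->]]]]; rewrite Cmod_rcis; lra. Qed.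

(** Polar coordinates make the closed disc the image of a real box, as [lip_pos_min] requires; a
    change of at most d in both coordinates moves the point by at most 2 d. *)
Lemma CPS_min_mod p r : conv1 p -> (forall z, Cmod z < 1 -> CPS p z <> 0) -> 0 < r < 1 ->
  exists c, 0 < c /\ forall z, annulus 0 r z -> c <= Cmod (CPS p z).
Proof.
  intros Hp Hnz Hr.
  destruct (T2_lip _ _ _ (CPS_T2 p r Hp Hr)) as [L [HL Hlip]].
  set (F := fun x : Compactness.Tn 2 R => Cmod (CPS p (RtoC (fst x) * cis (fst (snd x))))).
  destruct (lip_pos_min 2 (0, (0, tt)) (r, (2 * PI, tt)) F (2 * L)) as [c [Hc H]].
  - lra.
  - intros [x [y []]] [Hx [Hy _]]; unfold F; simpl; apply Cmod_gt_0, Hnz; rewrite Cmod_rcis; lra.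
  - intros [x [y []]] [s [t []]] d [Hx [Hy _]] [Hs [Ht _]] Hd [H1 [H2 _]]; unfold F; simpl.
    set (z := (RtoC x * cis y)%C); set (w := (RtoC s * cis t)%C).
    assert (Hz : Cmod z <= r) by (unfold z; rewrite Cmod_rcis; lra).
    assert (Hw : Cmod w <= r) by (unfold w; rewrite Cmod_rcis; lra).
    assert (A := Hlip z w Hz Hw).
    assert (B : Cmod (w - z) <= 2 * d).
    { replace (w - z)%C with (RtoC s * (cis t - cis y) + RtoC (s - x) * cis y)%C
        by (unfold w, z; rewrite RtoC_minus; ring).
      via Cmod_triangle; rewrite !Cmod_mult, !Cmod_R, Cmod_cis.
      rewrite (Rabs_pos_eq s) by lra; rewrite (Rabs_minus_sym s x).
      assert (C1 := cis_lip t y); rewrite (Rabs_minus_sym t y) in C1.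
      assert (C2 := Cmod_ge_0 (cis t - cis y)); nra. }
    generalize (Cmod_minus_ge (CPS p w) (CPS p z)); nra.
  - exists c; split; auto; intros z [s [t [Hs [Ht ->]]]].
    apply (H (s, (t, tt))); simpl; auto.
Qed.

(** * The reciprocal power series *)

(** Course-of-values recursion: each new coefficient needs all earlier ones, so stage n carries them
    as a function, meant to be read at k <= n. *)
Fixpoint invtab (p : nat -> C) (n : nat) : nat -> C :=
  match n with
  | O => fun _ => RtoC 1
  | S m => fun k => if Nat.leb k m then invtab p m k
                    else (- csum (fun i => p (S i) * invtab p m (m - i)%nat) (S m))%C
  end.

(* Coefficients of the reciprocal of a power series with constant term 1. *)
Definition psinv (p : nat -> C) (n : nat) : C := invtab p n n.

Lemma invtab_psinv p n k : (k <= n)%nat -> invtab p n k = psinv p k.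
Proof.
  induction n as [|n IH]; intros Hk.
  - replace k with O by lia; auto.
  - destruct (Nat.eq_dec k (S n)) as [->|H]; [auto|].
    simpl; rewrite (proj2 (Nat.leb_le k n)) by lia; apply IH; lia.
Qed.

Lemma psinv_S p m : psinv p (S m) = (- csum (fun i => p (S i) * psinv p (m - i)%nat) (S m))%C.
Proof.
  unfold psinv at 1; cbn [invtab]; rewrite (proj2 (Nat.leb_gt (S m) m)) by lia.
  f_equal; apply csum_ext; intros i Hi; rewrite invtab_psinv; auto; lia.
Qed.

Definition unit_seq (n : nat) : C := match n with O => RtoC 1 | _ => RtoC 0 end.

Lemma psinv_cconv p n : p O = RtoC 1 -> cconv p (psinv p) n = unit_seq n.
Proof.
  intros H0; unfold cconv; rewrite csum_first, H0, Nat.sub_0_r.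
  destruct n as [|n]; [unfold psinv; simpl; ring|].
  rewrite psinv_S; cbn [unit_seq Nat.sub]; ring.
Qed.

Lemma CPS_unit z : CPS unit_seq z = RtoC 1.
Proof.
  assert (Hz := Cmod_ge_0 z).
  rewrite (CPS_step (Cmod z + 1)); [|lra| |lra].
  - simpl; rewrite (CPS_zero z); ring.
  - apply absconv_unshift; simpl; apply absconv_zero.
Qed.

Lemma absconv_geom r a K D : 0 <= r -> r * D < 1 -> 0 <= D ->
  (forall n, Cmod (a n) <= K * D ^ n) -> absconv r a.
Proof.
  intros Hr HrD HD H.
  assert (Hq : Rabs (r * D) < 1) by (rewrite Rabs_pos_eq; nra).
  apply ex_series_le_R with (2 := ex_series_scal_l K _ (ex_series_geom _ Hq)).
  intros n; assert (0 <= r ^ n) by (apply pow_le; auto).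
  rewrite Rabs_pos_eq by (apply Rmult_le_pos; auto using Cmod_ge_0).
  unscal; rewrite Rpow_mult_distr.
  replace (K * (r ^ n * D ^ n)) with (K * D ^ n * r ^ n) by ring.
  apply Rmult_le_compat_r; auto.
Qed.

Lemma conv1_bounded a r : conv1 a -> 0 <= r < 1 -> exists K, 0 < K /\ forall n, Cmod (a n) * r ^ n <= K.
Proof.
  intros Ha Hr; destruct (is_lim_seq_bounded _ _ (ex_series_lim_0 _ (Ha r Hr))) as [K HK].
  exists (Rmax K 1); split; [generalize (Rmax_r K 1); lra|]; intros n.
  apply Rle_trans with K; [|apply Rmax_l]; eapply Rle_trans; [apply Rle_abs | apply HK].
Qed.

Lemma psinv_small_radius p : conv1 p -> exists r, 0 < r < 1 /\ absconv r (psinv p).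
Proof.
  intros Hp; destruct (conv1_bounded p (/ 2) Hp ltac:(lra)) as [A [HA H]].
  (* Chosen so that D - 2 = 2 A: the geometric sum in [G] then closes up exactly, and the bound D^k
     propagates through the recurrence. *)
  set (D := 2 * (1 + A)).
  assert (Hp2 : forall n, Cmod (p n) <= A * 2 ^ n).
  { intros n; specialize (H n); assert (0 < 2 ^ n) by (apply pow_lt; lra).
    rewrite pow_inv in H.
    apply Rmult_le_reg_r with (/ 2 ^ n); [apply Rinv_0_lt_compat; auto|].
    rewrite Rmult_assoc, Rinv_r; lra. }
  assert (G : forall n, rsum (fun i => A * 2 ^ S i * D ^ (n - i)) (S n) = D ^ S n - 2 ^ S n).
  { induction n as [|n IH]; [simpl; unfold D; lra|].
    change (rsum (fun i => A * 2 ^ S i * D ^ (S n - i)) (S (S n)))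
      with (rsum (fun i => A * 2 ^ S i * D ^ (S n - i)) (S n) + A * 2 ^ S (S n) * D ^ (S n - S n)).
    rewrite (rsum_ext _ (fun i => D * (A * 2 ^ S i * D ^ (n - i)))).
    2:{ intros i Hi; replace (S n - i)%nat with (S (n - i)) by lia; simpl; ring. }
    rewrite rsum_scal, Nat.sub_diag, IH; simpl; unfold D; ring. }
  assert (B : forall n k, (k <= n)%nat -> Cmod (psinv p k) <= D ^ k).
  { induction n as [|n IH]; intros k Hk.
    - replace k with O by lia; unfold psinv; simpl; rewrite Cmod_1; lra.
    - destruct (Nat.eq_dec k (S n)) as [->|]; [|apply IH; lia].
      rewrite psinv_S, Cmod_opp; via Cmod_csum.
      apply Rle_trans with (D ^ S n - 2 ^ S n);
        [|assert (0 < 2 ^ S n) by (apply pow_lt; lra); lra].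
      rewrite <- G; apply rsum_le; intros i Hi; rewrite Cmod_mult.
      apply Rmult_le_compat; auto using Cmod_ge_0; apply IH; lia. }
  exists (/ (2 * D)); split.
  - split; [apply Rinv_0_lt_compat; unfold D; lra|].
    rewrite <- Rinv_1; apply Rinv_lt_contravar; unfold D; lra.
  - apply absconv_geom with 1 D; try (unfold D; lra).
    + apply Rinv_pos_le; unfold D; lra.
    + replace (/ (2 * D) * D) with (/ 2) by (field; unfold D; lra); lra.
    + intros n; rewrite Rmult_1_l; apply (B n); auto.
Qed.

Theorem psinv_conv1 p : conv1 p -> p O = RtoC 1 -> (forall z, Cmod z < 1 -> CPS p z <> 0) ->
  conv1 (psinv p).
Proof.
  intros Hp Hp0 Hnz.
  destruct (psinv_small_radius p Hp) as [s [Hs Hcs]].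
  assert (Hinv : forall z, Cmod z <= s -> (CPS p z * CPS (psinv p) z = 1)%C).
  { intros z Hz; rewrite <- (CPS_mult s); auto; [|apply Hp; lra].
    rewrite (CPS_ext _ unit_seq), CPS_unit; auto; intros n; apply psinv_cconv; auto. }
  (* Cauchy's estimate. On |z| = s, 1/p is already the sum of its series, so the mean of z^(-k)/p
     gives the k-th coefficient; on |z| = r the same mean is at most 1/(c r^k), and
     [circle_mean_invariant] joins the two. *)
  assert (Main : forall r, s <= r < 1 -> exists K, forall k, Cmod (psinv p k) * r ^ k <= K).
  { intros r Hr; destruct (CPS_min_mod p r Hp Hnz ltac:(lra)) as [c [Hc Hmin]].
    exists (/ c); intros k.
    assert (Hsub : forall z, annulus s r z -> annulus 0 r z).
    { intros z [x [t [Hx Ht]]]; exists x, t; split; auto; lra. }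
    assert (TF : T2 (annulus s r) (fun z => / CPS p z)%C
        (fun z => - CPS (dcoef p) z * (/ CPS p z * / CPS p z))%C).
    { apply T2_inv with c; auto.
      eapply T2_subset; [|apply (CPS_T2 p r Hp); lra].
      intros z Hz; apply annulus_Cmod in Hz; lra. }
    destruct (T2_pow (annulus s r) r k) as [d Td].
    { intros z Hz; apply annulus_Cmod in Hz; lra. }
    assert (TP : T2 (annulus s r) (fun z => / z ^ k)%C (fun z => - d z * (/ z ^ k * / z ^ k))%C).
    { apply T2_inv with (s ^ k); auto; [apply pow_lt; lra|].
      intros z Hz; apply annulus_Cmod in Hz; [|lra]; rewrite Cmod_pow; apply pow_incr; lra. }
    destruct (circle_mean_invariant _ _ s r ltac:(lra) (T2_mult _ _ _ _ _ TF TP)) as [K HK].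
    assert (E : forall x, 0 < x -> forall j N, (/ (circ x N j) ^ k
       = / RtoC x ^ k * cis (- (INR k * ang N j)))%C).
    { intros x Hx j N; rewrite Cpow_mult_l, cis_pow.
      assert (Hx0 : (RtoC x ^ k)%C <> 0) by (apply Cpow_nz; intros H; apply RtoC_inj in H; lra).
      assert (Hc0 : cis (INR k * ang N j) <> 0).
      { intros H; generalize (Cmod_cis (INR k * ang N j)); rewrite H, Cmod_0; lra. }
      rewrite <- (Cmult_1_l (/ (_ * _))), <- cis_0, <- (Rplus_opp_r (INR k * ang N j)), cis_add.
      field; auto. }
    apply Rle_trans with (/ c + 0); [|lra].
    assert (Hrk : 0 < r ^ k) by (apply pow_lt; lra).
    assert (Hsk : 0 < s ^ k) by (apply pow_lt; lra).
    apply le_epsilon; intros eps He; rewrite Rplus_0_r.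
    (* Two errors e, multiplied by r^k at the end, amount to eps. The mean on |z| = s gets divided
       by s^k, hence the tolerance e s^k below. *)
    set (e := eps / 2 / r ^ k).
    assert (He' : 0 < e) by (apply Rdiv_lt_0_compat; lra).
    destruct (mean_CPS (psinv p) s k (e * s ^ k) ltac:(lra) Hcs ltac:(nra)) as [N0 [HN0 HM]].
    destruct (nfloor_ex (Rabs K / e)) as [n1 Hn1].
    { apply Rmult_le_pos; [apply Rabs_pos | apply Rinv_pos_le; auto]. }
    set (N := (N0 + n1 + 2)%nat).
    assert (HN1 : Rabs K / e < INR N).
    { unfold N; rewrite !plus_INR; simpl (INR 2); generalize (pos_INR N0); lra. }
    assert (HN : 0 < INR N) by (apply lt_0_INR; unfold N; lia).
    specialize (HK N ltac:(unfold N; lia)); specialize (HM N ltac:(unfold N; lia)).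
    assert (HKe : K / INR N <= e).
    { apply Rmult_le_reg_r with (INR N); auto; unfold Rdiv; rewrite Rmult_assoc, Rinv_l, Rmult_1_r by lra.
      apply Rle_trans with (Rabs K); [apply Rle_abs|].
      replace (Rabs K) with (e * (Rabs K / e)) by (field; lra); apply Rmult_le_compat_l; lra. }
    set (m1 := mean N (fun j => / CPS p (circ r N j) * / (circ r N j) ^ k)%C) in HK.
    set (m0 := mean N (fun j => / CPS p (circ s N j) * / (circ s N j) ^ k)%C) in HK.
    assert (B1 : Cmod m1 <= / c * / r ^ k).
    { apply Cmod_mean_le; [unfold N; lia|]; intros j Hj.
      rewrite E, !Cmod_mult, Cmod_cis, Rmult_1_r by lra.
      assert (Ha : annulus 0 r (circ r N j)).
      { exists r, (ang N j); repeat split; try lra; apply ang_bound; unfold N in *; lia. }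
      assert (Hz : Cmod (circ r N j) < 1) by (rewrite Cmod_rcis; lra).
      rewrite Cmod_inv by (apply Hnz; auto).
      rewrite (Cmod_inv (RtoC r ^ k)), Cmod_pow, Cmod_R, (Rabs_pos_eq r) by
        (lra || (apply Cpow_nz; intros H; apply RtoC_inj in H; lra)).
      apply Rmult_le_compat_r; [apply Rinv_pos_le; auto|].
      apply Rinv_le_contravar; auto. }
    assert (Hsc : (RtoC s ^ k)%C <> 0) by (apply Cpow_nz; intros H; apply RtoC_inj in H; lra).
    assert (B0 : Cmod (m0 - psinv p k) <= e).
    { assert (Em : (m0 - psinv p k = / RtoC s ^ k * (mean N (fun j => CPS (psinv p) (circ s N j)
          * cis (- (INR k * ang N j))) - psinv p k * RtoC s ^ k))%C).
      { unfold Cminus at 2; rewrite Cmult_plus_distr_l, <- mean_scal; unfold m0.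
        rewrite (mean_ext N _ (fun j => / RtoC s ^ k * (CPS (psinv p) (circ s N j) * cis (- (INR k * ang N j))))%C).
        - unfold Cminus; f_equal; field; auto.
        - intros j Hj; rewrite E by lra.
          assert (Hz : Cmod (circ s N j) <= s) by (rewrite Cmod_rcis; lra).
          replace (/ CPS p (circ s N j))%C with (CPS (psinv p) (circ s N j)); [ring|].
          rewrite <- (Cmult_1_r (/ _)), <- (Hinv _ Hz); field.
          apply Hnz; lra. }
      rewrite Em, Cmod_mult, Cmod_inv, Cmod_pow, Cmod_R, Rabs_pos_eq by (auto || lra).
      apply Rmult_le_reg_l with (s ^ k); auto; rewrite <- Rmult_assoc, Rinv_r, Rmult_1_l by lra; lra. }
    assert (B : Cmod (psinv p k) <= / c * / r ^ k + e + e).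
    { replace (psinv p k) with (m1 - (m1 - m0) - (m0 - psinv p k))%C by ring.
      via Cmod_minus_le.
      assert (A := Cmod_minus_le m1 (m1 - m0)); lra. }
    apply Rle_trans with ((/ c * / r ^ k + e + e) * r ^ k); [apply Rmult_le_compat_r; lra|].
    right; unfold e; field; lra. }
  (* The coefficient bound is used at r' > r, so that r / r' < 1 gives a geometric majorant; [Main]
     also asks for r' >= s. *)
  intros r Hr; set (r' := Rmax s ((1 + r) / 2)).
  assert (Hr' : s <= r' < 1).
  { split; [apply Rmax_l | apply Rmax_lub_lt; lra]. }
  assert (Hrr : (1 + r) / 2 <= r') by apply Rmax_r.
  destruct (Main r' Hr') as [K HK].
  apply absconv_geom with K (/ r'); try lra.
  - apply Rmult_lt_reg_r with r'; [lra|]; rewrite Rmult_assoc, Rinv_l; lra.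
  - apply Rinv_pos_le; lra.
  - intros n; assert (0 < r' ^ n) by (apply pow_lt; lra); rewrite pow_inv.
    apply Rmult_le_reg_r with (r' ^ n); auto; rewrite Rmult_assoc, Rinv_l, Rmult_1_r by lra; apply HK.
Qed.

Lemma CPS_psinv p z : conv1 p -> p O = RtoC 1 -> (forall z, Cmod z < 1 -> CPS p z <> 0) ->
  Cmod z < 1 -> (CPS p z * CPS (psinv p) z = 1)%C.
Proof.
  intros Hp Hp0 Hnz Hz; assert (Hz0 := Cmod_ge_0 z).
  rewrite <- (CPS_mult (Cmod z)); auto; try lra.
  - rewrite (CPS_ext _ unit_seq), CPS_unit; auto; intros n; apply psinv_cconv; auto.
  - apply (psinv_conv1 p Hp Hp0 Hnz (Cmod z)); lra.
Qed.

(** * Grid sums of a paraboloid *)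

(** Lipschitz on the whole line: integrals then exist and split without side conditions, and Riemann
    sums have an explicit error. *)
Definition lipR (L : R) (f : R -> R) : Prop := forall x y, Rabs (f x - f y) <= L * Rabs (x - y).

Lemma lipR_continuous L f x : lipR L f -> continuous f x.
Proof.
  intros H; apply (filterlim_locally (U := R_UniformSpace)); intros eps.
  assert (HL : 0 < Rabs L + 1) by (generalize (Rabs_pos L); lra).
  assert (Hd : 0 < eps / (Rabs L + 1)) by (apply Rdiv_lt_0_compat; auto; apply cond_pos).
  exists (mkposreal _ Hd); intros y Hy; change (Rabs (y - x) < eps / (Rabs L + 1)) in Hy.
  change (Rabs (f y - f x) < eps).
  eapply Rle_lt_trans; [apply H|].
  apply Rle_lt_trans with ((Rabs L + 1) * Rabs (y - x)).
  - apply Rmult_le_compat_r; [apply Rabs_pos | generalize (Rle_abs L); lra].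
  - replace (pos eps) with ((Rabs L + 1) * (eps / (Rabs L + 1))) by (field; lra).
    apply Rmult_lt_compat_l; auto.
Qed.

Lemma lipR_ex_RInt L f a b : lipR L f -> ex_RInt f a b.
Proof.
  intros H; apply (ex_RInt_continuous (V := R_CompleteNormedModule)).
  intros; eapply lipR_continuous; eauto.
Qed.

Lemma lipR_RInt_Chasles L f a b c : lipR L f -> RInt f a c = RInt f a b + RInt f b c.
Proof.
  intros H; symmetry; apply (RInt_Chasles f a b c); eapply lipR_ex_RInt; eauto.
Qed.

Lemma riemann_sum_RInt L f u h n : 0 <= L -> lipR L f -> 0 < h ->
  Rabs (rsum (fun i => h * f (u + INR i * h)) n - RInt f u (u + INR n * h)) <= L * h * (INR n * h).
Proof.
  intros HL Hf Hh; induction n as [|n IH].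
  - simpl; rewrite Rmult_0_l, Rplus_0_r, RInt_point; unfold zero; simpl.
    rewrite Rminus_0_r, Rabs_R0; nra.
  - rewrite (lipR_RInt_Chasles L f u (u + INR n * h)) by auto; simpl rsum.
    set (p := u + INR n * h); replace (u + INR (S n) * h) with (p + h) by (unfold p; rewrite S_INR; ring).
    assert (A : Rabs (RInt f p (p + h) - h * f p) <= h * (L * h)).
    { assert (E : RInt (fun x => minus (f x) (f p)) p (p + h) = RInt f p (p + h) - h * f p).
      { rewrite (RInt_minus f (fun _ => f p)); [|eapply lipR_ex_RInt; eauto|apply ex_RInt_const].
        rewrite RInt_const; unfold minus, plus, opp, scal; simpl; unfold mult; simpl; ring. }
      rewrite <- E; eapply Rle_trans; [apply (abs_RInt_le_const _ _ _ (L * h)); [lra| |]|right; ring].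
      - apply (ex_RInt_minus (V := R_NormedModule)); [eapply lipR_ex_RInt; eauto|apply ex_RInt_const].
      - intros t Ht; via Hf; apply Rmult_le_compat_l; auto.
        rewrite Rabs_pos_eq; lra. }
    replace (rsum (fun i => h * f (u + INR i * h)) n + h * f p - (RInt f u p + RInt f p (p + h)))
      with ((rsum (fun i => h * f (u + INR i * h)) n - RInt f u p) - (RInt f p (p + h) - h * f p)) by ring.
    via Rabs_triang; rewrite Rabs_Ropp, S_INR; fold p in IH; lra.
Qed.

Lemma RInt_nonneg_widen L f a b a' b' : lipR L f -> (forall x, 0 <= f x) ->
  a' <= a -> a <= b -> b <= b' -> RInt f a b <= RInt f a' b'.
Proof.
  intros Hf H0 H1 H2 H3.
  assert (E : forall x y, ex_RInt f x y) by (intros; eapply lipR_ex_RInt; eauto).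
  rewrite (lipR_RInt_Chasles L f a' a b'), (lipR_RInt_Chasles L f a b b') by auto.
  assert (0 <= RInt f a' a) by (apply RInt_ge_0; auto).
  assert (0 <= RInt f b b') by (apply RInt_ge_0; auto).
  lra.
Qed.

(** Section of the paraboloid 1 - x^2 - y^2 at fixed y, where c is the half-width of the section. *)
Definition slice (c x : R) : R := Rmax 0 (c ^ 2 - x ^ 2).

Lemma slice_lip c : 0 <= c <= 1 -> lipR 2 (slice c).
Proof.
  intros Hc.
  assert (P : forall x y, slice c x - slice c y <= 2 * Rabs (x - y)).
  { intros x y; unfold slice.
    assert (Hy := Rmax_l 0 (c ^ 2 - y ^ 2)); assert (Hy' := Rmax_r 0 (c ^ 2 - y ^ 2)).
    assert (Hxy := Rabs_pos (x - y)).
    destruct (Rle_dec (c ^ 2 - x ^ 2) 0) as [Hx|Hx]; [rewrite (Rmax_left _ _ Hx); lra|].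
    rewrite (Rmax_right 0 (c ^ 2 - x ^ 2)) by lra.
    assert (Ex : Rabs x ^ 2 = x ^ 2) by apply pow2_abs.
    assert (Ey : Rabs y ^ 2 = y ^ 2) by apply pow2_abs.
    assert (Hx0 := Rabs_pos x); assert (Hy0 := Rabs_pos y).
    assert (T : Rabs y - Rabs x <= Rabs (x - y)).
    { rewrite Rabs_minus_sym; apply Rabs_triang_inv. }
    assert (Hxc : Rabs x <= c) by nra.
    destruct (Rle_dec (Rabs y) c) as [Hyc|Hyc]; nra. }
  intros x y; apply Rabs_le; split; [|apply P].
  generalize (P y x); rewrite (Rabs_minus_sym y x); lra.
Qed.

Lemma slice_nonneg c x : 0 <= slice c x.
Proof. apply Rmax_l. Qed.

Lemma slice_RInt c a b : 0 <= c <= 1 -> a <= - c -> c <= b -> RInt (slice c) a b = 4 / 3 * c ^ 3.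
Proof.
  intros Hc Ha Hb.
  assert (S := slice_lip c Hc).
  rewrite (lipR_RInt_Chasles 2 _ a (- c) b), (lipR_RInt_Chasles 2 _ (- c) c b) by auto.
  assert (Z : forall x y, x <= y -> (y <= - c \/ c <= x) -> RInt (slice c) x y = 0).
  { intros x y Hxy H; rewrite (RInt_ext _ (fun _ => 0)).
    - rewrite RInt_const; unscal; ring.
    - intros t; rewrite Rmin_left, Rmax_right by auto; intros Ht.
      apply Rmax_left; destruct H; nra. }
  rewrite (Z a (- c)), (Z c b) by (auto || lra).
  rewrite (RInt_ext _ (fun x => c ^ 2 - x ^ 2)).
  - assert (I : is_RInt (fun x => c ^ 2 - x ^ 2) (- c) c
        (minus (c ^ 2 * c - c ^ 3 / 3) (c ^ 2 * (- c) - (- c) ^ 3 / 3))).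
    { apply (is_RInt_derive (fun x => c ^ 2 * x - x ^ 3 / 3)).
      - intros x _; auto_derive; auto; field.
      - intros x _; apply (ex_derive_continuous (fun x => c ^ 2 - x ^ 2)); auto_derive; auto. }
    rewrite (is_RInt_unique _ _ _ _ I); unfold minus, plus, opp; simpl; field.
  - intros t; rewrite Rmin_left, Rmax_right by lra; intros Ht; apply Rmax_right; nra.
Qed.

Lemma slice_RInt_le c a b : 0 <= c <= 1 -> a <= b -> RInt (slice c) a b <= 4 / 3 * c ^ 3.
Proof.
  intros Hc Hab; rewrite <- (slice_RInt c (Rmin a (-c)) (Rmax b c)); auto using Rmin_r, Rmax_r.
  apply RInt_nonneg_widen with 2; auto using slice_lip, slice_nonneg, Rmin_l, Rmax_l.
Qed.

Definition halfchord (y : R) : R := sqrt (Rmax 0 (1 - y ^ 2)).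

Lemma halfchord_sq y : halfchord y ^ 2 = Rmax 0 (1 - y ^ 2).
Proof. apply pow2_sqrt, Rmax_l. Qed.

Lemma halfchord_bounds y : 0 <= halfchord y <= 1.
Proof.
  split; [apply sqrt_pos|].
  rewrite <- sqrt_1; apply sqrt_le_1_alt, Rmax_lub; nra.
Qed.

Definition sect (y : R) : R := 4 / 3 * halfchord y ^ 3.

Lemma sect_nonneg y : 0 <= sect y.
Proof. assert (H := halfchord_bounds y); unfold sect; assert (0 <= halfchord y ^ 3) by (apply pow_le; lra); lra. Qed.

(** [halfchord] has vertical tangents at -1 and 1, but its cube is Lipschitz: for c, d in [0, 1],
    |c^3 - d^3| <= (3/2) |c^2 - d^2|, and the square of [halfchord] is [slice 1], with constant 2.
    Thus 4 = (4/3)(3/2) 2. *)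
Lemma sect_lip : lipR 4 sect.
Proof.
  intros x y; unfold sect.
  assert (Hx := halfchord_bounds x); assert (Hy := halfchord_bounds y).
  assert (S : lipR 2 (slice 1)) by (apply slice_lip; lra).
  assert (A := S x y); unfold slice in A.
  replace (1 ^ 2 - x ^ 2) with (1 - x ^ 2) in A by ring.
  replace (1 ^ 2 - y ^ 2) with (1 - y ^ 2) in A by ring.
  rewrite <- !halfchord_sq in A.
  set (c := halfchord x) in *; set (d := halfchord y) in *.
  replace (4 / 3 * c ^ 3 - 4 / 3 * d ^ 3) with (4 / 3 * ((c - d) * (c ^ 2 + c * d + d ^ 2))) by ring.
  rewrite !Rabs_mult, (Rabs_pos_eq (4 / 3)) by lra.
  replace (c ^ 2 - d ^ 2) with ((c - d) * (c + d)) in A by ring.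
  rewrite Rabs_mult in A; rewrite (Rabs_pos_eq (c + d)) in A by lra.
  rewrite (Rabs_pos_eq (c ^ 2 + c * d + d ^ 2)) by nra.
  assert (B : c ^ 2 + c * d + d ^ 2 <= 3 / 2 * (c + d)) by nra.
  assert (P := Rabs_pos (c - d)); nra.
Qed.

(** With y = sin t the integrand becomes (4/3) cos^4 t. The value is the volume under the
    paraboloid, to which all later grid sums are compared. *)
Lemma sect_RInt_unit : RInt sect (-1) 1 = PI / 2.
Proof.
  assert (HP := PI_RGT_0).
  replace (-1) with (sin (- (PI / 2))) by (rewrite sin_neg, sin_PI2; ring).
  rewrite <- sin_PI2 at 1.
  rewrite <- (RInt_comp sect sin cos).
  - rewrite (RInt_ext _ (fun t => 4 / 3 * cos t ^ 4)).
    + set (F := fun t => 4 / 3 * (3 / 8 * t + 3 / 8 * (sin t * cos t) + 1 / 4 * (sin t * cos t ^ 3))).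
      assert (I : is_RInt (fun t => 4 / 3 * cos t ^ 4) (- (PI / 2)) (PI / 2) (minus (F (PI / 2)) (F (- (PI / 2))))).
      { apply (is_RInt_derive (V := R_CompleteNormedModule) F).
        - intros t _; unfold F; auto_derive; auto.
          assert (H := sin2_cos2 t); unfold Rsqr in H.
          set (s := sin t) in *; set (c := cos t) in *.
          apply Rminus_diag_uniq; ring_simplify.
          replace (s ^ 2) with (1 - c ^ 2) by (simpl; lra); field.
        - intros t _; apply (ex_derive_continuous (fun t => 4 / 3 * cos t ^ 4)); auto_derive; auto. }
      rewrite (is_RInt_unique _ _ _ _ I); unfold F, minus, plus, opp; simpl.
      rewrite cos_neg, cos_PI2; field.
    + intros t; rewrite Rmin_left, Rmax_right by lra; intros Ht.
      assert (Hc : 0 <= cos t) by (apply cos_ge_0; lra).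
      unscal; unfold sect, halfchord.
      replace (1 - sin t ^ 2) with (cos t ^ 2) by (generalize (sin2_cos2 t); unfold Rsqr; simpl; lra).
      rewrite Rmax_right, sqrt_pow2 by (auto; apply pow_le; auto); ring.
  - intros t _; apply lipR_continuous with 4, sect_lip.
  - intros t _; split; [auto_derive; auto; ring|].
    apply (ex_derive_continuous cos); auto_derive; auto.
Qed.

Lemma sect_zero y : 1 <= Rabs y -> sect y = 0.
Proof.
  intros H; unfold sect, halfchord; rewrite Rmax_left, sqrt_0; [ring|].
  rewrite <- (pow2_abs y); nra.
Qed.

Lemma sect_RInt a b : a <= -1 -> 1 <= b -> RInt sect a b = PI / 2.
Proof.
  intros Ha Hb.
  rewrite (lipR_RInt_Chasles 4 _ a (-1) b), (lipR_RInt_Chasles 4 _ (-1) 1 b) by apply sect_lip.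
  assert (Z : forall x y, x <= y -> (y <= -1 \/ 1 <= x) -> RInt sect x y = 0).
  { intros x y Hxy H; rewrite (RInt_ext _ (fun _ => 0)).
    - rewrite RInt_const; unscal; ring.
    - intros t; rewrite Rmin_left, Rmax_right by auto; intros Ht; apply sect_zero.
      destruct H; [rewrite Rabs_left | rewrite Rabs_pos_eq]; lra. }
  rewrite (Z a (-1)), (Z 1 b), sect_RInt_unit by (lra || (left; lra) || (right; lra)).
  rewrite Rplus_0_l; apply Rplus_0_r.
Qed.

Lemma sect_RInt_le a b : a <= b -> RInt sect a b <= PI / 2.
Proof.
  intros Hab; rewrite <- (sect_RInt (Rmin a (-1)) (Rmax b 1)); auto using Rmin_r, Rmax_r.
  apply RInt_nonneg_widen with 4; auto using sect_lip, sect_nonneg, Rmin_l, Rmax_l.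
Qed.

Definition bump (x y : R) : R := Rmax 0 (1 - x ^ 2 - y ^ 2).

Lemma bump_slice x y : bump x y = slice (halfchord y) x.
Proof.
  unfold bump, slice; rewrite halfchord_sq.
  destruct (Rle_dec (1 - y ^ 2) 0) as [H|H].
  - rewrite (Rmax_left 0 (1 - y ^ 2)), !Rmax_left by nra; auto.
  - rewrite (Rmax_right 0 (1 - y ^ 2)) by lra; f_equal; ring.
Qed.

Lemma bump_nonneg x y : 0 <= bump x y.
Proof. apply Rmax_l. Qed.

Definition grid_bump (u v h k : R) (n m : nat) : R :=
  rsum (fun i => rsum (fun j => h * k * bump (u + INR i * h) (v + INR j * k)) m) n.

Lemma grid_bump_swap u v h k n m : grid_bump u v h k n m =
  rsum (fun j => k * rsum (fun i => h * slice (halfchord (v + INR j * k)) (u + INR i * h)) n) m.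
Proof.
  unfold grid_bump; rewrite rsum_swap; apply rsum_ext; intros j _.
  rewrite <- rsum_scal; apply rsum_ext; intros i _; rewrite bump_slice; ring.
Qed.

(** Fubini by hand: a Riemann sum over each section, then one of [sect]. The error terms carry the
    Lipschitz constants 4 of [sect] and 2 of [slice]. The upper bound holds wherever the grid lies;
    the lower one requires it to cover [-1, 1]^2. *)
Lemma grid_bump_le u v h k n m : 0 < h -> 0 < k ->
  grid_bump u v h k n m <= PI / 2 + 4 * k * (INR m * k) + 2 * h * (INR n * h) * (INR m * k).
Proof.
  intros Hh Hk; rewrite grid_bump_swap.
  apply Rle_trans with (rsum (fun j => k * sect (v + INR j * k) + k * (2 * h * (INR n * h))) m).
  - apply rsum_le; intros j _; rewrite <- Rmult_plus_distr_l; apply Rmult_le_compat_l; [lra|].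
    assert (Hc := halfchord_bounds (v + INR j * k)).
    assert (A := riemann_sum_RInt 2 _ u h n ltac:(lra) (slice_lip _ Hc) Hh).
    apply Rabs_le_between in A.
    assert (B := slice_RInt_le _ u (u + INR n * h) Hc ltac:(generalize (pos_INR n); nra)).
    unfold sect; lra.
  - rewrite rsum_plus, rsum_const.
    assert (A := riemann_sum_RInt 4 _ v k m ltac:(lra) sect_lip Hk); apply Rabs_le_between in A.
    assert (B := sect_RInt_le v (v + INR m * k) ltac:(generalize (pos_INR m); nra)).
    lra.
Qed.

Lemma grid_bump_ge u v h k n m : 0 < h -> 0 < k -> u <= -1 -> v <= -1 ->
  1 <= u + INR n * h -> 1 <= v + INR m * k ->
  PI / 2 - 4 * k * (INR m * k) - 2 * h * (INR n * h) * (INR m * k) <= grid_bump u v h k n m.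
Proof.
  intros Hh Hk Hu Hv Hn Hm; rewrite grid_bump_swap.
  apply Rle_trans with (rsum (fun j => k * sect (v + INR j * k) + k * (- (2 * h * (INR n * h)))) m).
  - rewrite rsum_plus, rsum_const.
    assert (A := riemann_sum_RInt 4 _ v k m ltac:(lra) sect_lip Hk); apply Rabs_le_between in A.
    assert (B := sect_RInt v (v + INR m * k) Hv Hm).
    lra.
  - apply rsum_le; intros j _; rewrite <- Rmult_plus_distr_l; apply Rmult_le_compat_l; [lra|].
    assert (Hc := halfchord_bounds (v + INR j * k)).
    assert (A := riemann_sum_RInt 2 _ u h n ltac:(lra) (slice_lip _ Hc) Hh).
    apply Rabs_le_between in A.
    assert (B := slice_RInt _ u (u + INR n * h) Hc ltac:(lra) ltac:(lra)).
    unfold sect; lra.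
Qed.

(** * The area inequality *)

Definition dsum (f : nat -> nat -> R) (n m : nat) : R := rsum (fun i => rsum (f i) m) n.

Lemma dsum_le f g n m : (forall i j, (i < n)%nat -> (j < m)%nat -> f i j <= g i j) ->
  dsum f n m <= dsum g n m.
Proof. intros H; apply rsum_le; intros i Hi; apply rsum_le; intros j Hj; auto. Qed.

Lemma dsum_ext f g n m : (forall i j, (i < n)%nat -> (j < m)%nat -> f i j = g i j) ->
  dsum f n m = dsum g n m.
Proof. intros H; apply rsum_ext; intros i Hi; apply rsum_ext; intros j Hj; auto. Qed.

Lemma dsum_scal c f n m : dsum (fun i j => c * f i j) n m = c * dsum f n m.
Proof. unfold dsum; rewrite <- rsum_scal; apply rsum_ext; intros; apply rsum_scal. Qed.

Lemma dsum_plus f g n m : dsum (fun i j => f i j + g i j) n m = dsum f n m + dsum g n m.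
Proof. unfold dsum; rewrite <- rsum_plus; apply rsum_ext; intros; apply rsum_plus. Qed.

Lemma dsum_const c n m : dsum (fun _ _ => c) n m = INR n * INR m * c.
Proof. unfold dsum; rewrite (rsum_const c), rsum_const; ring. Qed.

Lemma dsum_swap F n m p q :
  dsum (fun i j => dsum (F i j) p q) n m = dsum (fun k l => dsum (fun i j => F i j k l) n m) p q.
Proof.
  unfold dsum.
  transitivity (rsum (fun i => rsum (fun k => rsum (fun l => rsum (fun j => F i j k l) m) q) p) n).
  - apply rsum_ext; intros i _; rewrite rsum_swap.
    apply rsum_ext; intros k _; apply rsum_swap.
  - rewrite rsum_swap; apply rsum_ext; intros k _; apply rsum_swap.
Qed.

(** The factor 1/s^2 keeps the integral over the plane equal to pi/2 for every s. *)
Definition kern (s : R) (w : C) : R := / s ^ 2 * Rmax 0 (1 - Cmod w ^ 2 / s ^ 2).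

Lemma kern_nonneg s w : 0 < s -> 0 <= kern s w.
Proof.
  intros Hs; apply Rmult_le_pos; [apply Rinv_pos_le, pow_lt; auto | apply Rmax_l].
Qed.

Lemma kern_bump s w : 0 < s -> kern s w = / s ^ 2 * bump (Re w / s) (Im w / s).
Proof.
  intros Hs; unfold kern, bump; do 2 f_equal; rewrite Cmod2_alt; field; lra.
Qed.

Lemma kern_zero s w : 0 < s -> s <= Cmod w -> kern s w = 0.
Proof.
  intros Hs Hw; unfold kern; rewrite Rmax_left; [ring|].
  assert (s ^ 2 <= Cmod w ^ 2) by (apply pow_incr; lra).
  assert (0 < s ^ 2) by (apply pow_lt; auto).
  apply Rmult_le_reg_r with (s ^ 2); auto; unfold Rdiv.
  rewrite Rmult_minus_distr_r, Rmult_assoc, Rinv_l; lra.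
Qed.

Definition pt (y0 d : R) (N i j : nat) : C := (y0 + INR i * d, ang N j).

Definition strip (y0 y1 : R) (z : C) : Prop := y0 <= Re z <= y1.

Definition ishift (t : R) : C := (0, t).

(** Two imaginary parts in [0, 2 pi] can differ by no other multiple of 2 pi. *)
Definition wrap (t : R) : Prop := t = - (2 * PI) \/ t = 0 \/ t = 2 * PI.

(* Points with |G'| < m are discarded: the linearization of G has no small relative error there,
   and they carry little area. *)
Definition cutoff (m : R) (x : R) : R := if Rle_dec m x then x ^ 2 else 0.

(** From X <= Y + t and Y < 1 follows X^2 <= Y^2 + 2 t + t^2, and t^2 <= t; hence the 3 t. *)
Lemma linear_kernel_bound a0 X Y t : 0 <= t <= / 2 -> 0 <= X -> 0 <= Y < 1 -> X - t <= Y ->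
  a0 = 1 + 3 * t -> 1 - Y ^ 2 <= a0 - X ^ 2.
Proof. intros; subst; nra. Qed.

(* A point p contributing to the kernel sum around w is, up to a period, within O(s) of any other
   contributing point q, so G is linear there up to a relative error tau. *)
Lemma kern_linearize (G D : C -> C) y0 y1 M m c eta s tau w p q t :
  0 < M -> 0 < m -> 0 < s -> 2 * s < c -> eta = m / (2 * M) -> tau = 16 * M * s / m ^ 2 -> tau <= / 2 ->
  (forall z w, strip y0 y1 z -> strip y0 y1 w ->
     Cmod (G w - G z - D z * (w - z)) <= M * Cmod (w - z) ^ 2) ->
  (forall z w, strip y0 y1 z -> strip y0 y1 w -> Cmod (D w - D z) <= 2 * M * Cmod (w - z)) ->
  strip y0 y1 p -> strip y0 y1 q -> m <= Cmod (D q) ->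
  G (p + ishift t)%C = G p -> D (p + ishift t)%C = D p ->
  Cmod (p + ishift t - q) < eta ->
  Cmod (G q - w) < s -> Cmod (G p - w) < s ->
  let a := Cmod (D q) / (s * sqrt (1 + 3 * tau)) in
  let p0 := (q - (G q - w) / D q)%C in
  cutoff m (Cmod (D p)) * kern s (G p - w) <=
   (1 + tau) ^ 2 * (1 + 3 * tau) ^ 2 * (a ^ 2 * bump (a * (Re p - Re p0)) (a * (Im p + t - Im p0))).
Proof.
  intros HM Hm Hs Hsc Heta Htau Htau2 HT HD Hp Hq Hmq HGt HDt Hpq Hqw Hpw a p0.
  set (p' := (p + ishift t)%C) in *.
  assert (Hp' : strip y0 y1 p').
  { unfold strip, p', ishift in *; unfold Re in *; simpl; lra. }
  assert (Hdq : D q <> 0) by (intros E; rewrite E, Cmod_0 in Hmq; lra).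
  set (r := Cmod (p' - q)) in *; assert (Hr0 : 0 <= r) by apply Cmod_ge_0.
  assert (A := HT q p' Hq Hp'); fold r in A; rewrite HGt in A.
  (* Within eta = m / (2 M) the remainder M r^2 is at most half of m r, so |D q| r absorbs it; this
     gives r <= 4 s / m below. *)
  assert (HMr : M * r <= m / 2).
  { apply Rle_trans with (M * eta); [apply Rmult_le_compat_l; lra|]; rewrite Heta; right; field; lra. }
  assert (B : Cmod (G p - G q) <= 2 * s).
  { replace (G p - G q)%C with ((G p - w) - (G q - w))%C by ring.
    via Cmod_minus_le; lra. }
  assert (Hr : r <= 4 * s / m).
  { assert (E1 : Cmod (D q) * r <= 2 * s + M * r ^ 2).
    { unfold r at 1; rewrite <- Cmod_mult.
      replace (D q * (p' - q))%C with ((G p - G q) - (G p - G q - D q * (p' - q)))%C by ring.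
      via Cmod_minus_le; lra. }
    assert (E2 : m * r <= Cmod (D q) * r) by (apply Rmult_le_compat_r; auto).
    assert (E3 : M * r ^ 2 <= m / 2 * r) by (replace (M * r ^ 2) with (M * r * r) by ring; apply Rmult_le_compat_r; auto).
    apply Rmult_le_reg_l with m; auto; replace (m * (4 * s / m)) with (4 * s) by (field; lra); lra. }
  assert (Htau0 : 0 < tau) by (rewrite Htau; apply Rdiv_lt_0_compat; [repeat apply Rmult_lt_0_compat; lra | apply pow_lt; auto]).
  (* [tau] is M (4 s / m)^2 / s, the size of the remainder relative to the radius s of the
     kernel. *)
  assert (Hr2 : M * r ^ 2 <= tau * s).
  { apply Rle_trans with (M * (4 * s / m) ^ 2).
    - apply Rmult_le_compat_l; [lra|]; apply pow_incr; lra.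
    - rewrite Htau; right; field; lra. }
  assert (HDp : Cmod (D p) <= Cmod (D q) * (1 + tau)).
  { assert (E := HD q p' Hq Hp'); rewrite HDt in E; fold r in E.
    assert (E1 : 2 * M * r <= m * tau).
    { apply Rle_trans with (2 * M * (4 * s / m)); [apply Rmult_le_compat_l; lra|].
      rewrite Htau; replace (m * (16 * M * s / m ^ 2)) with (16 * (M * s / m)) by (field; lra).
      replace (2 * M * (4 * s / m)) with (8 * (M * s / m)) by (field; lra).
      assert (0 < M * s / m) by (apply Rdiv_lt_0_compat; auto; apply Rmult_lt_0_compat; auto); lra. }
    assert (E2 : m * tau <= Cmod (D q) * tau) by (apply Rmult_le_compat_r; lra).
    assert (E3 := Cmod_triangle (D p - D q) (D q)); replace (D p - D q + D q)%C with (D p) in E3 by ring.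
    lra. }
  set (lam := sqrt (1 + 3 * tau)) in *.
  assert (Hl2 : lam ^ 2 = 1 + 3 * tau) by (unfold lam; apply pow2_sqrt; lra).
  assert (Hl : 0 < lam) by (unfold lam; apply sqrt_lt_R0; lra).
  assert (Ha : 0 < a) by (apply Rdiv_lt_0_compat; [lra | apply Rmult_lt_0_compat; auto]).
  set (X := Cmod (D q) * Cmod (p' - p0) / s).
  set (Y := Cmod (G p - w) / s).
  assert (HX0 : 0 <= X).
  { unfold X; apply Rmult_le_pos; [apply Rmult_le_pos; apply Cmod_ge_0 | apply Rinv_pos_le; auto]. }
  assert (HY0 : 0 <= Y) by (apply Rmult_le_pos; [apply Cmod_ge_0 | apply Rinv_pos_le; auto]).
  assert (HY1 : Y < 1).
  { unfold Y; apply Rmult_lt_reg_r with s; auto; unfold Rdiv; rewrite Rmult_assoc, Rinv_l; lra. }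
  assert (EX : X * s = Cmod (D q * (p' - p0))) by (rewrite Cmod_mult; unfold X; field; lra).
  assert (EY : Y * s = Cmod (G p - w)) by (unfold Y; field; lra).
  (* [p0] is the zero of the linearization of G - w at q, so X and Y are the linear model and the
     true value of |G p - w| / s. *)
  assert (HXY : X - tau <= Y).
  { apply Rmult_le_reg_r with s; auto; rewrite Rmult_minus_distr_r, EX, EY.
    replace (D q * (p' - p0))%C with ((G p - w) - (G p - G q - D q * (p' - q)))%C
      by (unfold p0; field; auto).
    generalize (Cmod_minus_le (G p - w) (G p - G q - D q * (p' - q))); lra. }
  assert (HK : Rmax 0 (1 - Cmod (G p - w) ^ 2 / s ^ 2) <=
     (1 + 3 * tau) * bump (a * (Re p - Re p0)) (a * (Im p + t - Im p0))).
  { replace (Cmod (G p - w) ^ 2 / s ^ 2) with (Y ^ 2) by (unfold Y; field; lra).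
    assert (F : 1 - Y ^ 2 <= 1 + 3 * tau - X ^ 2).
    { apply (linear_kernel_bound (1 + 3 * tau) X Y tau); lra. }
    apply Rmax_lub; [apply Rmult_le_pos; [lra | apply bump_nonneg]|].
    (* The bound 1 + 3 tau - X^2 is again a paraboloid, higher by the factor 1 + 3 tau and wider by
       its square root, which explains the root in [a]. *)
    apply Rle_trans with ((1 + 3 * tau) * (1 - (a * (Re p - Re p0)) ^ 2 - (a * (Im p + t - Im p0)) ^ 2));
      [|apply Rmult_le_compat_l; [lra | apply Rmax_r]].
    via F; right.
    assert (EX2 : X ^ 2 = lam ^ 2 * (a ^ 2 * Cmod (p' - p0) ^ 2)) by (unfold X, a; field; lra).
    rewrite EX2, Cmod2_alt, Hl2.
    replace (Re (p' - p0)) with (Re p - Re p0) by (unfold p', ishift, Re; simpl; ring).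
    replace (Im (p' - p0)) with (Im p + t - Im p0) by (unfold p', ishift, Im; simpl; ring).
    ring. }
  set (Bm := bump (a * (Re p - Re p0)) (a * (Im p + t - Im p0))) in *.
  assert (HB : 0 <= Bm) by apply bump_nonneg.
  assert (Hc : cutoff m (Cmod (D p)) <= (Cmod (D q) * (1 + tau)) ^ 2).
  { unfold cutoff; destruct (Rle_dec m (Cmod (D p))).
    - apply pow_incr; split; auto using Cmod_ge_0.
    - apply pow2_ge_0. }
  unfold kern.
  assert (Hs2 : 0 < / s ^ 2) by (apply Rinv_0_lt_compat, pow_lt; auto).
  apply Rle_trans with ((Cmod (D q) * (1 + tau)) ^ 2 * (/ s ^ 2 * ((1 + 3 * tau) * Bm))).
  - apply Rmult_le_compat; auto.
    + unfold cutoff; destruct (Rle_dec _ _); [apply pow2_ge_0 | lra].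
    + apply Rmult_le_pos; [lra | apply Rmax_l].
    + apply Rmult_le_compat_l; lra.
  - right; unfold a.
    replace (1 + 3 * tau) with (lam ^ 2); field; lra.
Qed.

Definition box (y0 y1 : R) (z : C) : Prop := strip y0 y1 z /\ 0 <= Im z <= 2 * PI.

(** Injectivity modulo 2 pi i in uniform form: smearing yields images that are only close to each
    other, not equal. *)
Definition unif_inj (G : C -> C) (y0 y1 : R) : Prop :=
  forall eta, 0 < eta -> exists c, 0 < c /\ forall z w, box y0 y1 z -> box y0 y1 w ->
    Cmod (G z - G w) < c -> exists t, wrap t /\ Cmod (z + ishift t - w) < eta.

Definition periodic (G : C -> C) : Prop := forall t z, wrap t -> G (z + ishift t)%C = G z.

Lemma rsum_zero f n : (forall i, (i < n)%nat -> f i = 0) -> rsum f n = 0.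
Proof.
  intros H; rewrite (rsum_ext _ (fun _ => 0)) by auto; rewrite rsum_const; ring.
Qed.

Lemma rsum_nonzero f n : rsum f n <> 0 -> exists i, (i < n)%nat /\ f i <> 0.
Proof.
  intros H; apply NNPP; intros Hn; apply H, rsum_zero; intros i Hi.
  apply NNPP; intros Hf; apply Hn; exists i; auto.
Qed.

Lemma dsum_nonzero f n m : dsum f n m <> 0 -> exists i j, (i < n)%nat /\ (j < m)%nat /\ f i j <> 0.
Proof.
  intros H; apply rsum_nonzero in H; destruct H as [i [Hi H]].
  apply rsum_nonzero in H; destruct H as [j [Hj H]]; exists i, j; auto.
Qed.

Definition bump3 (a x t : R) (p0 : C) : R :=
  bump (a * (x - Re p0)) (a * (t + - (2 * PI) - Im p0))
  + bump (a * (x - Re p0)) (a * (t + 0 - Im p0))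
  + bump (a * (x - Re p0)) (a * (t + 2 * PI - Im p0)).

(** N steps of size b make one period, so the three translates join into a single grid with 3 N
    nodes in the imaginary direction. *)
Lemma grid_bump_three_periods a d y0 p0 N n : (0 < N)%nat ->
  let b := 2 * PI / INR N in
  dsum (fun i j => (a * d) * (a * b) * bump3 a (y0 + INR i * d) (ang N j) p0) n N
  = grid_bump (a * (y0 - Re p0)) (a * (- (2 * PI) - Im p0)) (a * d) (a * b) n (N + N + N).
Proof.
  intros HN b; assert (HN' : 0 < INR N) by (apply lt_0_INR; auto).
  unfold dsum, grid_bump, bump3; apply rsum_ext; intros i _.
  rewrite !rsum_add, <- !rsum_plus; apply rsum_ext; intros j _.
  rewrite !plus_INR; unfold b, ang.
  replace (a * (y0 - Re p0) + INR i * (a * d)) with (a * (y0 + INR i * d - Re p0)) by ring.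
  replace (a * (- (2 * PI) - Im p0) + INR j * (a * (2 * PI / INR N)))
    with (a * (2 * PI * INR j / INR N + - (2 * PI) - Im p0)) by (field; lra).
  replace (a * (- (2 * PI) - Im p0) + (INR N + INR j) * (a * (2 * PI / INR N)))
    with (a * (2 * PI * INR j / INR N + 0 - Im p0)) by (field; lra).
  replace (a * (- (2 * PI) - Im p0) + (INR N + INR N + INR j) * (a * (2 * PI / INR N)))
    with (a * (2 * PI * INR j / INR N + 2 * PI - Im p0)) by (field; lra).
  ring.
Qed.

Lemma quartic_bound t : 0 <= t <= / 10 -> (1 + t) ^ 2 * (1 + 3 * t) ^ 2 <= 1 + 20 * t.
Proof.
  intros H.
  assert (A : (1 + t) * (1 + 3 * t) <= 1 + 5 * t) by nra.
  replace ((1 + t) ^ 2 * (1 + 3 * t) ^ 2) with (((1 + t) * (1 + 3 * t)) ^ 2) by ring.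
  apply Rle_trans with ((1 + 5 * t) ^ 2); [apply pow_incr; nra | nra].
Qed.

Lemma archi_nat x : exists n, (0 < n)%nat /\ x <= INR n.
Proof.
  destruct (nfloor_ex (Rabs x)) as [n Hn]; [apply Rabs_pos|].
  exists (S n); split; [lia|]; rewrite S_INR; generalize (Rle_abs x); lra.
Qed.

Lemma INR_div_le K e n0 n : 0 <= K -> 0 < e -> K / e <= INR n0 -> (0 < n0)%nat -> (n0 <= n)%nat ->
  K / INR n <= e.
Proof.
  intros HK He H H0 Hn; apply le_INR in Hn; apply lt_0_INR in H0.
  apply Rmult_le_reg_r with (INR n); [lra|].
  replace (K / INR n * INR n) with (e * (K / e)) by (field; lra).
  apply Rmult_le_compat_l; lra.
Qed.

(** Discrete form of the fact that a neighbourhood of w is covered at most once. If some grid point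
    q contributes, [kern_linearize] at q bounds every contribution by one paraboloid and its
    translates by a period, whose grid sum is at most about pi/2. The threshold n0 does not depend
    on w, because the scale [a] stays below [A]. *)
Lemma multiplicity_bound (G D : C -> C) y0 y1 m e : y0 < y1 ->
  T2 (strip y0 y1) G D -> periodic G -> periodic D -> unif_inj G y0 y1 ->
  0 < m -> 0 < e <= 1 ->
  exists s0, 0 < s0 /\ forall s, 0 < s < s0 -> exists n0, (0 < n0)%nat /\
   forall n N w, (n0 <= n)%nat -> (n0 <= N)%nat ->
    let d := (y1 - y0) / INR n in let b := 2 * PI / INR N in
    dsum (fun i j => d * b * (cutoff m (Cmod (D (pt y0 d N i j))) * kern s (G (pt y0 d N i j) - w))) n N
      <= PI / 2 * (1 + e).
Proof.
  intros Hy TG PG PD Inj Hm He.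
  destruct (T2_lip' _ _ _ TG) as [L [HL HLip]]; destruct TG as [M0 [HM0 [Hb HT]]].
  set (M := M0 + L).
  assert (HM : 0 < M) by (unfold M; lra).
  destruct (Inj (m / (2 * M))) as [c [Hc Hinj]]; [apply Rdiv_lt_0_compat; lra|].
  assert (HP := PI_RGT_0).
  (* The first bound makes any two contributing points satisfy |G p - G q| < c; the second makes tau
     <= e/40, so that [quartic_bound] costs at most e/2. *)
  set (s0 := Rmin (c / 2) (m ^ 2 / (16 * M) * (e / 40))).
  assert (Hmm : 0 < m ^ 2) by (apply pow_lt; auto).
  assert (HmM : 0 < m ^ 2 / (16 * M)) by (apply Rdiv_lt_0_compat; lra).
  exists s0; split; [apply Rmin_glb_lt; [lra | apply Rmult_lt_0_compat; lra]|].
  intros s [Hs Hss].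
  assert (Hs1 : s < c / 2) by (eapply Rlt_le_trans; [apply Hss | apply Rmin_l]).
  assert (Hs2 : s < m ^ 2 / (16 * M) * (e / 40)) by (eapply Rlt_le_trans; [apply Hss | apply Rmin_r]).
  set (tau := 16 * M * s / m ^ 2).
  assert (Htau0 : 0 < tau) by (apply Rdiv_lt_0_compat; auto; repeat apply Rmult_lt_0_compat; lra).
  assert (Htau : tau <= e / 40).
  { unfold tau; apply Rmult_le_reg_r with (m ^ 2 / (16 * M)); auto.
    replace (16 * M * s / m ^ 2 * (m ^ 2 / (16 * M))) with s by (field; lra); lra. }
  remember (M / s) as A eqn:EA.
  assert (HA : 0 < A) by (rewrite EA; apply Rdiv_lt_0_compat; auto).
  set (K1 := 4 * (2 * PI * A) * (3 * (2 * PI * A))).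
  set (K2 := 2 * (A * (y1 - y0)) * (A * (y1 - y0)) * (3 * (2 * PI * A))).
  assert (HPA : 0 <= 2 * PI * A) by (apply Rmult_le_pos; lra).
  assert (HyA : 0 <= A * (y1 - y0)) by (apply Rmult_le_pos; lra).
  assert (HK1 : 0 <= K1) by (unfold K1; apply Rmult_le_pos; lra).
  assert (HK2 : 0 <= K2) by (unfold K2; apply Rmult_le_pos; [apply Rmult_le_pos|]; lra).
  (* Makes (1 + e/2)(pi/2 + 2 e1) equal to (pi/2)(1 + e/2)(1 + e/6), which is at most (pi/2)(1 + e)
     for e <= 1. *)
  set (e1 := e * PI / 24).
  assert (He1 : 0 < e1) by (apply Rdiv_lt_0_compat; [apply Rmult_lt_0_compat; lra | lra]).
  destruct (archi_nat ((K1 + K2) / e1)) as [n0 [Hn0 Hn0']].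
  exists n0; split; auto; intros n N w Hn HN d b.
  assert (Hnp : 0 < INR n) by (apply lt_0_INR; lia).
  assert (HNp : 0 < INR N) by (apply lt_0_INR; lia).
  assert (Hd : 0 < d) by (apply Rdiv_lt_0_compat; lra).
  assert (Hbp : 0 < b) by (apply Rdiv_lt_0_compat; lra).
  assert (E1 : K1 / INR N <= e1).
  { apply INR_div_le with n0; auto; eapply Rle_trans; [|apply Hn0'].
    apply Rmult_le_compat_r; [apply Rinv_pos_le; auto | lra]. }
  assert (E2 : K2 / INR n <= e1).
  { apply INR_div_le with n0; auto; eapply Rle_trans; [|apply Hn0'].
    apply Rmult_le_compat_r; [apply Rinv_pos_le; auto | lra]. }
  assert (Hpt : forall i j, (i < n)%nat -> (j < N)%nat -> box y0 y1 (pt y0 d N i j)).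
  { intros i j Hi Hj; split.
    - unfold strip, pt, Re; simpl; apply lt_INR in Hi.
      assert (0 <= INR i * d) by (apply Rmult_le_pos; [apply pos_INR | lra]).
      assert (INR i * d <= INR n * d) by (apply Rmult_le_compat_r; lra).
      assert (INR n * d = y1 - y0) by (unfold d; field; lra); lra.
    - unfold pt, Im; simpl; apply ang_bound; lia. }
  set (S := dsum _ n N).
  destruct (Req_dec S 0) as [H0|H0].
  { rewrite H0; apply Rmult_le_pos; lra. }
  destruct (dsum_nonzero _ _ _ H0) as [iq [jq [Hiq [Hjq Hnz]]]].
  set (q := pt y0 d N iq jq) in *.
  assert (Hq := Hpt iq jq Hiq Hjq); fold q in Hq.
  assert (Hmq : m <= Cmod (D q)).
  { unfold cutoff in Hnz; destruct (Rle_dec m (Cmod (D q))); auto; exfalso; apply Hnz; ring. }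
  assert (Hqw : Cmod (G q - w) < s).
  { apply Rnot_le_lt; intros H; apply Hnz; rewrite kern_zero by auto; ring. }
  set (a := Cmod (D q) / (s * sqrt (1 + 3 * tau))).
  set (p0 := (q - (G q - w) / D q)%C).
  set (F := (1 + tau) ^ 2 * (1 + 3 * tau) ^ 2).
  assert (HF0 : 0 <= F) by (unfold F; apply Rmult_le_pos; apply pow2_ge_0).
  assert (HFe : F <= 1 + e / 2) by (unfold F; generalize (quartic_bound tau ltac:(lra)); lra).
  assert (Hsq : 1 <= sqrt (1 + 3 * tau)) by (rewrite <- sqrt_1 at 1; apply sqrt_le_1_alt; lra).
  assert (Ha : 0 < a) by (apply Rdiv_lt_0_compat; [lra | apply Rmult_lt_0_compat; lra]).
  assert (HaA : a <= A).
  { rewrite EA; unfold a; apply Rmult_le_compat; auto using Cmod_ge_0.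
    - apply Rinv_pos_le, Rmult_lt_0_compat; lra.
    - destruct (Hb q (proj1 Hq)); unfold M; lra.
    - apply Rinv_le_contravar; auto; nra. }
  assert (Bnd : S <= F * dsum (fun i j => (a * d) * (a * b) * bump3 a (y0 + INR i * d) (ang N j) p0) n N).
  { rewrite <- dsum_scal; apply dsum_le; intros i j Hi Hj; unfold bump3.
    set (p := pt y0 d N i j).
    assert (Hp := Hpt i j Hi Hj); fold p in Hp.
    set (b1 := bump _ (a * (ang N j + - (2 * PI) - Im p0))); set (b2 := bump _ (a * (ang N j + 0 - Im p0)));
    set (b3 := bump _ (a * (ang N j + 2 * PI - Im p0))).
    assert (Hb1 : 0 <= b1) by apply bump_nonneg; assert (Hb2 : 0 <= b2) by apply bump_nonneg;
    assert (Hb3 : 0 <= b3) by apply bump_nonneg.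
    apply Rle_trans with (d * b * (F * (a ^ 2 * (b1 + b2 + b3)))); [|right; ring].
    apply Rmult_le_compat_l; [left; apply Rmult_lt_0_compat; auto|].
    assert (Ha2 : 0 <= a ^ 2) by apply pow2_ge_0.
    destruct (Rlt_dec (Cmod (G p - w)) s) as [Hpw|Hpw].
    2:{ rewrite kern_zero, Rmult_0_r by lra; apply Rmult_le_pos; auto; apply Rmult_le_pos; lra. }
    destruct (Hinj p q Hp Hq) as [t [Ht Hpq]].
    { replace (G p - G q)%C with ((G p - w) - (G q - w))%C by ring.
      eapply Rle_lt_trans; [apply Cmod_minus_le|]; lra. }
    assert (X := kern_linearize G D y0 y1 M m c _ s tau w p q t HM Hm Hs ltac:(lra) eq_refl eq_refl ltac:(lra)).
    specialize (X ltac:(intros u v Hu Hv; eapply Rle_trans; [apply HT; auto|];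
       apply Rmult_le_compat_r; [apply pow2_ge_0 | unfold M; lra])).
    specialize (X ltac:(intros u v Hu Hv; eapply Rle_trans; [apply HLip; auto|];
       apply Rmult_le_compat_r; [apply Cmod_ge_0 | unfold M; lra])).
    specialize (X (proj1 Hp) (proj1 Hq) Hmq (PG t p Ht) (PD t p Ht) Hpq Hqw Hpw).
    cbv zeta in X; fold a p0 F in X.
    via X; apply Rmult_le_compat_l; auto; apply Rmult_le_compat_l; auto.
    change (Re p) with (y0 + INR i * d); change (Im p) with (ang N j).
    destruct Ht as [-> | [-> | ->]]; [fold b1 | fold b2 | fold b3]; lra. }
  unfold b in Bnd; rewrite grid_bump_three_periods in Bnd by lia; fold b in Bnd.
  assert (Had : 0 < a * d) by (apply Rmult_lt_0_compat; auto).
  assert (Hab : 0 < a * b) by (apply Rmult_lt_0_compat; auto).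
  assert (GB := grid_bump_le (a * (y0 - Re p0)) (a * (- (2 * PI) - Im p0)) (a * d) (a * b) n (N + N + N) Had Hab).
  set (g := grid_bump _ _ _ _ _ _) in *.
  assert (En : INR n * (a * d) = a * (y1 - y0)) by (unfold d; field; lra).
  assert (EN : INR (N + N + N) * (a * b) = 3 * (2 * PI * a)) by (rewrite !plus_INR; unfold b; field; lra).
  rewrite En, EN in GB.
  assert (Q1 : 4 * (a * b) * (3 * (2 * PI * a)) <= K1 / INR N).
  { replace (4 * (a * b) * (3 * (2 * PI * a))) with (4 * (2 * PI * a) * (3 * (2 * PI * a)) / INR N) by (unfold b; field; lra).
    apply Rmult_le_compat_r; [apply Rinv_pos_le; auto|].
    unfold K1; assert (0 <= 2 * PI * a <= 2 * PI * A) by (split; [apply Rmult_le_pos; lra | apply Rmult_le_compat_l; lra]).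
    nra. }
  assert (Q2 : 2 * (a * d) * (a * (y1 - y0)) * (3 * (2 * PI * a)) <= K2 / INR n).
  { replace (2 * (a * d) * (a * (y1 - y0)) * (3 * (2 * PI * a))) with
      (2 * (a * (y1 - y0)) * (a * (y1 - y0)) * (3 * (2 * PI * a)) / INR n) by (unfold d; field; lra).
    apply Rmult_le_compat_r; [apply Rinv_pos_le; auto|].
    assert (Z1 : 0 <= a * (y1 - y0) <= A * (y1 - y0)) by (split; [apply Rmult_le_pos; lra | apply Rmult_le_compat_r; lra]).
    assert (Z2 : 0 <= 2 * PI * a <= 2 * PI * A) by (split; [apply Rmult_le_pos; lra | apply Rmult_le_compat_l; lra]).
    unfold K2; apply Rmult_le_compat; try lra; [apply Rmult_le_pos; lra|].
    apply Rmult_le_compat; lra. }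
  assert (Hg : g <= PI / 2 + 2 * e1) by lra.
  apply Rle_trans with (F * (PI / 2 + 2 * e1)).
  - via Bnd; apply Rmult_le_compat_l; auto.
  - apply Rle_trans with ((1 + e / 2) * (PI / 2 + 2 * e1)); [apply Rmult_le_compat_r; lra|].
    replace ((1 + e / 2) * (PI / 2 + 2 * e1)) with (PI / 2 * ((1 + e / 2) * (1 + e / 6))) by (unfold e1; field).
    apply Rmult_le_compat_l; nra.
Qed.

(** The weight psi with T = S^2. Since [kern s] is [cap s] over s^2, the same grid sums serve for
    both. *)
Definition cap (S : R) (w : C) : R := Rmax 0 (1 - Cmod w ^ 2 / S ^ 2).

Lemma cap_slice S w : 0 < S -> cap S w = slice 1 (Cmod w / S).
Proof. intros HS; unfold cap, slice; f_equal; field; lra. Qed.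

Lemma cap_lip S v w : 1 <= S -> cap S v <= cap S w + 2 * Cmod (v - w).
Proof.
  intros HS; rewrite !cap_slice by lra.
  assert (A := slice_lip 1 ltac:(lra) (Cmod v / S) (Cmod w / S)).
  apply Rabs_le_between in A.
  assert (B : Rabs (Cmod v / S - Cmod w / S) <= Cmod (v - w)); [|lra].
  replace (Cmod v / S - Cmod w / S) with ((Cmod v - Cmod w) * / S) by (field; lra).
  assert (HS' : 0 < / S <= 1).
  { split; [apply Rinv_0_lt_compat; lra|]; rewrite <- Rinv_1; apply Rinv_le_contravar; lra. }
  rewrite Rabs_mult, (Rabs_pos_eq (/ S)) by lra.
  assert (C1 : Rabs (Cmod v - Cmod w) <= Cmod (v - w)).
  { apply Rabs_le; assert (X := Cmod_minus_ge v w); assert (Y := Cmod_minus_ge w v).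
    rewrite (Cmod_minus_sym w v) in Y; lra. }
  assert (P := Rabs_pos (Cmod v - Cmod w)); nra.
Qed.

Lemma cap_nonneg S w : 0 <= cap S w.
Proof. apply Rmax_l. Qed.

Lemma cap_zero S w : 0 < S -> S <= Cmod w -> cap S w = 0.
Proof.
  intros HS Hw; generalize (kern_zero S w HS Hw); unfold kern, cap; intros H.
  assert (0 < / S ^ 2) by (apply Rinv_0_lt_compat, pow_lt; auto).
  apply Rmult_integral in H; destruct H; [lra | auto].
Qed.

Definition square_pt (B h : R) (k l : nat) : C := (- B + INR k * h, - B + INR l * h).

Lemma kern_square_sum s B h v n : 0 < s -> 0 < h ->
  dsum (fun k l => h ^ 2 * kern s (v - square_pt B h k l)) n n
  = grid_bump ((- B - Re v) / s) ((- B - Im v) / s) (h / s) (h / s) n n.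
Proof.
  intros Hs Hh; unfold grid_bump, dsum; apply rsum_ext; intros k _; apply rsum_ext; intros l _.
  rewrite kern_bump by auto.
  replace (h ^ 2 * (/ s ^ 2 * bump (Re (v - square_pt B h k l) / s) (Im (v - square_pt B h k l) / s)))
    with (h / s * (h / s) * bump (Re (v - square_pt B h k l) / s) (Im (v - square_pt B h k l) / s)) by (field; lra).
  f_equal; unfold bump; do 2 f_equal; [f_equal|]; unfold square_pt, Re, Im; simpl; field; lra.
Qed.

Lemma limit_arith q S e eps X : 0 < q -> 1 <= S -> 0 < e <= / 2 -> 1 <= q -> 0 < eps ->
  e * (q * (2 * S ^ 2 + 2 + S ^ 2 * q) + S ^ 2 * q + eps) <= q * eps ->
  (q - e) * X <= q * (1 + e) * (S ^ 2 * (q + e) + e) -> X <= S ^ 2 * q + eps.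
Proof.
  intros Hq HS He Hq1 Heps H1 H2.
  apply Rmult_le_reg_l with (q - e); [lra|]; via H2.
  assert (A : 0 < S ^ 2) by (apply pow_lt; lra).
  assert (B : e ^ 2 <= e) by nra.
  assert (B1 : q * (e ^ 2 * (S ^ 2 + 1)) <= q * (e * (S ^ 2 + 1))).
  { apply Rmult_le_compat_l; [lra|]; apply Rmult_le_compat_r; lra. }
  lra.
Qed.

(** Double counting over a square grid of target points w. Summing kern(G p - w) over w gives nearly
    pi/2 for each p with |G p| <= S; summing over p instead is controlled by [multiplicity_bound].
    As the kernel vanishes beyond s, cap(G p) may be replaced by cap(w) + 2 s, and cap summed over w
    is about S^2 pi/2; one factor pi/2 then cancels. *)
Theorem area_inequality (G D : C -> C) y0 y1 S eps : y0 < y1 ->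
  T2 (strip y0 y1) G D -> periodic G -> periodic D -> unif_inj G y0 y1 -> 1 <= S -> 0 < eps ->
  exists n0, (0 < n0)%nat /\ forall n N, (n0 <= n)%nat -> (n0 <= N)%nat ->
    let d := (y1 - y0) / INR n in let b := 2 * PI / INR N in
    dsum (fun i j => d * b * (Cmod (D (pt y0 d N i j)) ^ 2 * cap S (G (pt y0 d N i j)))) n N
      <= S ^ 2 * (PI / 2) + eps.
Proof.
  intros Hy TG PG PD Inj HS Heps.
  assert (HP := PI_RGT_0); assert (HP2 := PI2_1).
  remember (PI / 2) as q eqn:Eq; assert (HPq : PI = 2 * q) by (rewrite Eq; field).
  set (CC := q * (2 * S ^ 2 + 2 + S ^ 2 * q) + S ^ 2 * q + eps / 2).
  assert (HS2 : 1 <= S ^ 2) by nra.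
  assert (HCC : 0 < CC) by (unfold CC; assert (0 < S ^ 2 * q) by nra; nra).
  set (e := Rmin (/ 2) (q * (eps / 2) / CC)).
  assert (He : 0 < e <= / 2).
  { split; [|apply Rmin_l]; apply Rmin_glb_lt; [lra|]; apply Rdiv_lt_0_compat; auto.
    apply Rmult_lt_0_compat; lra. }
  assert (HeC : e * CC <= q * (eps / 2)).
  { replace (q * (eps / 2)) with (q * (eps / 2) / CC * CC) by (field; lra).
    apply Rmult_le_compat_r; [lra | apply Rmin_r]. }
  (* Points below the cutoff contribute at most m^2 times the area 2 pi (y1 - y0) of the rectangle,
     here eps / 2. *)
  set (m := sqrt (eps / 2 / (2 * PI * (y1 - y0)))).
  assert (Hden : 0 < 2 * PI * (y1 - y0)) by (apply Rmult_lt_0_compat; lra).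
  assert (Hm2 : m ^ 2 = eps / 2 / (2 * PI * (y1 - y0))).
  { apply pow2_sqrt; apply Rmult_le_pos; [lra | apply Rinv_pos_le; auto]. }
  assert (Hm : 0 < m) by (apply sqrt_lt_R0; apply Rdiv_lt_0_compat; lra).
  destruct (multiplicity_bound G D y0 y1 m e Hy TG PG PD Inj Hm ltac:(lra)) as [s0 [Hs0 HN]].
  (* The margin keeps every kernel of radius s <= 1/2 centred in |w| <= S inside the square of
     targets. *)
  set (B := S + 2).
  assert (HB : 3 <= B) by (unfold B; lra).
  set (s := Rmin (s0 / 2) (Rmin (/ 2) (e / (8 * B ^ 2)))).
  assert (HB2 : 0 < 8 * B ^ 2) by nra.
  assert (Hs : 0 < s).
  { repeat apply Rmin_glb_lt; try lra; apply Rdiv_lt_0_compat; lra. }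
  assert (Hs1 : s <= s0 / 2) by apply Rmin_l.
  assert (Hs2 : s <= / 2) by (eapply Rle_trans; [apply Rmin_r | apply Rmin_l]).
  assert (Hs3 : 8 * s * B ^ 2 <= e).
  { assert (X : s <= e / (8 * B ^ 2)) by (eapply Rle_trans; [apply Rmin_r | apply Rmin_r]).
    apply (Rmult_le_compat_r (8 * B ^ 2)) in X; [|lra].
    replace (e / (8 * B ^ 2) * (8 * B ^ 2)) with e in X by (field; nra); lra. }
  clearbody s.
  destruct (HN s ltac:(lra)) as [n0 [Hn0 HN']].
  exists n0; split; auto; intros n N Hn HNn d b.
  assert (Hnp : 0 < INR n) by (apply lt_0_INR; lia).
  assert (HNp : 0 < INR N) by (apply lt_0_INR; lia).
  assert (Hd : 0 < d) by (apply Rdiv_lt_0_compat; lra).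
  assert (Hb : 0 < b) by (apply Rdiv_lt_0_compat; lra).
  set (x := 2 * B / s).
  assert (Hx : 0 < x) by (apply Rdiv_lt_0_compat; lra).
  set (K := 4 * x * x + 2 * x * x * x).
  assert (HK : 0 <= K) by (unfold K; assert (0 < x * x) by nra; nra).
  (* The mesh of the targets can be chosen last, because the bound in [HN'] is uniform in w. *)
  destruct (archi_nat (K / e)) as [Q [HQ HQ']].
  assert (HQp : 0 < INR Q) by (apply lt_0_INR; auto).
  assert (HKQ : K / INR Q <= e) by (apply INR_div_le with Q; auto; lra).
  set (h := 2 * B / INR Q).
  assert (Hh : 0 < h) by (apply Rdiv_lt_0_compat; lra).
  assert (Low : forall v, Cmod v <= S -> q - e <= dsum (fun k l => h ^ 2 * kern s (v - square_pt B h k l)) Q Q).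
  { intros v Hv; rewrite kern_square_sum by auto.
    assert (Hr := Rabs_re_le_Cmod v); assert (Hi := Rabs_im_le_Cmod v).
    assert (Hr' : Rabs (Re v) <= S) by lra; assert (Hi' : Rabs (Im v) <= S) by lra.
    apply Rabs_le_between in Hr'; apply Rabs_le_between in Hi'.
    assert (EQ : INR Q * (h / s) = x) by (unfold h, x; field; lra).
    assert (Dv : forall y z, y <= z * s -> y / s <= z).
    { intros y z Hyz; apply Rmult_le_reg_r with s; auto; unfold Rdiv; rewrite Rmult_assoc, Rinv_l; lra. }
    assert (Dv' : forall y, s <= y -> 1 <= y / s).
    { intros y Hyz; apply Rmult_le_reg_r with s; auto; unfold Rdiv; rewrite Rmult_assoc, Rinv_l; lra. }
    assert (Hhs : 0 < h / s) by (apply Rdiv_lt_0_compat; auto).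
    assert (GE := grid_bump_ge ((- B - Re v) / s) ((- B - Im v) / s) (h / s) (h / s) Q Q Hhs Hhs).
    rewrite EQ in GE.
    specialize (GE ltac:(apply Dv; unfold B; lra) ltac:(apply Dv; unfold B; lra)).
    assert (Y1 : 1 <= (- B - Re v) / s + x).
    { unfold x; replace ((- B - Re v) / s + 2 * B / s) with ((B - Re v) / s) by (field; lra).
      apply Dv'; unfold B; lra. }
    assert (Y2 : 1 <= (- B - Im v) / s + x).
    { unfold x; replace ((- B - Im v) / s + 2 * B / s) with ((B - Im v) / s) by (field; lra).
      apply Dv'; unfold B; lra. }
    specialize (GE Y1 Y2); rewrite <- Eq in GE.
    replace (h / s) with (x / INR Q) in GE at 1 2 by (unfold x, h; field; lra).
    assert (EK : K / INR Q = 4 * (x / INR Q) * x + 2 * (x / INR Q) * x * x) by (unfold K; field; lra).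
    lra. }
  assert (CapS : dsum (fun k l => h ^ 2 * cap S (square_pt B h k l)) Q Q <= S ^ 2 * (q + e)).
  { assert (E : dsum (fun k l => h ^ 2 * cap S (square_pt B h k l)) Q Q =
       S ^ 2 * grid_bump ((- B - Re 0) / S) ((- B - Im 0) / S) (h / S) (h / S) Q Q).
    { rewrite <- kern_square_sum, <- dsum_scal by lra; apply dsum_ext; intros k l _ _.
      unfold kern, cap; replace (Cmod (0 - square_pt B h k l)) with (Cmod (square_pt B h k l))
        by (rewrite Cmod_minus_sym; f_equal; ring).
      field; lra. }
    rewrite E; apply Rmult_le_compat_l; [lra|].
    assert (HhS : 0 < h / S) by (apply Rdiv_lt_0_compat; lra).
    eapply Rle_trans; [apply (grid_bump_le _ _ (h / S) (h / S) Q Q HhS HhS)|].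
    set (z := 2 * B / S).
    assert (EQ : INR Q * (h / S) = z) by (unfold h, z; field; lra).
    assert (EQ' : h / S = z / INR Q) by (unfold h, z; field; lra).
    rewrite EQ, EQ', <- Eq.
    assert (Hz : 0 <= z <= x).
    { unfold z, x; split; [left; apply Rdiv_lt_0_compat; lra|].
      apply Rmult_le_compat_l; [lra|]; apply Rinv_le_contravar; lra. }
    assert (EK : 4 * (z / INR Q) * z + 2 * (z / INR Q) * z * z <= K / INR Q).
    { replace (4 * (z / INR Q) * z + 2 * (z / INR Q) * z * z) with ((4 * z * z + 2 * z * z * z) / INR Q) by (field; lra).
      apply Rmult_le_compat_r; [apply Rinv_pos_le; auto|].
      unfold K; assert (z * z <= x * x) by nra; assert (0 <= z * z) by nra.
      assert (z * z * z <= x * x * x) by (apply Rmult_le_compat; lra); lra. }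
    lra. }
  set (Xs := dsum (fun i j => d * b * (cutoff m (Cmod (D (pt y0 d N i j))) * cap S (G (pt y0 d N i j)))) n N).
  assert (Hcut : forall z, 0 <= cutoff m z).
  { intros z; unfold cutoff; destruct (Rle_dec m z); [apply pow2_ge_0 | lra]. }
  assert (Hdb : 0 < d * b) by (apply Rmult_lt_0_compat; auto).
  assert (Main : (q - e) * Xs <= q * (1 + e) * (S ^ 2 * (q + e) + e)).
  { apply Rle_trans with (dsum (fun i j => dsum (fun k l =>
       (h ^ 2 * (cap S (square_pt B h k l) + 2 * s)) *
       (d * b * (cutoff m (Cmod (D (pt y0 d N i j))) * kern s (G (pt y0 d N i j) - square_pt B h k l)))) Q Q) n N).
    - unfold Xs; rewrite <- dsum_scal; apply dsum_le; intros i j Hi Hj.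
      set (p := pt y0 d N i j).
      apply Rle_trans with ((d * b * (cutoff m (Cmod (D p)) * cap S (G p))) *
         dsum (fun k l => h ^ 2 * kern s (G p - square_pt B h k l)) Q Q).
      + destruct (Rle_dec S (Cmod (G p))) as [HSG|HSG].
        * rewrite (cap_zero S (G p)) by lra; right; ring.
        * rewrite Rmult_comm; apply Rmult_le_compat_l; [|apply Low; lra].
          apply Rmult_le_pos; [lra|]; apply Rmult_le_pos; [apply Hcut | apply cap_nonneg].
      + rewrite <- dsum_scal; apply dsum_le; intros k l _ _.
        set (w := square_pt B h k l).
        assert (Hk := kern_nonneg s (G p - w) Hs).
        assert (Hw : cap S (G p) * kern s (G p - w) <= (cap S w + 2 * s) * kern s (G p - w)).
        { destruct (Rle_dec s (Cmod (G p - w))) as [Hsw|Hsw]; [rewrite kern_zero by auto; lra|].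
          apply Rmult_le_compat_r; auto; generalize (cap_lip S (G p) w HS); lra. }
        replace (d * b * (cutoff m (Cmod (D p)) * cap S (G p)) * (h ^ 2 * kern s (G p - w))) with
          ((d * b * cutoff m (Cmod (D p)) * h ^ 2) * (cap S (G p) * kern s (G p - w))) by ring.
        replace (h ^ 2 * (cap S w + 2 * s) * (d * b * (cutoff m (Cmod (D p)) * kern s (G p - w)))) with
          ((d * b * cutoff m (Cmod (D p)) * h ^ 2) * ((cap S w + 2 * s) * kern s (G p - w))) by ring.
        apply Rmult_le_compat_l; auto.
        apply Rmult_le_pos; [|apply pow2_ge_0]; apply Rmult_le_pos; [lra | apply Hcut].
    - rewrite dsum_swap.
      apply Rle_trans with (dsum (fun k l => (q * (1 + e)) * (h ^ 2 * cap S (square_pt B h k l) + h ^ 2 * (2 * s))) Q Q).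
      + apply dsum_le; intros k l _ _; rewrite dsum_scal.
        assert (NN := HN' n N (square_pt B h k l) Hn HNn); cbv zeta in NN; fold d b in NN.
        rewrite (Rmult_comm (q * (1 + e))), <- Rmult_plus_distr_l.
        apply Rmult_le_compat_l; [|rewrite <- Eq in NN; apply NN].
        apply Rmult_le_pos; [apply pow2_ge_0 | generalize (cap_nonneg S (square_pt B h k l)); lra].
      + rewrite dsum_scal, dsum_plus, dsum_const.
        apply Rmult_le_compat_l; [nra|].
        replace (INR Q * INR Q * (h ^ 2 * (2 * s))) with (8 * s * B ^ 2) by (unfold h; field; lra).
        lra. }
  assert (HX : Xs <= S ^ 2 * q + eps / 2).
  { apply limit_arith with e; auto; try lra. }
  apply Rle_trans with (Xs + dsum (fun i j => d * b * m ^ 2) n N).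
  - unfold Xs; rewrite <- dsum_plus; apply dsum_le; intros i j _ _.
    set (p := pt y0 d N i j); rewrite <- Rmult_plus_distr_l.
    apply Rmult_le_compat_l; [lra|].
    assert (Hc0 := cap_nonneg S (G p)).
    assert (Hc1 : cap S (G p) <= 1).
    { apply Rmax_lub; [lra|].
      assert (0 <= Cmod (G p) ^ 2 / S ^ 2); [|lra].
      apply Rmult_le_pos; [apply pow2_ge_0 | apply Rinv_pos_le; lra]. }
    unfold cutoff; destruct (Rle_dec m (Cmod (D p))) as [Hc|Hc].
    + assert (0 <= m ^ 2) by apply pow2_ge_0; lra.
    + assert (Cmod (D p) ^ 2 <= m ^ 2) by (apply pow_incr; split; [apply Cmod_ge_0 | lra]).
      assert (0 <= Cmod (D p) ^ 2) by apply pow2_ge_0; nra.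
  - rewrite dsum_const.
    replace (INR n * INR N * (d * b * m ^ 2)) with (eps / 2); [lra|].
    rewrite Hm2; unfold d, b; field; lra.
Qed.

(** * Mean squares on circles *)

Definition rmean (N : nat) (f : nat -> R) : R := / INR N * rsum f N.

Lemma rmean_re N f : rmean N (fun j => Re (f j)) = Re (mean N f).
Proof.
  unfold rmean, mean; rewrite re_scal_l, csum_re; auto.
Qed.

Lemma rmean_plus N f g : rmean N (fun j => f j + g j) = rmean N f + rmean N g.
Proof. unfold rmean; rewrite rsum_plus; ring. Qed.

Lemma rmean_scal N c f : rmean N (fun j => c * f j) = c * rmean N f.
Proof. unfold rmean; rewrite rsum_scal; ring. Qed.

Lemma rmean_const N c : (0 < N)%nat -> rmean N (fun _ => c) = c.
Proof. intros H; apply lt_0_INR in H; unfold rmean; rewrite rsum_const; field; lra. Qed.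

Lemma rmean_le N f g : (0 < N)%nat -> (forall j, (j < N)%nat -> f j <= g j) -> rmean N f <= rmean N g.
Proof.
  intros H Hfg; apply lt_0_INR in H; unfold rmean; apply Rmult_le_compat_l.
  - apply Rinv_pos_le; auto.
  - apply rsum_le; auto.
Qed.

Lemma rmean_ext N f g : (forall j, (j < N)%nat -> f j = g j) -> rmean N f = rmean N g.
Proof. intros H; unfold rmean; f_equal; apply rsum_ext; auto. Qed.

Definition eventually_N (P : nat -> Prop) : Prop :=
  exists N0, (0 < N0)%nat /\ forall N, (N0 <= N)%nat -> P N.

Lemma eventually_N_forall (P : nat -> nat -> Prop) K :
  (forall k, (k < K)%nat -> eventually_N (P k)) ->
  eventually_N (fun N => forall k, (k < K)%nat -> P k N).
Proof.
  induction K as [|K IH]; intros H.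
  - exists 1%nat; split; [lia|]; intros; lia.
  - destruct (IH ltac:(intros; apply H; lia)) as [n [Hn H1]], (H K ltac:(lia)) as [m [Hm H2]].
    exists (n + m)%nat; split; [lia|]; intros N HN k Hk.
    destruct (Nat.eq_dec k K) as [->|Hne]; [apply H2; lia | apply H1; lia].
Qed.

Lemma Cmod_sq_minus (x y : C) : Cmod (x - y) ^ 2 = Cmod x ^ 2 - 2 * Re (x * Cconj y) + Cmod y ^ 2.
Proof. rewrite !Cmod2_alt; destruct x, y; unfold Re, Im; simpl; ring. Qed.

Lemma Cconj_csum f n : Cconj (csum f n) = csum (fun k => Cconj (f k)) n.
Proof.
  induction n as [|n IH]; simpl.
  - unfold Cconj, RtoC; simpl; f_equal; ring.
  - rewrite Cplus_conj, IH; auto.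
Qed.

Lemma Cconj_R r : Cconj (RtoC r) = RtoC r.
Proof. unfold Cconj, RtoC; simpl; f_equal; ring. Qed.

(** Expanding |Y - y|^2 >= 0, with y the truncated series, gives mean |Y|^2 >= 2 Re mean(Y conj y) -
    mean |y|^2. By orthogonality the last mean is exactly the finite sum; the cross term equals it
    up to e A. *)
Lemma bessel c r K eps : 0 <= r -> absconv r c -> 0 < eps ->
  eventually_N (fun N => rsum (fun k => Cmod (c k) ^ 2 * r ^ (2 * k)) K - eps
     <= rmean N (fun j => Cmod (CPS c (circ r N j)) ^ 2)).
Proof.
  intros Hr Hc He.
  set (A := rsum (fun k => Cmod (c k) * r ^ k) K).
  assert (HA : 0 <= A).
  { apply rsum_nonneg; intros; apply Rmult_le_pos; [apply Cmod_ge_0 | apply pow_le; auto]. }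
  set (e := eps / (2 * (A + 1))).
  assert (He' : 0 < e) by (apply Rdiv_lt_0_compat; lra).
  destruct (eventually_N_forall (fun k N =>
     Cmod (mean N (fun j => CPS c (circ r N j) * cis (- (INR k * ang N j)))
         - c k * RtoC r ^ k)%C <= e) K) as [N0 [HN0 H]].
  { intros k _; apply (mean_CPS c r k e Hr Hc He'). }
  exists (N0 + K)%nat; split; [lia|]; intros N HN.
  assert (HNp : (0 < N)%nat) by lia.
  set (Y := fun j => CPS c (circ r N j)).
  set (y := fun j => csum (fun k => c k * RtoC r ^ k * cis (INR k * ang N j))%C K).
  set (S := rsum (fun k => Cmod (c k) ^ 2 * r ^ (2 * k)) K).
  assert (Ey : forall j, Cconj (y j) = csum (fun k => (Cconj (c k) * RtoC r ^ k) * cis (- (INR k * ang N j)))%C K).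
  { intros j; unfold y; rewrite Cconj_csum; apply csum_ext; intros k _.
    rewrite !Cmult_conj, Cpow_conj, Cconj_R, Cconj_cis; auto. }
  assert (ES : forall k, Re ((Cconj (c k) * RtoC r ^ k) * (c k * RtoC r ^ k)) = Cmod (c k) ^ 2 * r ^ (2 * k)).
  { intros k; replace ((Cconj (c k) * RtoC r ^ k) * (c k * RtoC r ^ k))%C
      with ((c k * Cconj (c k)) * (RtoC r ^ k * RtoC r ^ k))%C by ring.
    rewrite <- Cmod2_conj, <- Cpow_add_r, <- !RtoC_pow, <- RtoC_mult, re_RtoC.
    do 2 f_equal; lia. }
  assert (Y1 : S - e * A <= Re (mean N (fun j => Y j * Cconj (y j))%C)).
  { rewrite (mean_ext N _ (fun j => csum (fun k => (Cconj (c k) * RtoC r ^ k) * (Y j * cis (- (INR k * ang N j))))%C K)).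
    2:{ intros j _; rewrite Ey, <- csum_scal; apply csum_ext; intros; ring. }
    rewrite mean_csum, csum_re; unfold S, A; rewrite <- rsum_scal, <- rsum_minus.
    apply rsum_le; intros k Hk; rewrite mean_scal.
    assert (HH := H N ltac:(lia) k Hk); fold (Y) in HH.
    set (mu := mean N (fun j => Y j * cis (- (INR k * ang N j)))%C) in *.
    change (Cmod (mu - c k * RtoC r ^ k) <= e) in HH.
    replace mu with (c k * RtoC r ^ k + (mu - c k * RtoC r ^ k))%C by ring.
    rewrite Cmult_plus_distr_l, <- ES.
    set (X := ((Cconj (c k) * RtoC r ^ k) * (mu - c k * RtoC r ^ k))%C).
    assert (HX : Cmod X <= Cmod (c k) * r ^ k * e).
    { unfold X; rewrite !Cmod_mult, Cmod_conj, Cmod_pow, Cmod_R, Rabs_pos_eq by auto.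
      apply Rmult_le_compat_l; auto; apply Rmult_le_pos; [apply Cmod_ge_0 | apply pow_le; auto]. }
    assert (HR := Rabs_re_le_Cmod X); assert (HR' : Rabs (Re X) <= Cmod (c k) * r ^ k * e) by lra.
    apply Rabs_le_between in HR'.
    match goal with |- _ <= Re (?a + ?b)%C => change (Re (a + b)%C) with (Re a + Re b) end; lra. }
  assert (Y2 : Re (mean N (fun j => y j * Cconj (y j))%C) = S).
  { rewrite (mean_ext N _ (fun j => csum (fun k => csum (fun l => (c l * RtoC r ^ l * (Cconj (c k) * RtoC r ^ k)) *
        (cis (INR l * ang N j) * cis (- (INR k * ang N j))))%C K) K)).
    2:{ intros j _; rewrite Ey, <- csum_scal; apply csum_ext; intros k _.
        unfold y; rewrite Cmult_comm, <- csum_scal; apply csum_ext; intros; ring. }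
    rewrite mean_csum, csum_re; apply rsum_ext; intros k Hk.
    rewrite mean_csum, (csum_single _ k); auto.
    - rewrite mean_scal, mean_cis_eq by lia.
      rewrite <- ES; f_equal; ring.
    - intros l Hl Hlk; rewrite mean_scal, mean_cis_neq by lia; ring. }
  assert (Y3 : 2 * Re (mean N (fun j => Y j * Cconj (y j))%C) - Re (mean N (fun j => y j * Cconj (y j))%C)
     <= rmean N (fun j => Cmod (Y j) ^ 2)).
  { rewrite <- !rmean_re.
    replace (2 * rmean N (fun j => Re (Y j * Cconj (y j))) - rmean N (fun j => Re (y j * Cconj (y j))))
      with (rmean N (fun j => 2 * Re (Y j * Cconj (y j)) + (-1) * Re (y j * Cconj (y j))))
      by (rewrite rmean_plus, !rmean_scal; ring).
    apply rmean_le; auto; intros j _.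
    assert (P := pow2_ge_0 (Cmod (Y j - y j))); rewrite Cmod_sq_minus in P.
    rewrite <- Cmod2_conj, re_RtoC; lra. }
  rewrite Y2 in Y3.
  assert (2 * (e * A) <= eps).
  { unfold e; apply Rmult_le_reg_r with (A + 1); [lra|].
    replace (2 * (eps / (2 * (A + 1)) * A) * (A + 1)) with (eps * A) by (field; lra); nra. }
  eapply Rle_trans; [|apply Y3]; fold S; lra.
Qed.

Lemma mean_CPS_re_small a r eps : 0 <= r -> absconv r a -> a O = RtoC 0 -> 0 < eps ->
  eventually_N (fun N => Rabs (rmean N (fun j => Re (CPS a (circ r N j)))) <= eps).
Proof.
  intros Hr Ha H0 He; destruct (mean_CPS_0 a r eps Hr Ha He) as [N0 [HN0 H]].
  exists N0; split; auto; intros N HN; specialize (H N HN); rewrite H0 in H.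
  replace (mean N (fun j => CPS a (circ r N j)) - 0)%C
    with (mean N (fun j => CPS a (circ r N j))) in H by ring.
  rewrite rmean_re; eapply Rle_trans; [apply Rabs_re_le_Cmod | apply H].
Qed.

(** * Logarithmic coordinates *)

Definition cexp (v : C) : C := (RtoC (exp (Re v)) * cis (Im v))%C.

Lemma cexp_add v w : cexp (v + w) = (cexp v * cexp w)%C.
Proof.
  unfold cexp; replace (Re (v + w)) with (Re v + Re w) by (unfold Re; simpl; ring).
  replace (Im (v + w)) with (Im v + Im w) by (unfold Im; simpl; ring).
  rewrite exp_plus, RtoC_mult, cis_add; ring.
Qed.

Lemma Cmod_cexp v : Cmod (cexp v) = exp (Re v).
Proof. unfold cexp; apply Cmod_rcis; left; apply exp_pos. Qed.

Lemma cexp_neq_0 v : cexp v <> 0.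
Proof. apply Cmod_gt_0; rewrite Cmod_cexp; apply exp_pos. Qed.

Lemma exp_le_exp x y : x <= y -> exp x <= exp y.
Proof. intros [H|H]; [left; apply exp_increasing; auto | rewrite H; lra]. Qed.

Lemma exp_lt_1 x : x < 0 -> exp x < 1.
Proof. intros H; rewrite <- exp_0; apply exp_increasing, H. Qed.

Lemma exp_upper x : x < 1 -> exp x <= / (1 - x).
Proof.
  intros H; rewrite <- (Ropp_involutive x) at 1; rewrite exp_Ropp.
  apply Rinv_le_contravar; [lra|]; generalize (exp_ineq1_le (- x)); lra.
Qed.

Lemma exp_taylor2 x : Rabs x <= / 2 -> Rabs (exp x - 1 - x) <= 2 * x ^ 2.
Proof.
  intros H; apply Rabs_le_between in H.
  assert (A := exp_ineq1_le x); assert (B := exp_upper x ltac:(lra)).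
  rewrite Rabs_pos_eq by lra.
  assert (D : / (1 - x) - 1 - x = x ^ 2 * / (1 - x)) by (field; lra).
  assert (E : / (1 - x) <= / (/ 2)) by (apply Rinv_le_contravar; lra).
  rewrite Rinv_inv in E.
  assert (F : x ^ 2 * / (1 - x) <= x ^ 2 * 2) by (apply Rmult_le_compat_l; [apply pow2_ge_0 | lra]); lra.
Qed.

Lemma cos_taylor y : Rabs (cos y - 1) <= y ^ 2 / 2.
Proof.
  replace y with (2 * (y / 2)) at 1 by field; rewrite cos_2a_sin.
  assert (H := Rabs_sin_le (y / 2)); apply Rsqr_le_abs_1 in H; unfold Rsqr in H.
  apply Rabs_le; split; nra.
Qed.

Lemma sin_taylor y : Rabs (sin y - y) <= Rabs y ^ 3 / 2.
Proof.
  destruct (Req_dec y 0) as [->|Hy0].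
  { rewrite sin_0, Rabs_R0; replace (0 - 0) with 0 by ring; rewrite Rabs_R0; lra. }
  destruct (MVT_gen sin 0 y cos) as [c [Hc E]].
  - intros x _; auto_derive; auto; ring.
  - intros x _; apply continuity_pt_filterlim, continuous_sin.
  - rewrite sin_0, !Rminus_0_r in E; rewrite E.
    replace (cos c * y - y) with ((cos c - 1) * y) by ring; rewrite Rabs_mult.
    assert (A := cos_taylor c).
    assert (B : Rabs c <= Rabs y).
    { unfold Rmin, Rmax in Hc; destruct (Rle_dec 0 y).
      - rewrite !Rabs_pos_eq; lra.
      - rewrite !Rabs_left1; lra. }
    assert (B2 : c ^ 2 <= Rabs y ^ 2) by (rewrite <- (pow2_abs c); apply pow_incr; split; auto using Rabs_pos).
    replace (Rabs y ^ 3 / 2) with (Rabs y ^ 2 / 2 * Rabs y) by field.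
    apply Rmult_le_compat_r; [apply Rabs_pos | lra].
Qed.

Lemma cexp_taylor d : Cmod d <= / 2 -> Cmod (cexp d - 1 - d) <= 6 * Cmod d ^ 2.
Proof.
  intros H; set (x := Re d); set (y := Im d).
  assert (Hx : Rabs x <= Cmod d) by apply Rabs_re_le_Cmod.
  assert (Hy : Rabs y <= Cmod d) by apply Rabs_im_le_Cmod.
  set (r := Cmod d) in *; assert (Hr : 0 <= r) by apply Cmod_ge_0.
  assert (Hx0 := Rabs_pos x); assert (Hy0 := Rabs_pos y).
  assert (X2 : x ^ 2 <= r ^ 2) by (rewrite <- (pow2_abs x); apply pow_incr; lra).
  assert (Y2 : y ^ 2 <= r ^ 2) by (rewrite <- (pow2_abs y); apply pow_incr; lra).
  assert (T1 := exp_taylor2 x ltac:(lra)); assert (T2 := cos_taylor y); assert (T3 := sin_taylor y).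
  assert (Hex : Rabs (exp x - 1) <= 2 * Rabs x).
  { replace (exp x - 1) with ((exp x - 1 - x) + x) by ring.
    via Rabs_triang.
    rewrite <- (pow2_abs x) in T1; nra. }
  assert (Hc : Rabs (cos y) <= 1) by (apply Rabs_le, COS_bound).
  via Cmod_le_re_im.
  replace (Re (cexp d - 1 - d)) with ((exp x - 1 - x) * cos y + (1 + x) * (cos y - 1))
    by (unfold cexp, x, y, cis, Re, Im; simpl; ring).
  replace (Im (cexp d - 1 - d)) with (exp x * (sin y - y) + (exp x - 1) * y)
    by (unfold cexp, x, y, cis, Re, Im; simpl; ring).
  assert (R1 : Rabs ((exp x - 1 - x) * cos y + (1 + x) * (cos y - 1)) <= 3 * r ^ 2).
  { via Rabs_triang; rewrite !Rabs_mult.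
    assert (Rabs (1 + x) <= 2) by (apply Rabs_le; apply Rabs_le_between in Hx; lra).
    assert (Rabs (exp x - 1 - x) * Rabs (cos y) <= 2 * x ^ 2 * 1)
      by (apply Rmult_le_compat; auto using Rabs_pos).
    assert (Rabs (1 + x) * Rabs (cos y - 1) <= 2 * (y ^ 2 / 2))
      by (apply Rmult_le_compat; auto using Rabs_pos).
    lra. }
  assert (R2 : Rabs (exp x * (sin y - y) + (exp x - 1) * y) <= 3 * r ^ 2).
  { via Rabs_triang; rewrite !Rabs_mult.
    assert (Rabs (exp x) <= 2).
    { rewrite Rabs_pos_eq by (left; apply exp_pos); apply Rabs_le_between in Hex; nra. }
    assert (Y3 : Rabs y ^ 3 / 2 <= r ^ 2 / 4).
    { assert (Rabs y ^ 2 <= r ^ 2) by (apply pow_incr; lra).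
      assert (0 <= Rabs y ^ 2) by apply pow2_ge_0.
      replace (Rabs y ^ 3) with (Rabs y ^ 2 * Rabs y) by ring; nra. }
    assert (Rabs (exp x) * Rabs (sin y - y) <= 2 * (r ^ 2 / 4))
      by (apply Rmult_le_compat; auto using Rabs_pos; lra).
    assert (Rabs (exp x - 1) * Rabs y <= (2 * r) * r)
      by (apply Rmult_le_compat; auto using Rabs_pos; lra).
    assert (0 <= r ^ 2) by apply pow2_ge_0; nra. }
  lra.
Qed.

Lemma cexp_T2 y0 y1 : T2 (strip y0 y1) cexp cexp.
Proof.
  set (E := exp y1); assert (HE : 0 < E) by apply exp_pos.
  assert (B : forall z, strip y0 y1 z -> Cmod (cexp z) <= E).
  { intros z [_ Hz]; rewrite Cmod_cexp; apply exp_le_exp, Hz. }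
  exists (12 * E); split; [lra|]; split.
  { intros z Hz; assert (A := B z Hz); lra. }
  intros z w Hz Hw; assert (Az := B z Hz); assert (Aw := B w Hw).
  set (d := (w - z)%C).
  replace (cexp w) with (cexp z * cexp d)%C by (rewrite <- cexp_add; f_equal; unfold d; ring).
  destruct (Rle_dec (Cmod d) (/ 2)) as [Hd|Hd].
  - replace (cexp z * cexp d - cexp z - cexp z * d)%C with (cexp z * (cexp d - 1 - d))%C by ring.
    rewrite Cmod_mult; assert (T := cexp_taylor d Hd).
    apply Rle_trans with (E * (6 * Cmod d ^ 2)).
    + apply Rmult_le_compat; auto using Cmod_ge_0.
    + assert (0 <= Cmod d ^ 2) by apply pow2_ge_0; nra.
  - replace (cexp z * cexp d)%C with (cexp w) by (rewrite <- cexp_add; f_equal; unfold d; ring).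
    via Cmod_minus_le.
    assert (X := Cmod_minus_le (cexp w) (cexp z)); rewrite Cmod_mult.
    assert (Cmod (cexp z) * Cmod d <= E * Cmod d) by (apply Rmult_le_compat_r; auto using Cmod_ge_0).
    (* The product is 12 |d|^2 - |d| - 5/2, so for |d| > 1/2 the crude bound E (2 + |d|) is at most
       12 E |d|^2. *)
    assert (0 <= E * ((Cmod d - / 2) * (12 * Cmod d + 5))).
    { apply Rmult_le_pos; [lra|]; apply Rmult_le_pos; lra. }
    lra.
Qed.

Lemma cexp_ishift t v : wrap t -> cexp (v + ishift t) = cexp v.
Proof.
  intros Ht; rewrite cexp_add; replace (cexp (ishift t)) with (RtoC 1); [ring|].
  unfold cexp, ishift; unfold Re, Im; simpl; rewrite exp_0.
  replace (cis t) with (RtoC 1); [ring|]; symmetry.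
  destruct Ht as [-> | [-> | ->]].
  - rewrite <- (cis_period _ 1); simpl INR; replace (- (2 * PI) + 2 * 1 * PI) with 0 by ring; apply cis_0.
  - apply cis_0.
  - replace (2 * PI) with (0 + 2 * INR 1 * PI) by (simpl; ring); rewrite cis_period; apply cis_0.
Qed.

Lemma cexp_inj y0 y1 z w : box y0 y1 z -> box y0 y1 w -> cexp z = cexp w ->
  exists t, wrap t /\ (z + ishift t)%C = w.
Proof.
  intros [_ Hz] [_ Hw] E.
  assert (ER : Re z = Re w).
  { apply exp_inv; rewrite <- !Cmod_cexp, E; auto. }
  assert (EI : cis (Im z - Im w) = RtoC 1).
  { assert (EC : cis (Im z) = cis (Im w)).
    { unfold cexp in E; rewrite ER in E.
      apply (f_equal (fun u => (/ RtoC (exp (Re w)) * u)%C)) in E.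
      assert (Hn : RtoC (exp (Re w)) <> 0) by (intros H; apply RtoC_inj in H; generalize (exp_pos (Re w)); lra).
      rewrite !Cmult_assoc, Cinv_l, !Cmult_1_l in E; auto. }
    unfold Rminus; rewrite cis_add, EC, <- cis_add, Rplus_opp_r; apply cis_0. }
  assert (Ht : wrap (Im w - Im z)).
  { destruct (Req_dec (Im z - Im w) 0) as [H0|H0]; [right; left; lra|].
    assert (HP := PI_RGT_0).
    destruct (Rlt_dec (Rabs (Im z - Im w)) (2 * PI)) as [H1|H1].
    - exfalso; apply (cis_neq_1 _ H0 H1 EI).
    - unfold Rabs in H1; destruct (Rcase_abs (Im z - Im w)).
      + right; right; lra.
      + left; lra. }
  exists (Im w - Im z); split; auto.
  apply Ceq_re_im; unfold ishift, Re, Im in *; simpl; lra.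
Qed.

(** A minimum in place of the existence of a good shift: the result is Lipschitz, so compactness
    applies. *)
Definition lattice_dist (z w : C) : R :=
  Rmin (Cmod (z + ishift (- (2 * PI)) - w))
    (Rmin (Cmod (z + ishift 0 - w)) (Cmod (z + ishift (2 * PI) - w))).

Lemma Rmin_lip a b a' b' e : a <= a' + e -> b <= b' + e -> Rmin a b <= Rmin a' b' + e.
Proof.
  intros; unfold Rmin; destruct (Rle_dec a b), (Rle_dec a' b'); lra.
Qed.

(** [F] is Lipschitz on pairs of points, and it could vanish only if G z = G w at lattice distance
    at least eta, which injectivity forbids. Its positive lower bound c works: |G z - G w| < c
    forces the second summand to be positive. *)
Lemma unif_inj_of_inj G D y0 y1 : T2 (strip y0 y1) G D ->
  (forall z w, box y0 y1 z -> box y0 y1 w -> G z = G w -> exists t, wrap t /\ (z + ishift t)%C = w) ->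
  unif_inj G y0 y1.
Proof.
  intros TG Inj eta Heta.
  destruct (T2_lip _ _ _ TG) as [L [HL Lip]].
  set (F := fun x : Compactness.Tn 4 R =>
    let z := (fst x, fst (snd x)) : C in
    let w := (fst (snd (snd x)), fst (snd (snd (snd x)))) : C in
    Cmod (G z - G w) + Rmax 0 (eta - lattice_dist z w)).
  destruct (lip_pos_min 4 (y0, (0, (y0, (0, tt)))) (y1, (2 * PI, (y1, (2 * PI, tt)))) F (4 * L + 4))
    as [c [Hc H]].
  - lra.
  - intros [z1 [z2 [w1 [w2 []]]]] [H1 [H2 [H3 [H4 _]]]]; unfold F; simpl.
    set (z := (z1, z2) : C); set (w := (w1, w2) : C).
    assert (Hm := Rmax_l 0 (eta - lattice_dist z w)).
    assert (Hn := Cmod_ge_0 (G z - G w)).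
    destruct (Req_dec (Cmod (G z - G w)) 0) as [H0|H0]; [|lra].
    destruct (Inj z w) as [t [Ht Et]].
    + split; auto.
    + split; auto.
    + apply Ceq_minus, Cmod_eq_0; auto.
    + assert (X : lattice_dist z w <= 0).
      { assert (E0 : Cmod (z + ishift t - w) = 0).
        { rewrite Et; replace (w - w)%C with (RtoC 0) by ring; apply Cmod_0. }
        unfold lattice_dist; destruct Ht as [-> | [-> | ->]].
        - eapply Rle_trans; [apply Rmin_l | lra].
        - via Rmin_r; eapply Rle_trans; [apply Rmin_l | lra].
        - via Rmin_r; eapply Rle_trans; [apply Rmin_r | lra]. }
      generalize (Rmax_r 0 (eta - lattice_dist z w)); lra.
  - intros [z1 [z2 [w1 [w2 []]]]] [u1 [u2 [v1 [v2 []]]]] d [A1 [A2 [A3 [A4 _]]]] [B1 [B2 [B3 [B4 _]]]] Hd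
      [D1 [D2 [D3 [D4 _]]]]; unfold F; simpl.
    set (z := (z1, z2) : C); set (w := (w1, w2) : C); set (u := (u1, u2) : C); set (v := (v1, v2) : C).
    assert (Hzu : Cmod (u - z) <= 2 * d).
    { rewrite Cmod_minus_sym; via Cmod_le_re_im.
      unfold z, u, Re, Im; simpl; change (z1 + - u1) with (z1 - u1); change (z2 + - u2) with (z2 - u2); lra. }
    assert (Hwv : Cmod (v - w) <= 2 * d).
    { rewrite Cmod_minus_sym; via Cmod_le_re_im.
      unfold w, v, Re, Im; simpl; change (w1 + - v1) with (w1 - v1); change (w2 + - v2) with (w2 - v2); lra. }
    assert (E1 : Cmod (G u - G v) <= Cmod (G z - G w) + 4 * L * d).
    { replace (G u - G v)%C with ((G z - G w) + ((G u - G z) - (G v - G w)))%C by ring.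
      via Cmod_triangle; apply Rplus_le_compat_l.
      via Cmod_minus_le.
      assert (X1 := Lip z u A1 B1); assert (X2 := Lip w v A3 B3); nra. }
    assert (E2 : lattice_dist z w <= lattice_dist u v + 4 * d).
    { assert (S : forall t, Cmod (z + ishift t - w) <= Cmod (u + ishift t - v) + 4 * d).
      { intros t; replace (z + ishift t - w)%C with ((u + ishift t - v) - ((u - z) - (v - w)))%C by ring.
        via Cmod_minus_le; apply Rplus_le_compat_l.
        via Cmod_minus_le; lra. }
      unfold lattice_dist; repeat apply Rmin_lip; apply S. }
    assert (E3 : Rmax 0 (eta - lattice_dist u v) <= Rmax 0 (eta - lattice_dist z w) + 4 * d).
    { apply Rmax_lub; [generalize (Rmax_l 0 (eta - lattice_dist z w)); lra|].
      generalize (Rmax_r 0 (eta - lattice_dist z w)); lra. }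
    lra.
  - exists c; split; auto; intros z w [Hz1 Hz2] [Hw1 Hw2] Hzw.
    destruct z as [z1 z2], w as [w1 w2].
    assert (X := H (z1, (z2, (w1, (w2, tt))))); unfold F in X; simpl in X.
    set (z := (z1, z2) : C) in *; set (w := (w1, w2) : C) in *.
    assert (X' : c <= Cmod (G z - G w) + Rmax 0 (eta - lattice_dist z w)) by (apply X; repeat split; apply Hz1 || apply Hz2 || apply Hw1 || apply Hw2).
    assert (Y : lattice_dist z w < eta).
    { apply Rnot_le_lt; intros Hle; rewrite Rmax_left in X' by lra; lra. }
    unfold lattice_dist in Y.
    destruct (Rlt_dec (Cmod (z + ishift (- (2 * PI)) - w)) eta) as [H1|H1];
      [exists (- (2 * PI)); split; auto; left; auto|].
    destruct (Rlt_dec (Cmod (z + ishift 0 - w)) eta) as [H2|H2];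
      [exists 0; split; auto; right; left; auto|].
    destruct (Rlt_dec (Cmod (z + ishift (2 * PI) - w)) eta) as [H3|H3];
      [exists (2 * PI); split; auto; right; right; auto|].
    exfalso; apply (Rlt_not_le _ _ Y); repeat apply Rmin_glb; lra.
Qed.

(** * The area theorem *)

Definition gfun (b : nat -> C) (u : C) : C := (/ u + CPS b u)%C.
(** The derivative of gfun(e^v) in v, written in u: the operator u d/du sends 1/u to -1/u and acts
    on the series by [ud]. *)
Definition gder (b : nat -> C) (u : C) : C := (- / u + CPS (ud b) u)%C.

Lemma gfun_T2 b y0 y1 : conv1 b -> y1 < 0 ->
  T2 (strip y0 y1) (fun v => gfun b (cexp v)) (fun v => gder b (cexp v)).
Proof.
  intros Hb Hy1.
  set (S' := fun u : C => exp y0 <= Cmod u <= exp y1).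
  assert (H1 := exp_lt_1 _ Hy1).
  assert (TI : T2 S' (fun u => u) (fun _ => RtoC 1)) by (apply T2_id with (exp y1); intros z Hz; apply Hz).
  assert (TV := T2_inv S' _ _ (exp y0) (exp_pos y0) (fun z Hz => proj1 Hz) TI).
  assert (TP : T2 S' (CPS b) (CPS (dcoef b))).
  { eapply T2_subset; [|apply (CPS_T2 b (exp y1) Hb); split; [apply exp_pos | auto]].
    intros z Hz; apply Hz. }
  assert (Hmap : forall z, strip y0 y1 z -> S' (cexp z)).
  { intros z [A B]; unfold S'; rewrite Cmod_cexp; split.
    - apply exp_le_exp, A.
    - apply exp_le_exp, B. }
  eapply T2_ext; [| | exact (T2_comp _ _ _ _ _ _ Hmap (cexp_T2 y0 y1) (T2_plus _ _ _ _ _ TV TP))].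
  - intros z _; reflexivity.
  - intros z Hz; cbv beta; unfold gder.
    destruct (Hmap z Hz) as [_ Hz1]; rewrite CPS_ud by (auto; lra).
    field; apply cexp_neq_0.
Qed.

Lemma gfun_periodic b : periodic (fun v => gfun b (cexp v)).
Proof. intros t z Ht; rewrite cexp_ishift; auto. Qed.

Lemma gder_periodic b : periodic (fun v => gder b (cexp v)).
Proof. intros t z Ht; rewrite cexp_ishift; auto. Qed.

Definition mulX (a : nat -> C) (n : nat) : C := match n with O => RtoC 0 | S m => a m end.

Lemma conv1_mulX a : conv1 a -> conv1 (mulX a).
Proof. intros Ha; apply conv1_unshift; exact Ha. Qed.

Lemma CPS_step1 a u : conv1 a -> Cmod u < 1 -> CPS a u = (a O + u * CPS (fun n => a (S n)) u)%C.
Proof.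
  intros Ha Hu; assert (H0 := Cmod_ge_0 u).
  apply (CPS_step ((1 + Cmod u) / 2)); [lra | apply Ha; lra | lra].
Qed.

Lemma CPS_mulX a u : conv1 a -> Cmod u < 1 -> CPS (mulX a) u = (u * CPS a u)%C.
Proof.
  intros Ha Hu; rewrite CPS_step1; auto using conv1_mulX; simpl.
  rewrite (CPS_ext _ a) by auto; ring.
Qed.

(** Coefficients of (u q' - q)/u + q (u q'), where q is the series of b with b_0 = 0: division by u
    is the index shift, the product is the convolution. *)
Definition ecoef (b : nat -> C) (n : nat) : C :=
  ((ud b (S n) + RtoC (-1) * b (S n)) + cconv b (ud b) n)%C.

Lemma conv1_ecoef b : conv1 b -> conv1 (ecoef b).
Proof.
  intros Hb; assert (Hu := conv1_ud b Hb).
  apply (conv1_plus (fun n => ud b (S n) + RtoC (-1) * b (S n))%C).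
  - apply (conv1_plus (fun n => ud b (S n))); [apply conv1_shift; auto|].
    apply (conv1_scal (RtoC (-1)) (fun n => b (S n))), conv1_shift; auto.
  - apply conv1_cconv; auto.
Qed.

(* As b 0 = 0, the product (1/u + q)(-1/u + u q') has no 1/u term. *)
Lemma gfun_gder b (u : C) : conv1 b -> b O = RtoC 0 -> u <> 0 -> Cmod u < 1 ->
  (gfun b u * gder b u = - (/ u * / u) + CPS (ecoef b) u)%C.
Proof.
  intros Hb H0 Hu0 Hu; assert (Hub := conv1_ud b Hb).
  assert (Hr := Cmod_ge_0 u); set (r := (1 + Cmod u) / 2).
  assert (Hr1 : 0 <= r < 1) by (unfold r; lra); assert (Hur : Cmod u <= r) by (unfold r; lra).
  assert (HbS := conv1_shift b Hb); assert (HuS := conv1_shift _ Hub).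
  unfold ecoef.
  rewrite (CPS_plus r (fun n => ud b (S n) + RtoC (-1) * b (S n))%C); auto.
  2:{ apply absconv_plus; [apply HuS; auto | apply absconv_scal; [apply HbS; auto|lra] | lra]. }
  2:{ apply absconv_cconv; [lra | apply Hb; auto | apply Hub; auto]. }
  rewrite (CPS_plus r (fun n => ud b (S n))); [| apply HuS; auto | apply absconv_scal; [apply HbS; auto|lra] | auto].
  rewrite (CPS_scal r); [| apply HbS; auto | auto].
  rewrite (CPS_mult r); [| apply Hb; auto | apply Hub; auto | auto].
  unfold gfun, gder.
  assert (E1 := CPS_step1 b u Hb Hu); assert (E2 := CPS_step1 (ud b) u Hub Hu).
  rewrite H0 in E1; unfold ud at 2 in E2; simpl INR in E2.
  rewrite E1, E2; field; exact Hu0.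
Qed.

Lemma Cconj_inv_mod (u : C) : u <> 0 -> Cconj (/ u) = (u * RtoC (/ Cmod u ^ 2))%C.
Proof.
  intros Hu; assert (Hm : 0 < Cmod u) by (apply Cmod_gt_0; auto).
  assert (H2 : 0 < Cmod u ^ 2) by (apply pow_lt; auto).
  rewrite Cinv_conj, RtoC_inv, Cmod2_conj by (auto; lra); field; split; auto.
  intros H; apply Hu; rewrite <- (Cconj_conj u), H; unfold Cconj, RtoC; simpl; f_equal; ring.
Qed.

(** The cross term takes the form Re(u Y), for a power series Y the real part of a series without
    constant term, so that its circle mean tends to 0. *)
Lemma Cmod_sq_inv_plus (u Y : C) : u <> 0 ->
  Cmod (- / u + Y) ^ 2 = / Cmod u ^ 2 + -2 * / Cmod u ^ 2 * Re (u * Y) + Cmod Y ^ 2.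
Proof.
  intros Hu; assert (Hm : 0 < Cmod u) by (apply Cmod_gt_0; auto).
  replace (- / u + Y)%C with (Y - / u)%C by ring.
  rewrite Cmod_sq_minus, Cconj_inv_mod, Cmod_inv by auto.
  replace (Y * (u * RtoC (/ Cmod u ^ 2)))%C with (RtoC (/ Cmod u ^ 2) * (u * Y))%C by ring.
  rewrite re_scal_l; field; lra.
Qed.

(** The weight is at least 1 - |G|^2 / S^2. The mean of |G'|^2 is bounded below by [bessel]; that of
    |G G'|^2 is bounded above through its leading term 1/u^2, and [Cst] may be crude because it is
    divided by S^2. *)
Lemma weighted_mean_lower b K r r1 Cst S eps : conv1 b -> b O = RtoC 0 -> 0 < r <= r1 -> r1 < 1 -> 1 <= S -> 0 < eps ->
  (forall u, Cmod u <= r1 -> Cmod (CPS (ecoef b) u) ^ 2 <= Cst) ->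
  eventually_N (fun N => / r ^ 2 + rsum (fun k => INR k ^ 2 * Cmod (b k) ^ 2 * r ^ (2 * k)) K
      - (/ r ^ 4 + Cst) / S ^ 2 - eps <=
    rmean N (fun j => let u := (circ r N j) in Cmod (gder b u) ^ 2 * cap S (gfun b u))).
Proof.
  intros Hb H0 Hr Hr1 HS He HC.
  assert (Hub := conv1_ud b Hb); assert (Hec := conv1_ecoef b Hb).
  assert (Hr' : 0 <= r < 1) by lra.
  assert (P2 : 0 < r ^ 2) by (apply pow_lt; lra).
  assert (P4 : 0 < r ^ 4) by (apply pow_lt; lra).
  assert (HS2 : 1 <= S ^ 2) by nra.
  destruct (bessel (ud b) r K (eps / 4) ltac:(lra) (Hub r Hr') ltac:(lra)) as [N1 [HN1 A1]].
  destruct (mean_CPS_re_small (mulX (ud b)) r (eps * r ^ 2 / 8) ltac:(lra) (conv1_mulX _ Hub r Hr') eq_refl ltac:(nra))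
    as [N2 [HN2 A2]].
  destruct (mean_CPS_re_small (mulX (mulX (ecoef b))) r (eps * r ^ 4 / 8) ltac:(lra)
     (conv1_mulX _ (conv1_mulX _ Hec) r Hr') eq_refl ltac:(nra)) as [N3 [HN3 A3]].
  exists (N1 + N2 + N3)%nat; split; [lia|]; intros N HN; cbv zeta.
  assert (HNp : (0 < N)%nat) by lia.
  specialize (A1 N ltac:(lia)); specialize (A2 N ltac:(lia)); specialize (A3 N ltac:(lia)).
  set (u := fun j => (circ r N j)).
  assert (Hu : forall j, Cmod (u j) = r) by (intros j; apply Cmod_rcis; lra).
  assert (Hu0 : forall j, u j <> 0) by (intros j; apply Cmod_gt_0; rewrite Hu; lra).
  set (MY := rmean N (fun j => Cmod (CPS (ud b) (u j)) ^ 2)) in *.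
  set (M1 := rmean N (fun j => Re (CPS (mulX (ud b)) (u j)))) in *.
  set (M2 := rmean N (fun j => Re (CPS (mulX (mulX (ecoef b))) (u j)))) in *.
  change (Rabs M1 <= eps * r ^ 2 / 8) in A2; change (Rabs M2 <= eps * r ^ 4 / 8) in A3.
  change (rsum (fun k => Cmod (ud b k) ^ 2 * r ^ (2 * k)) K - eps / 4 <= MY) in A1.
  rewrite (rsum_ext _ (fun k => INR k ^ 2 * Cmod (b k) ^ 2 * r ^ (2 * k))) in A1.
  2:{ intros k _; unfold ud; rewrite Cmod_mult, Cmod_R, Rabs_pos_eq by apply pos_INR; ring. }
  assert (B1 : rmean N (fun j => Cmod (gder b (u j)) ^ 2) = / r ^ 2 + -2 * / r ^ 2 * M1 + MY).
  { unfold M1, MY; rewrite <- rmean_scal, <- (rmean_const N (/ r ^ 2)) by auto.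
    rewrite <- !rmean_plus; apply rmean_ext; intros j _.
    unfold gder; rewrite Cmod_sq_inv_plus, Hu by auto.
    rewrite (CPS_mulX (ud b)) by (auto; rewrite Hu; lra); rewrite (rmean_const N); auto. }
  assert (B2 : rmean N (fun j => Cmod (gfun b (u j) * gder b (u j)) ^ 2) <= / r ^ 4 + -2 * / r ^ 4 * M2 + Cst).
  { unfold M2; rewrite <- rmean_scal, <- (rmean_const N (/ r ^ 4)), <- (rmean_const N Cst) by auto.
    rewrite <- !rmean_plus; apply rmean_le; auto; intros j _.
    assert (Hu1 : Cmod (u j) < 1) by (rewrite Hu; lra).
    assert (Huu : (u j * u j)%C <> 0) by (apply Cmult_neq_0; auto).
    rewrite (gfun_gder b (u j)) by auto.
    replace (- (/ u j * / u j) + CPS (ecoef b) (u j))%C with (- / (u j * u j) + CPS (ecoef b) (u j))%C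
      by (field; auto).
    rewrite Cmod_sq_inv_plus by auto.
    rewrite CPS_mulX, (CPS_mulX (ecoef b)) by (auto using conv1_mulX).
    rewrite Cmod_mult, Hu, !(rmean_const N) by auto.
    replace (u j * (u j * CPS (ecoef b) (u j)))%C with (u j * u j * CPS (ecoef b) (u j))%C by ring.
    replace ((r * r) ^ 2) with (r ^ 4) by ring.
    apply Rplus_le_compat_l, HC; rewrite Hu; lra. }
  assert (B3 : rmean N (fun j => Cmod (gder b (u j)) ^ 2) + - / S ^ 2 * rmean N (fun j => Cmod (gfun b (u j) * gder b (u j)) ^ 2)
     <= rmean N (fun j => Cmod (gder b (u j)) ^ 2 * cap S (gfun b (u j)))).
  { rewrite <- rmean_scal, <- rmean_plus; apply rmean_le; auto; intros j _.
    rewrite Cmod_mult.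
    replace (Cmod (gder b (u j)) ^ 2 + - / S ^ 2 * (Cmod (gfun b (u j)) * Cmod (gder b (u j))) ^ 2) with
      (Cmod (gder b (u j)) ^ 2 * (1 - Cmod (gfun b (u j)) ^ 2 / S ^ 2)) by (field; lra).
    apply Rmult_le_compat_l; [apply pow2_ge_0 | apply Rmax_r]. }
  change (/ r ^ 2 + rsum (fun k => INR k ^ 2 * Cmod (b k) ^ 2 * r ^ (2 * k)) K - (/ r ^ 4 + Cst) / S ^ 2 - eps <=
     rmean N (fun j => Cmod (gder b (u j)) ^ 2 * cap S (gfun b (u j)))).
  apply Rabs_le_between in A2; apply Rabs_le_between in A3.
  assert (C1 : / r ^ 2 * M1 <= eps / 8).
  { apply Rmult_le_reg_l with (r ^ 2); auto; rewrite <- Rmult_assoc, Rinv_r by lra; lra. }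
  assert (C2 : - (/ r ^ 4 * M2) <= eps / 8).
  { apply Rmult_le_reg_l with (r ^ 4); auto.
    replace (r ^ 4 * - (/ r ^ 4 * M2)) with (- M2) by (field; lra); lra. }
  assert (HSi : 0 < / S ^ 2 <= 1).
  { split; [apply Rinv_0_lt_compat; lra|]; rewrite <- Rinv_1; apply Rinv_le_contravar; lra. }
  assert (B4 : / S ^ 2 * rmean N (fun j => Cmod (gfun b (u j) * gder b (u j)) ^ 2) <=
     / S ^ 2 * (/ r ^ 4 + Cst) + eps / 4).
  { apply Rle_trans with (/ S ^ 2 * (/ r ^ 4 + -2 * / r ^ 4 * M2 + Cst)); [apply Rmult_le_compat_l; lra|].
    assert (/ S ^ 2 * (-2 * / r ^ 4 * M2) <= eps / 4).
    { apply Rle_trans with (/ S ^ 2 * (eps / 4)); [apply Rmult_le_compat_l; lra|]; nra. }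
    lra. }
  unfold Rdiv; lra.
Qed.

Lemma telescope f n : rsum (fun i => f (S i) - f i) n = f n - f O.
Proof. induction n as [|n IH]; simpl; [ring | rewrite IH; ring]. Qed.

(** Both sides come from 1 + x <= e^x, at x = c d and x = -c d, and hold for c of either sign;
    telescoped, they replace the integrals of exponentials. *)
Lemma exp_step c y d : c * d * exp (c * y) <= exp (c * (y + d)) - exp (c * y) <=
   c * exp (c * d) * (d * exp (c * y)).
Proof.
  replace (exp (c * (y + d))) with (exp (c * y) * exp (c * d)) by (rewrite <- exp_plus; f_equal; ring).
  assert (H := exp_pos (c * y)); assert (H' := exp_pos (c * d)).
  assert (A := exp_ineq1_le (c * d)); assert (B := exp_ineq1_le (- (c * d))).
  rewrite exp_Ropp in B.
  split; [nra|].
  assert (B' : exp (c * d) - 1 <= c * d * exp (c * d)).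
  { apply (Rmult_le_compat_r (exp (c * d))) in B; [|lra]; rewrite Rinv_l in B by lra; lra. }
  nra.
Qed.

Lemma exp_sum_bounds c y0 d n :
  c * rsum (fun i => d * exp (c * (y0 + INR i * d))) n <= exp (c * (y0 + INR n * d)) - exp (c * y0) <=
  c * exp (c * d) * rsum (fun i => d * exp (c * (y0 + INR i * d))) n.
Proof.
  assert (T := telescope (fun i => exp (c * (y0 + INR i * d))) n); simpl in T.
  rewrite Rmult_0_l, Rplus_0_r in T; rewrite <- T, <- !rsum_scal.
  assert (E : forall i, y0 + INR (S i) * d = y0 + INR i * d + d) by (intros; rewrite S_INR; ring).
  split; apply rsum_le; intros i _; change (match i with O => 1 | S _ => INR i + 1 end) with (INR (S i));
  rewrite E; generalize (exp_step c (y0 + INR i * d) d); lra.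
Qed.

Definition gfun_inj (b : nat -> C) : Prop := forall u v : C, u <> 0 -> v <> 0 ->
  Cmod u < 1 -> Cmod v < 1 -> gfun b u = gfun b v -> u = v.

Lemma exp_pow x n : exp x ^ n = exp (INR n * x).
Proof.
  induction n as [|n IH]; [simpl; rewrite Rmult_0_l, exp_0; auto|].
  rewrite S_INR; simpl; rewrite IH, <- exp_plus; f_equal; ring.
Qed.

Lemma gfun_strip_inj b y0 y1 : y1 < 0 -> gfun_inj b ->
  forall z w, box y0 y1 z -> box y0 y1 w -> gfun b (cexp z) = gfun b (cexp w) ->
  exists t, wrap t /\ (z + ishift t)%C = w.
Proof.
  intros Hy Hinj z w Hz Hw E; apply (cexp_inj y0 y1); auto.
  assert (X : forall v, box y0 y1 v -> Cmod (cexp v) < 1).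
  { intros v [[_ Hv] _]; rewrite Cmod_cexp; apply exp_lt_1; lra. }
  apply Hinj; auto using cexp_neq_0.
Qed.

(** Its derivative is twice [scoef]: integrating mean squares over the strip turns the weights k^2
    into Gronwall's k, up to the factor 1/2. *)
Definition acoef (b : nat -> C) (K : nat) (x : R) : R :=
  rsum (fun k => INR k * Cmod (b k) ^ 2 * exp (2 * INR k * x)) K.

Definition scoef (b : nat -> C) (K : nat) (x : R) : R :=
  rsum (fun k => INR k ^ 2 * Cmod (b k) ^ 2 * exp (2 * INR k * x)) K.

(** e^(-y0) is the modulus of 1/u on the innermost circle. The number n of circles is fixed before
    N, so N can be taken large enough for the mean estimates on all of them. *)
Lemma strip_area_discrete b K y0 y1 Cst e : conv1 b -> b O = RtoC 0 -> gfun_inj b ->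
  y0 < y1 -> y1 < 0 -> 0 < e -> 
  (forall u, Cmod u <= exp y1 -> Cmod (CPS (ecoef b) u) ^ 2 <= Cst) ->
  exists n0, (0 < n0)%nat /\ forall n, (n0 <= n)%nat ->
   let d := (y1 - y0) / INR n in
   2 * PI * rsum (fun i => d * (exp (-2 * (y0 + INR i * d)) +
      scoef b K (y0 + INR i * d)
      - (exp (-4 * (y0 + INR i * d)) + Cst) / exp (- y0) ^ 2 - e)) n
   <= exp (- y0) ^ 2 * (PI / 2) + e.
Proof.
  intros Hb H0 Hinj Hy Hy1 He HC.
  set (S := exp (- y0)).
  assert (HS : 1 <= S) by (unfold S; rewrite <- exp_0; left; apply exp_increasing; lra).
  destruct (area_inequality _ _ y0 y1 S e Hy (gfun_T2 b y0 y1 Hb Hy1) (gfun_periodic b) (gder_periodic b)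
    (unif_inj_of_inj _ _ y0 y1 (gfun_T2 b y0 y1 Hb Hy1) (gfun_strip_inj b y0 y1 Hy1 Hinj)) HS He)
    as [n0 [Hn0 HA]].
  exists n0; split; auto; intros n Hn d.
  assert (Hnp : 0 < INR n) by (apply lt_0_INR; lia).
  assert (Hd : 0 < d) by (apply Rdiv_lt_0_compat; lra).
  assert (Hyi : forall i, (i < n)%nat -> y0 + INR i * d <= y1).
  { intros i Hi; apply lt_INR in Hi.
    assert (INR i * d <= INR n * d) by (apply Rmult_le_compat_r; lra).
    assert (INR n * d = y1 - y0) by (unfold d; field; lra); lra. }
  destruct (eventually_N_forall _ n (fun i Hi => weighted_mean_lower b K (exp (y0 + INR i * d)) (exp y1) Cst S e
     Hb H0 (conj (exp_pos _) (exp_le_exp _ _ (Hyi i Hi)))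
     (exp_lt_1 _ Hy1) HS He HC)) as [N0 [HN0 HM]].
  set (N := (N0 + n0)%nat); specialize (HM N ltac:(unfold N; lia)).
  specialize (HA n N Hn ltac:(unfold N; lia)); cbv zeta in HA; fold d in HA.
  assert (HNp : 0 < INR N) by (apply lt_0_INR; unfold N; lia).
  eapply Rle_trans; [|apply HA].
  unfold dsum; rewrite <- rsum_scal; apply rsum_le; intros i Hi.
  specialize (HM i Hi); cbv zeta in HM.
  set (M := rmean N _) in HM.
  assert (EM : rsum (fun j => d * (2 * PI / INR N) * (Cmod (gder b (cexp (pt y0 d N i j))) ^ 2
       * cap S (gfun b (cexp (pt y0 d N i j))))) N = 2 * PI * d * M).
  { rewrite rsum_scal; unfold M, rmean; field_simplify; [|lra|lra].
    f_equal; f_equal. }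
  rewrite EM.
  assert (HP := PI_RGT_0).
  replace (2 * PI * (d * _)) with ((2 * PI * d) * (exp (-2 * (y0 + INR i * d)) +
      scoef b K (y0 + INR i * d)
      - (exp (-4 * (y0 + INR i * d)) + Cst) / S ^ 2 - e)) by ring.
  apply Rmult_le_compat_l; [apply Rmult_le_pos; lra|].
  set (y := y0 + INR i * d) in *.
  replace (exp (-2 * y)) with (/ exp y ^ 2) by (rewrite exp_pow, <- exp_Ropp; f_equal; simpl; ring).
  replace (exp (-4 * y)) with (/ exp y ^ 4) by (rewrite exp_pow, <- exp_Ropp; f_equal; simpl; ring).
  unfold scoef; rewrite (rsum_ext _ (fun k => INR k ^ 2 * Cmod (b k) ^ 2 * exp y ^ (2 * k))); [exact HM|].
  intros k _; rewrite exp_pow, mult_INR; do 2 f_equal.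
Qed.

Lemma le_of_le_plus_small x y K : 0 <= K -> (forall e, 0 < e <= 1 -> x <= y + e * K) -> x <= y.
Proof.
  intros HK H; apply le_epsilon; intros eps He.
  set (e := Rmin 1 (eps / (K + 1))).
  assert (He' : 0 < e <= 1).
  { split; [apply Rmin_glb_lt; [lra | apply Rdiv_lt_0_compat; lra] | apply Rmin_l]. }
  assert (e * K <= eps); [|specialize (H e He'); lra].
  apply Rle_trans with (eps / (K + 1) * (K + 1)); [|right; field; lra].
  apply Rmult_le_compat; try lra; apply Rmin_r.
Qed.

(** [Z] is the integral in y of the strip estimate, and Z <= S2 / 4. Its divergent terms, S2/2 from
    e^(-2y) and -S2/4 from e^(-4y)/S2, cancel against S2/4; there remain W, e^(-2 y1) and the error
    with [Cst]. *)
Lemma strip_area b K y0 y1 Cst : conv1 b -> b O = RtoC 0 -> gfun_inj b ->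
  y0 < y1 -> y1 < 0 -> 
  (forall u, Cmod u <= exp y1 -> Cmod (CPS (ecoef b) u) ^ 2 <= Cst) ->
  acoef b K y1 - acoef b K y0 <= exp (-2 * y1) + 2 * Cst * (y1 - y0) / exp (-2 * y0).
Proof.
  intros Hb H0 Hinj Hy Hy1 HC.
  set (W := acoef b K y1 - acoef b K y0).
  set (S2 := exp (-2 * y0)).
  set (Z := (S2 - exp (-2 * y1)) / 2 + W / 2 - (S2 ^ 2 - exp (-4 * y1)) / 4 / S2 - Cst * (y1 - y0) / S2).
  assert (HS2 : 0 < S2) by apply exp_pos.
  assert (ES2 : exp (- y0) ^ 2 = S2) by (rewrite exp_pow; unfold S2; f_equal; simpl; ring).
  assert (ES4 : exp (-4 * y0) = S2 ^ 2) by (unfold S2; rewrite exp_pow; f_equal; simpl; ring).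
  assert (HP := PI_RGT_0).
  assert (HWk : forall k, 0 <= INR k * Cmod (b k) ^ 2 * (exp (2 * INR k * y1) - exp (2 * INR k * y0))).
  { intros k; assert (Hk := pos_INR k).
    apply Rmult_le_pos; [apply Rmult_le_pos; [auto | apply pow2_ge_0]|].
    destruct Hk as [Hk|Hk]; [|rewrite <- Hk; replace (2 * 0 * y1) with (2 * 0 * y0) by ring; lra].
    assert (exp (2 * INR k * y0) < exp (2 * INR k * y1)); [|lra].
    apply exp_increasing; apply Rmult_lt_compat_l; lra. }
  assert (EW : W = rsum (fun k => INR k * Cmod (b k) ^ 2 * (exp (2 * INR k * y1) - exp (2 * INR k * y0))) K).
  { unfold W, acoef; rewrite <- rsum_minus; apply rsum_ext; intros; ring. }
  assert (HW : 0 <= W) by (rewrite EW; apply rsum_nonneg; auto).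
  assert (HF : 2 * PI * Z <= S2 * (PI / 2)).
  { apply le_of_le_plus_small with (1 + 2 * PI * (2 + (y1 - y0))).
    { assert (0 <= 2 * PI * (2 + (y1 - y0))) by (apply Rmult_le_pos; lra); lra. }
    intros e He.
    destruct (strip_area_discrete b K y0 y1 Cst e Hb H0 Hinj Hy Hy1 ltac:(lra) HC) as [n0 [Hn0 HD]].
    (* Once d Q <= e, the Riemann errors 2 d S2 and K d W together are at most e. *)
    set (Q := 2 * (INR K * W + S2 + 1)).
    assert (HK0 := pos_INR K).
    assert (HKW : 0 <= INR K * W) by (apply Rmult_le_pos; auto).
    assert (HQ : 0 < Q) by (unfold Q; lra).
    destruct (archi_nat ((y1 - y0) / Rmin (/ 8) (e / Q))) as [n1 [Hn1 Hn1']].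
    set (n := (n0 + n1)%nat).
    assert (Hnp : 0 < INR n) by (apply lt_0_INR; unfold n; lia).
    specialize (HD n ltac:(unfold n; lia)); cbv zeta in HD.
    assert (HeQ : 0 < e / Q) by (apply Rdiv_lt_0_compat; lra).
    assert (Hmin : 0 < Rmin (/ 8) (e / Q)) by (apply Rmin_glb_lt; lra).
    set (d := (y1 - y0) / INR n) in HD.
    assert (Hd : d <= Rmin (/ 8) (e / Q)) by (apply INR_div_le with n1; auto; unfold n; (lra || lia)).
    assert (Hd0 : 0 < d) by (apply Rdiv_lt_0_compat; lra).
    assert (Hd1 : d <= / 8) by (eapply Rle_trans; [apply Hd | apply Rmin_l]).
    assert (Hd2 : d * Q <= e).
    { apply Rle_trans with (e / Q * Q); [|right; field; lra].
      apply Rmult_le_compat_r; [lra|]; eapply Rle_trans; [apply Hd | apply Rmin_r]. }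
    assert (End : y0 + INR n * d = y1) by (unfold d; field; lra).
    assert (Esum : rsum (fun i => d * (exp (-2 * (y0 + INR i * d)) +
      scoef b K (y0 + INR i * d)
      - (exp (-4 * (y0 + INR i * d)) + Cst) / exp (- y0) ^ 2 - e)) n =
      rsum (fun i => d * exp (-2 * (y0 + INR i * d))) n
      + rsum (fun k => INR k ^ 2 * Cmod (b k) ^ 2 * rsum (fun i => d * exp (2 * INR k * (y0 + INR i * d))) n) K
      - / S2 * rsum (fun i => d * exp (-4 * (y0 + INR i * d))) n
      - (y1 - y0) * (Cst / S2 + e)).
    { assert (Es : rsum (fun k => INR k ^ 2 * Cmod (b k) ^ 2 * rsum (fun i => d * exp (2 * INR k * (y0 + INR i * d))) n) K
        = rsum (fun i => d * scoef b K (y0 + INR i * d)) n).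
      { transitivity (rsum (fun k => rsum (fun i => d * (INR k ^ 2 * Cmod (b k) ^ 2 * exp (2 * INR k * (y0 + INR i * d)))) n) K).
        - apply rsum_ext; intros k _; rewrite <- rsum_scal; apply rsum_ext; intros; ring.
        - rewrite rsum_swap; apply rsum_ext; intros i _; apply rsum_scal. }
      rewrite Es.
      replace ((y1 - y0) * (Cst / S2 + e)) with (rsum (fun _ => d * (Cst / S2 + e)) n)
        by (rewrite rsum_const; unfold d; field; lra).
      rewrite <- rsum_scal, <- rsum_plus, <- !rsum_minus; apply rsum_ext; intros i _.
      rewrite ES2; field; lra. }
    rewrite Esum, ES2 in HD; clear Esum.
    assert (T1 := exp_sum_bounds (-2) y0 d n); assert (T3 := exp_sum_bounds (-4) y0 d n).
    rewrite End in T1, T3.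
    set (s1 := rsum (fun i => d * exp (-2 * (y0 + INR i * d))) n) in *.
    set (s3 := rsum (fun i => d * exp (-4 * (y0 + INR i * d))) n) in *.
    fold S2 in T1; rewrite ES4 in T3.
    assert (B1 : (S2 - exp (-2 * y1)) / 2 <= s1) by lra.
    assert (B3 : / S2 * s3 <= (S2 ^ 2 - exp (-4 * y1)) / 4 / S2 + 2 * d * S2).
    { assert (X : s3 <= exp (4 * d) * ((S2 ^ 2 - exp (-4 * y1)) / 4)).
      { assert (E : exp (4 * d) * exp (-4 * d) = 1) by (rewrite <- exp_plus; replace (4 * d + -4 * d) with 0 by ring; apply exp_0).
        assert (P := exp_pos (4 * d)); destruct T3 as [_ T3].
        apply (Rmult_le_compat_l (exp (4 * d))) in T3; [|lra].
        replace (exp (4 * d) * (-4 * exp (-4 * d) * s3)) with (-4 * (exp (4 * d) * exp (-4 * d)) * s3) in T3 by ring.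
        rewrite E in T3; lra. }
      assert (Y : exp (4 * d) <= 1 + 8 * d).
      { eapply Rle_trans; [apply exp_upper; lra|].
        apply Rmult_le_reg_r with (1 - 4 * d); [lra|]; rewrite Rinv_l by lra; nra. }
      assert (V : 0 <= S2 ^ 2 - exp (-4 * y1) <= S2 ^ 2).
      { generalize (exp_pos (-4 * y1)); intros; split; [|lra].
        rewrite <- ES4; assert (exp (-4 * y1) < exp (-4 * y0)) by (apply exp_increasing; lra); lra. }
      apply Rmult_le_reg_l with S2; auto; rewrite <- Rmult_assoc, Rinv_r, Rmult_1_l by lra.
      replace (S2 * ((S2 ^ 2 - exp (-4 * y1)) / 4 / S2 + 2 * d * S2)) with
        ((S2 ^ 2 - exp (-4 * y1)) / 4 + 2 * d * S2 ^ 2) by (field; lra).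
      set (V0 := S2 ^ 2 - exp (-4 * y1)) in *.
      assert (exp (4 * d) * (V0 / 4) <= (1 + 8 * d) * (V0 / 4)) by (apply Rmult_le_compat_r; lra).
      assert (d * V0 <= d * S2 ^ 2) by (apply Rmult_le_compat_l; lra).
      lra. }
    assert (B2 : W / 2 - INR K * d * W <=
       rsum (fun k => INR k ^ 2 * Cmod (b k) ^ 2 * rsum (fun i => d * exp (2 * INR k * (y0 + INR i * d))) n) K).
    { replace (W / 2 - INR K * d * W) with ((1 - 2 * INR K * d) / 2 * W) by field.
      rewrite EW, <- rsum_scal; apply rsum_le; intros k Hk.
      assert (T2 := exp_sum_bounds (2 * INR k) y0 d n); rewrite End in T2.
      cbv beta; set (s2 := rsum (fun i => d * exp (2 * INR k * (y0 + INR i * d))) n) in *; set (Dk := exp (2 * INR k * y1) - exp (2 * INR k * y0)) in *.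
      assert (Hk0 := pos_INR k); assert (HkK := lt_INR _ _ Hk).
      assert (Hbk : 0 <= INR k * Cmod (b k) ^ 2) by (apply Rmult_le_pos; [auto | apply pow2_ge_0]).
      (* The factor 2 k stays on the right, so k = 0 requires no division; (1 - 2 K d) e^(2 k d) <=
         1 removes the exponential from the upper bound of [exp_sum_bounds]. *)
      assert (Hs2 : (1 - 2 * INR K * d) * Dk <= 2 * INR k * s2).
      { set (E := exp (2 * INR k * d)) in *.
        assert (HE : 0 < E) by apply exp_pos.
        assert (HE' : (1 - 2 * INR K * d) * E <= 1).
        { assert (X := exp_ineq1_le (- (2 * INR k * d))); rewrite exp_Ropp in X; fold E in X.
          assert (Y : 1 - 2 * INR K * d <= / E) by nra.
          apply (Rmult_le_compat_r E) in Y; [|lra]; rewrite Rinv_l in Y; lra. }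
        assert (Hs20 : 0 <= 2 * INR k * s2).
        { apply Rmult_le_pos; [lra|]; apply rsum_nonneg; intros; apply Rmult_le_pos; [lra | left; apply exp_pos]. }
        assert (HDk0 : 0 <= Dk).
        { destruct T2 as [T2a _]; lra. }
        destruct (Rle_dec (1 - 2 * INR K * d) 0) as [Hneg|Hpos]; [nra|].
        apply Rle_trans with ((1 - 2 * INR K * d) * (2 * INR k * E * s2)).
        - apply Rmult_le_compat_l; lra.
        - replace ((1 - 2 * INR K * d) * (2 * INR k * E * s2)) with
            (((1 - 2 * INR K * d) * E) * (2 * INR k * s2)) by ring.
          rewrite <- (Rmult_1_l (2 * INR k * s2)) at 2; apply Rmult_le_compat_r; auto. }
      replace ((1 - 2 * INR K * d) / 2 * (INR k * Cmod (b k) ^ 2 * Dk)) with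
        (INR k * Cmod (b k) ^ 2 / 2 * ((1 - 2 * INR K * d) * Dk)) by field.
      replace (INR k ^ 2 * Cmod (b k) ^ 2 * s2) with (INR k * Cmod (b k) ^ 2 / 2 * (2 * INR k * s2)) by field.
      apply Rmult_le_compat_l; lra. }
    set (s2 := rsum (fun k => INR k ^ 2 * Cmod (b k) ^ 2 * _) K) in *.
    assert (F : Z - e - (y1 - y0) * e <= s1 + s2 - / S2 * s3 - (y1 - y0) * (Cst / S2 + e)).
    { unfold Z.
      replace (Cst * (y1 - y0) / S2) with ((y1 - y0) * (Cst / S2)) by (field; lra).
      assert (d * (2 * (INR K * W + S2 + 1)) <= e) by exact Hd2.
      assert (0 <= d * (INR K * W)) by (apply Rmult_le_pos; lra).
      lra. }
    assert (G : 2 * PI * (Z - e - (y1 - y0) * e) <= S2 * (PI / 2) + e).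
    { eapply Rle_trans; [|apply HD]; apply Rmult_le_compat_l; lra. }
    assert (0 <= 2 * PI * e) by (apply Rmult_le_pos; lra).
    nra. }
  assert (HZ : Z <= S2 / 4).
  { apply Rmult_le_reg_l with (2 * PI); [lra|]; lra. }
  unfold Z in HZ.
  assert (E1 : (S2 ^ 2 - exp (-4 * y1)) / 4 / S2 = S2 / 4 - exp (-4 * y1) / 4 / S2) by (field; lra).
  assert (E2 : 0 <= exp (-4 * y1) / 4 / S2).
  { apply Rmult_le_pos; [generalize (exp_pos (-4 * y1)); lra | apply Rinv_pos_le; auto]. }
  assert (E3 : 2 * Cst * (y1 - y0) / S2 = 2 * (Cst * (y1 - y0) / S2)) by (field; lra).
  lra.
Qed.

Theorem area_theorem b K : conv1 b -> b O = RtoC 0 -> gfun_inj b ->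
  rsum (fun k => INR k * Cmod (b k) ^ 2) K <= 1.
Proof.
  intros Hb H0 Hinj.
  set (Bs := rsum (fun k => INR k * Cmod (b k) ^ 2) K).
  assert (Hk0 : forall k, 0 <= INR k * Cmod (b k) ^ 2)
    by (intros; apply Rmult_le_pos; [apply pos_INR | apply pow2_ge_0]).
  assert (HBs : 0 <= Bs) by (apply rsum_nonneg; auto).
  assert (A1 : forall y1, y1 < 0 -> acoef b K y1 <= exp (-2 * y1)).
  { intros y1 Hy1.
    assert (Hr : 0 <= exp y1 < 1) by (split; [left; apply exp_pos | apply exp_lt_1; auto]).
    (* This bound depends on y1 but not on y0, so it survives y0 -> -oo. *)
    set (Q := Series (fun n => Cmod (ecoef b n) * exp y1 ^ n)).
    assert (HQ : forall u, Cmod u <= exp y1 -> Cmod (CPS (ecoef b) u) ^ 2 <= Q ^ 2).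
    { intros u Hu; apply pow_incr; split; [apply Cmod_ge_0|].
      apply Cmod_CPS_le; auto; apply conv1_ecoef; auto. }
    assert (HQ0 : 0 <= Q ^ 2) by apply pow2_ge_0.
    apply le_of_le_plus_small with (2 * Q ^ 2 + Bs); [lra|]; intros e He.
    (* Then L = -y0 >= 1/e and e^(2 L) >= L^2, so the error with [Cst] is O(1/L) = O(e), and the
       exponentials in [acoef] at y0 with k >= 1 are at most 1/L. *)
    set (y0 := - (/ e - y1)).
    assert (He1 : 1 <= / e) by (rewrite <- Rinv_1; apply Rinv_le_contravar; lra).
    assert (Hy : y0 < y1) by (unfold y0; lra).
    assert (X := strip_area b K y0 y1 (Q ^ 2) Hb H0 Hinj Hy Hy1 HQ).
    set (L := - y0) in *.
    assert (HL : / e <= L) by (unfold L, y0; lra).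
    assert (HE : L ^ 2 <= exp (-2 * y0)).
    { replace (-2 * y0) with (INR 2 * L) by (unfold L; simpl; ring); rewrite <- exp_pow.
      apply pow_incr; split; [lra|]; generalize (exp_ineq1_le L); lra. }
    assert (HL0 : 1 <= L) by lra.
    assert (HL2 : 0 < L ^ 2) by (apply pow_lt; lra).
    assert (HLe : / L <= e) by (rewrite <- (Rinv_inv e); apply Rinv_le_contravar; lra).
    assert (HEi : / exp (-2 * y0) <= / L ^ 2) by (apply Rinv_le_contravar; auto).
    assert (C1 : 2 * Q ^ 2 * (y1 - y0) / exp (-2 * y0) <= e * (2 * Q ^ 2)).
    { apply Rle_trans with (2 * Q ^ 2 * L * / L ^ 2).
      - apply Rmult_le_compat; auto.
        + apply Rmult_le_pos; lra.
        + apply Rinv_pos_le, exp_pos.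
        + apply Rmult_le_compat_l; [lra|]; unfold L; lra.
      - replace (2 * Q ^ 2 * L * / L ^ 2) with (/ L * (2 * Q ^ 2)) by (field; lra).
        apply Rmult_le_compat_r; lra. }
    assert (C2 : acoef b K y0 <= e * Bs).
    { unfold acoef, Bs; rewrite <- rsum_scal; apply rsum_le; intros k _.
      destruct k as [|k]; [simpl; lra|].
      rewrite (Rmult_comm e); apply Rmult_le_compat_l; auto.
      apply Rle_trans with (/ L); auto.
      replace (2 * INR (S k) * y0) with (- (2 * INR (S k) * L)) by (unfold L; ring).
      rewrite exp_Ropp; apply Rinv_le_contravar; [lra|].
      eapply Rle_trans; [|apply exp_ineq1_le].
      assert (1 <= INR (S k)) by (rewrite S_INR; generalize (pos_INR k); lra); nra. }
    lra. }
  apply le_of_le_plus_small with (4 + 2 * INR K * Bs).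
  { assert (0 <= INR K * Bs) by (apply Rmult_le_pos; auto using pos_INR); lra. }
  intros e' He'; set (e := e' / 4).
  assert (He : 0 < e <= / 4) by (unfold e; lra).
  assert (X := A1 (- e) ltac:(lra)).
  assert (Y : exp (-2 * - e) <= 1 + 4 * e).
  { eapply Rle_trans; [apply exp_upper; lra|].
    apply Rmult_le_reg_r with (1 - -2 * - e); [lra|]; rewrite Rinv_l by lra; nra. }
  assert (V : (1 - 2 * INR K * e) * Bs <= acoef b K (- e)).
  { unfold Bs, acoef; rewrite <- rsum_scal; apply rsum_le; intros k Hk.
    rewrite Rmult_comm; apply Rmult_le_compat_l; auto.
    eapply Rle_trans; [|apply exp_ineq1_le]; apply lt_INR in Hk; nra. }
  assert (0 <= INR K * Bs) by (apply Rmult_le_pos; auto using pos_INR).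
  unfold e in *; nra.
Qed.

(** * Bounds for the Hankel determinants *)

(** For p the coefficients of f(u)/u, 1/f(u) is the sum of [psinv p n] times u^(n - 1). The pole n =
    0 and the constant h_1 at n = 1 are left out, so b_k is [psinv p (k + 1)] for k >= 1 and b_0 =
    0. *)
Definition tailcoef (p : nat -> C) (n : nat) : C :=
  match n with O => RtoC 0 | S m => psinv p (S (S m)) end.

(** Univalence is used twice: f vanishes only at 0, so f(u)/u has no zeros, and 1/f - h_1, which is
    [gfun b], inherits injectivity. *)
Lemma classS_reciprocal f a : classS f a ->
  let p := fun n => a (S n) in let b := tailcoef p in
  conv1 p /\ p O = RtoC 1 /\ (forall z, Cmod z < 1 -> CPS p z <> 0) /\
  conv1 b /\ gfun_inj b.
Proof.
  intros [_ [Hu [He [H0 H1]]]] p b.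
  assert (Ha := expansion_conv1 f a He); assert (Hp : conv1 p) by (apply conv1_shift; auto).
  assert (Hf : forall z, Cmod z < 1 -> f z = (z * CPS p z)%C).
  { intros z Hz; rewrite (expansion_CPS f a z He Hz), (CPS_step1 a z Ha Hz), H0; unfold p; ring. }
  assert (Hin0 : Cmod 0 < 1) by (rewrite Cmod_0; lra).
  assert (Hnz : forall z, Cmod z < 1 -> CPS p z <> 0).
  { intros z Hz E.
    assert (Ez : z = RtoC 0).
    { apply Hu; auto; rewrite (Hf z Hz), (Hf 0 Hin0), E; ring. }
    rewrite Ez in E; rewrite (CPS_step1 p 0 Hp Hin0) in E; unfold p at 1 in E; rewrite H1 in E.
    replace (1 + 0 * CPS (fun n => p (S n)) 0)%C with (RtoC 1) in E by ring.
    apply RtoC_inj in E; lra. }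
  assert (Hh := psinv_conv1 p Hp H1 Hnz).
  assert (Hb : conv1 b) by (apply conv1_unshift; apply (conv1_shift (fun n => psinv p (S n))), conv1_shift, Hh).
  repeat split; auto.
  assert (Hg : forall u : C, u <> 0 -> Cmod u < 1 -> gfun b u = (CPS (psinv p) u / u - psinv p 1)%C).
  { intros u Hu0 Hu1; unfold gfun.
    rewrite (CPS_step1 b u Hb Hu1), (CPS_step1 _ u Hh Hu1), (CPS_step1 _ u (conv1_shift _ Hh) Hu1).
    unfold b at 1; simpl tailcoef; change (psinv p 0) with (RtoC 1).
    rewrite (CPS_ext (fun n => b (S n)) (fun n => psinv p (S (S n)))) by auto.
    field; exact Hu0. }
  intros u v Hu0 Hv0 Hu1 Hv1 E; rewrite (Hg u Hu0 Hu1), (Hg v Hv0 Hv1) in E.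
  apply Hu; auto; rewrite (Hf u Hu1), (Hf v Hv1).
  assert (Iu := CPS_psinv p u Hp H1 Hnz Hu1); assert (Iv := CPS_psinv p v Hp H1 Hnz Hv1).
  set (hu := CPS (psinv p) u) in *; set (hv := CPS (psinv p) v) in *.
  set (pu := CPS p u) in *; set (pv := CPS p v) in *.
  assert (E' : (hu / u = hv / v)%C).
  { replace (hu / u)%C with ((hu / u - psinv p 1) + psinv p 1)%C by ring; rewrite E; ring. }
  transitivity (u * pu * (hv / v) * (v * pv))%C.
  - replace (u * pu * (hv / v) * (v * pv))%C with (u * pu * (pv * hv))%C by (field; auto).
    rewrite Iv; ring.
  - rewrite <- E'; replace (u * pu * (hu / u) * (v * pv))%C with (v * pv * (pu * hu))%C by (field; auto).
    rewrite Iu; ring.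
Qed.

Lemma psinv_1_bound p : conv1 p -> p O = RtoC 1 -> (forall z, Cmod z < 1 -> CPS p z <> 0) ->
  (forall n, Cmod (psinv p (S (S n))) <= 1) -> Cmod (psinv p 1) <= 5.
Proof.
  intros Hp H1 Hnz Hb; apply Rnot_lt_le; intros Hlt.
  assert (Hh := psinv_conv1 p Hp H1 Hnz).
  (* On |u| = 1/2 and with |T| <= 2, |1 + h_1 u + u^2 T| >= h1/2 - 1 - 2/4; this lower bound exceeds
     1 exactly when h1 > 5. *)
  set (h1 := Cmod (psinv p 1)) in *; set (M := h1 / 2 - 3 / 2).
  assert (HM : 1 < M) by (unfold M; lra).
  assert (HMi : / M < 1) by (rewrite <- Rinv_1; apply Rinv_lt_contravar; lra).
  assert (Hlow : forall u, Cmod u = / 2 -> M <= Cmod (CPS (psinv p) u)).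
  { intros u Hu; assert (Hu1 : Cmod u < 1) by lra.
    assert (Hh1 := conv1_shift _ Hh); assert (Hh2 := conv1_shift _ Hh1); cbv beta in Hh2.
    rewrite (CPS_step1 _ u Hh Hu1), (CPS_step1 _ u Hh1 Hu1).
    set (T := CPS (fun n => psinv p (S (S n))) u).
    assert (HT : Cmod T <= 2).
    { unfold T; eapply Rle_trans; [apply (Cmod_CPS_le (/ 2)); [apply Hh2; lra | lra]|].
      apply Rle_trans with (Series (fun n => (/ 2) ^ n)); [|right; rewrite Series_geom; [field | rewrite Rabs_pos_eq; lra]].
      apply Series_le; [|apply ex_series_geom; rewrite Rabs_pos_eq; lra].
      intros n; assert (P : 0 < (/ 2) ^ n) by (apply pow_lt; lra); split.
      - apply Rmult_le_pos; [apply Cmod_ge_0 | lra].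
      - rewrite <- (Rmult_1_l ((/ 2) ^ n)) at 2; apply Rmult_le_compat_r; auto; lra. }
    change (psinv p 0) with (RtoC 1).
    replace (1 + u * (psinv p 1 + u * T))%C with (u * psinv p 1 - (- (1) - u * u * T))%C by ring.
    eapply Rle_trans; [|apply Cmod_minus_ge].
    assert (X := Cmod_minus_le (- (1))%C (u * u * T)%C); rewrite Cmod_m1, !Cmod_mult, Hu in X.
    rewrite Cmod_mult, Hu; fold h1; unfold M; lra. }
  (* The mean of p tends to p(0) = 1 but would be at most 1/M; half the gap is a sufficient
     tolerance. *)
  destruct (mean_CPS_0 p (/ 2) ((1 - / M) / 2) ltac:(lra) (Hp (/ 2) ltac:(lra)) ltac:(lra)) as [N0 [HN0 HN]].
  specialize (HN N0 (Nat.le_refl _)).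
  set (mu := mean N0 _) in HN.
  assert (B : Cmod mu <= / M).
  { apply Cmod_mean_le; auto; intros j _.
    set (u := (RtoC (/ 2) * cis (ang N0 j))%C).
    assert (Hu : Cmod u = / 2) by (apply Cmod_rcis; lra).
    assert (I := CPS_psinv p u Hp H1 Hnz ltac:(lra)).
    assert (L := Hlow u Hu).
    assert (I' := f_equal Cmod I); rewrite Cmod_mult, Cmod_1 in I'.
    apply Rmult_le_reg_r with M; [lra|]; rewrite Rinv_l by lra.
    rewrite <- I'; apply Rmult_le_compat_l; auto using Cmod_ge_0. }
  assert (A := Cmod_minus_ge (p O) mu); rewrite Cmod_minus_sym, H1, Cmod_1 in A.
  rewrite H1 in HN; lra.
Qed.

Lemma hankel_psinv a : a 1%nat = RtoC 1 ->
  let h := psinv (fun n => a (S n)) in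
  hankel22 a = (h 1%nat * h 3%nat - h 2%nat * h 2%nat)%C /\
  hankel31 a = (h 2%nat * h 4%nat - h 3%nat * h 3%nat)%C.
Proof.
  intros H1 h.
  assert (E1 : h 1%nat = (- a 2%nat)%C).
  { unfold h; rewrite psinv_S; simpl; unfold psinv; simpl; ring. }
  assert (E2 : h 2%nat = (- (a 2%nat * h 1%nat + a 3%nat))%C).
  { unfold h at 1; rewrite psinv_S; simpl csum; fold h; change (h 0%nat) with (RtoC 1); ring. }
  assert (E3 : h 3%nat = (- (a 2%nat * h 2%nat + a 3%nat * h 1%nat + a 4%nat))%C).
  { unfold h at 1; rewrite psinv_S; simpl csum; fold h; change (h 0%nat) with (RtoC 1); ring. }
  assert (E4 : h 4%nat = (- (a 2%nat * h 3%nat + a 3%nat * h 2%nat + a 4%nat * h 1%nat + a 5%nat))%C).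
  { unfold h at 1; rewrite psinv_S; simpl csum; fold h; change (h 0%nat) with (RtoC 1); ring. }
  unfold hankel22, hankel31; rewrite E4, E3, E2, E1; split; ring.
Qed.

Lemma classS_hankel_bounds f a : classS f a -> Cmod (hankel22 a) <= 11 / 3 /\ Cmod (hankel31 a) <= 1.
Proof.
  intros Hfa; destruct (classS_reciprocal f a Hfa) as [Hp [Hp0 [Hnz [Hb Hinj]]]].
  destruct Hfa as [_ [_ [_ [_ H1]]]].
  destruct (hankel_psinv a H1) as [-> ->].
  set (p := fun n => a (S n)) in *; set (h := psinv p) in *.
  assert (Hk0 : forall k, 0 <= INR k * Cmod (tailcoef p k) ^ 2)
    by (intros; apply Rmult_le_pos; [apply pos_INR | apply pow2_ge_0]).
  assert (A := area_theorem _ 4 Hb eq_refl Hinj); simpl in A; fold h in A.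
  assert (B : Cmod (h 1%nat) <= 5).
  { apply psinv_1_bound; auto; intros n; fold h.
    assert (An := area_theorem _ (S (S n)) Hb eq_refl Hinj).
    assert (T := rsum_term_le (fun k => INR k * Cmod (tailcoef p k) ^ 2) (S (S n)) (S n) ltac:(lia) ltac:(intros; apply Hk0)).
    cbv beta in T; change (tailcoef p (S n)) with (h (S (S n))) in T; rewrite S_INR in T.
    assert (Hn := pos_INR n); assert (Hc := Cmod_ge_0 (h (S (S n)))); nra. }
  assert (X0 := Cmod_ge_0 (h 2%nat)); assert (Y0 := Cmod_ge_0 (h 3%nat)); assert (Z0 := Cmod_ge_0 (h 4%nat)).
  set (x := Cmod (h 2%nat)) in *; set (y := Cmod (h 3%nat)) in *; set (z := Cmod (h 4%nat)) in *.
  assert (A' : x ^ 2 + 2 * y ^ 2 + 3 * z ^ 2 <= 1) by lra.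
  clear A; split; (via Cmod_minus_le); rewrite !Cmod_mult; fold x y z.
  (* Under x^2 + 2 y^2 <= 1 this is at most 5 y + 1 - 2 y^2 with y <= 1/sqrt 2, hence at most 5/sqrt
     2 < 11/3: the crude bound 5 is just good enough. *)
  - apply Rle_trans with (5 * y + x * x).
    + apply Rplus_le_compat_r, Rmult_le_compat_r; auto.
    + nra.
  (* x z + y^2 <= (x^2 + 2 y^2 + 3 z^2) / 2 leaves room to spare. *)
  - nra.
Qed.

(** * Two functions of class S *)

Lemma CPS_0 a : conv1 a -> CPS a 0 = a O.
Proof. intros Ha; rewrite CPS_step1; auto; [ring | rewrite Cmod_0; lra]. Qed.

Lemma conv1_bounded_coef a : (forall n, Cmod (a n) <= 1) -> conv1 a.
Proof.
  intros H r Hr; apply absconv_geom with 1 1; try lra.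
  intros n; rewrite pow1; specialize (H n); lra.
Qed.

Lemma classS_of_series p : conv1 p -> p O = RtoC 1 ->
  (forall z w, Cmod z < 1 -> Cmod w < 1 -> (z * CPS p z = w * CPS p w)%C -> z = w) ->
  classS (CPS (mulX p)) (mulX p).
Proof.
  intros Hp H0 Hinj; assert (Hu := conv1_mulX p Hp); repeat split; auto.
  - apply conv1_analytic; auto.
  - intros z w Hz Hw E; apply Hinj; auto; rewrite <- !CPS_mulX; auto.
  - intros z Hz; apply conv1_is_pseries; auto.
Qed.

Definition evens (n : nat) : C := if Nat.even n then RtoC 1 else RtoC 0.

Lemma conv1_evens : conv1 evens.
Proof.
  apply conv1_bounded_coef; intros n; unfold evens; destruct (Nat.even n); rewrite ?Cmod_1, ?Cmod_0; lra.
Qed.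

Lemma CPS_evens z : Cmod z < 1 -> ((1 - z * z) * CPS evens z = 1)%C.
Proof.
  intros Hz; assert (H := conv1_evens).
  assert (E : CPS evens z = (1 + z * (0 + z * CPS evens z))%C).
  { rewrite (CPS_step1 evens z H Hz) at 1; rewrite (CPS_step1 _ z (conv1_shift _ H) Hz).
    rewrite (CPS_ext (fun n => evens (S (S n))) evens) by auto; auto. }
  replace ((1 - z * z) * CPS evens z)%C with (CPS evens z - z * (0 + z * CPS evens z))%C by ring.
  rewrite E at 1; ring.
Qed.

Lemma Cminus_1_neq_0 (x : C) : Cmod x < 1 -> (1 - x)%C <> 0.
Proof.
  intros Hx E; apply Ceq_minus in E; rewrite <- E, Cmod_1 in Hx; lra.
Qed.

Lemma Cmod_mult_lt_1 z w : Cmod z < 1 -> Cmod w < 1 -> Cmod (z * w) < 1.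
Proof.
  intros; rewrite Cmod_mult; assert (A := Cmod_ge_0 z); assert (B := Cmod_ge_0 w); nra.
Qed.

Lemma Cmult_zero_l (x y : C) : (x * y)%C = 0 -> y <> 0 -> x = 0.
Proof. intros E Hy; apply NNPP; intros Hx; apply (Cmult_neq_0 x y); auto. Qed.

(** Clearing denominators in z/(1 - z^2) = w/(1 - w^2) leaves (z - w)(1 + z w) = 0, and |z w| <
    1. *)
Lemma classS_evens : classS (CPS (mulX evens)) (mulX evens).
Proof.
  apply classS_of_series; auto using conv1_evens.
  intros z w Hz Hw E.
  assert (Ez := CPS_evens z Hz); assert (Ew := CPS_evens w Hw).
  apply Ceq_minus, Cmult_zero_l with (1 - (- z * w))%C.
  - transitivity ((1 - z * z) * (1 - w * w) * (z * CPS evens z - w * CPS evens w))%C.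
    + transitivity ((1 - w * w) * z * ((1 - z * z) * CPS evens z) - (1 - z * z) * w * ((1 - w * w) * CPS evens w))%C;
        [rewrite Ez, Ew; ring | ring].
    + rewrite E; ring.
  - apply Cminus_1_neq_0, Cmod_mult_lt_1; auto; rewrite Cmod_opp; auto.
Qed.

(* Coefficients of (1 - z^3)^(-2/3). *)
Fixpoint cubic (n : nat) : R :=
  match n with
  | O => 1 | 1%nat => 0 | 2%nat => 0
  | S (S (S m)) => (INR m + 2) / (INR m + 3) * cubic m
  end.

Definition cubicC (n : nat) : C := RtoC (cubic n).

Lemma three_step_ind (P : nat -> Prop) :
  P 0%nat -> P 1%nat -> P 2%nat -> (forall n, P n -> P (S (S (S n)))) -> forall n, P n.
Proof.
  intros H0 H1 H2 HS n; assert (P n /\ P (S n) /\ P (S (S n))); [|tauto].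
  induction n as [|n [A [B C]]]; auto.
Qed.

Lemma conv1_cubic : conv1 cubicC.
Proof.
  apply conv1_bounded_coef; intros n; unfold cubicC; rewrite Cmod_R.
  assert (0 <= cubic n <= 1); [|rewrite Rabs_pos_eq; lra].
  induction n as [| | |n IH] using three_step_ind; try (simpl; lra).
  cbn [cubic]; assert (Hn := pos_INR n).
  assert (0 <= (INR n + 2) / (INR n + 3) <= 1); [|nra].
  split; [apply Rmult_le_pos; [lra | apply Rinv_pos_le; lra]|].
  apply Rmult_le_reg_r with (INR n + 3); [lra|]; unfold Rdiv; rewrite Rmult_assoc, Rinv_l; lra.
Qed.

(** Comparison of coefficients: the recurrence reads (m + 3) c_(m+3) = m c_m + 2 c_m, and the two
    lowest coefficients of the derivative vanish. *)
Lemma cubic_ode z : Cmod z < 1 ->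
  ((1 - z * z * z) * CPS (dcoef cubicC) z = 2 * (z * z) * CPS cubicC z)%C.
Proof.
  intros Hz; assert (Hc := conv1_cubic); assert (Hd := conv1_dcoef _ Hc).
  assert (Hu := conv1_ud _ Hc).
  assert (Hz0 := Cmod_ge_0 z); set (r := (1 + Cmod z) / 2).
  assert (Hr : 0 <= r < 1) by (unfold r; lra); assert (Hzr : Cmod z <= r) by (unfold r; lra).
  assert (E : CPS (dcoef cubicC) z = (z * z * (z * CPS (dcoef cubicC) z + 2 * CPS cubicC z))%C).
  { rewrite (CPS_step1 _ z Hd Hz) at 1; rewrite (CPS_step1 _ z (conv1_shift _ Hd) Hz).
    rewrite (CPS_ext (fun n => dcoef cubicC (S (S n))) (fun n => ud cubicC n + RtoC 2 * cubicC n)%C).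
    - rewrite (CPS_plus r), (CPS_scal r), CPS_ud; auto.
      + unfold dcoef at 1 2, cubicC at 1 2; simpl cubic; ring.
      + apply absconv_scal; [apply Hc; auto | lra].
    - intros n; unfold dcoef, ud, cubicC; cbn [cubic]; rewrite !S_INR, <- !RtoC_mult, <- RtoC_plus.
      f_equal; assert (Hn := pos_INR n); field; lra. }
  replace ((1 - z * z * z) * CPS (dcoef cubicC) z)%C with
    (CPS (dcoef cubicC) z - z * z * z * CPS (dcoef cubicC) z)%C by ring.
  rewrite E at 1; ring.
Qed.

(** With g the series, g^3 (1 - z^3)^2 has derivative 3 g^2 (1 - z^3) ((1 - z^3) g' - 2 z^2 g) = 0.
    Working with the cube avoids fractional powers. *)
Lemma cubic_identity z : Cmod z < 1 ->
  (CPS cubicC z * CPS cubicC z * CPS cubicC z * ((1 - z * z * z) * (1 - z * z * z)) = 1)%C.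
Proof.
  intros Hz; assert (Hz0 := Cmod_ge_0 z); assert (Hc := conv1_cubic).
  set (r := (1 + Cmod z) / 2); assert (Hr : 0 < r < 1) by (unfold r; lra).
  set (S := fun u : C => Cmod u <= r).
  assert (TF : T2 S (CPS cubicC) (CPS (dcoef cubicC))) by (apply CPS_T2; auto).
  assert (TI : T2 S (fun u => u) (fun _ => RtoC 1)) by (apply T2_id with r; auto).
  assert (T3 := T2_mult _ _ _ _ _ (T2_mult _ _ _ _ _ TI TI) TI).
  assert (TQ := T2_plus _ _ _ _ _ (T2_const S (RtoC 1)) (T2_mult _ _ _ _ _ (T2_const S (RtoC (-1))) T3)).
  assert (TT := T2_mult _ _ _ _ _ (T2_mult _ _ _ _ _ (T2_mult _ _ _ _ _ TF TF) TF) (T2_mult _ _ _ _ _ TQ TQ)).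
  assert (Hseg : forall t, 0 <= t <= 1 -> S (RtoC t * z)%C).
  { intros t Ht; unfold S; rewrite Cmod_mult, Cmod_R, Rabs_pos_eq by lra; unfold r; nra. }
  (* The derivative assembled by the [T2] rules is read off from [TT] instead of being written
     out. *)
  match type of TT with T2 _ ?F ?F' =>
    assert (K : (forall w, S w -> F' w = RtoC 0) -> F z = F (RtoC 0))
      by (intros HD; exact (T2_zero_derivative_const S F F' z Hseg HD TT)) end.
  cbv beta in K; clear TT TQ T3 TI TF.
  transitivity (CPS cubicC 0 * CPS cubicC 0 * CPS cubicC 0 *
     ((1 + RtoC (-1) * (0 * 0 * 0)) * (1 + RtoC (-1) * (0 * 0 * 0))))%C.
  2:{ rewrite CPS_0 by auto; unfold cubicC; simpl cubic; ring. }
  rewrite <- K; [ring|].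
  intros w Hw.
  assert (Hw1 : Cmod w < 1) by (unfold S in Hw; lra).
  assert (E := cubic_ode w Hw1).
  set (g := CPS cubicC w) in *; set (g' := CPS (dcoef cubicC) w) in *.
  transitivity (3 * g * g * (1 - w * w * w) * ((1 - w * w * w) * g' - 2 * (w * w) * g))%C; [ring|].
  rewrite E; ring.
Qed.

(** Only powers of z^3 have nonzero coefficients. This removes the ambiguity by a cube root of unity
    in the injectivity proof. *)
Lemma cubic_symmetry z w : (z * z * z = w * w * w)%C -> CPS cubicC z = CPS cubicC w.
Proof.
  intros E; apply CSer_ext; intros n; induction n as [| | |n IH] using three_step_ind;
    try (unfold cubicC; simpl; ring).
  replace (cubicC (S (S (S n)))) with (RtoC ((INR n + 2) / (INR n + 3)) * cubicC n)%C
    by (unfold cubicC; cbn [cubic]; rewrite RtoC_mult; auto).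
  transitivity (RtoC ((INR n + 2) / (INR n + 3)) * (cubicC n * z ^ n) * (z * z * z))%C; [simpl; ring|].
  rewrite IH, E; simpl; ring.
Qed.

(** The cube of the function is the Koebe function x / (1 - x)^2 at x = z^3, so equal values give (x
    - y)(1 - x y) = 0, hence x = y. The factors g then agree and cancel. *)
Lemma classS_cubic : classS (CPS (mulX cubicC)) (mulX cubicC).
Proof.
  apply classS_of_series; auto using conv1_cubic.
  intros z w Hz Hw E.
  assert (Ez := cubic_identity z Hz); assert (Ew := cubic_identity w Hw).
  assert (Hz3 : Cmod (z * z * z) < 1) by (repeat apply Cmod_mult_lt_1; auto).
  assert (Hw3 : Cmod (w * w * w) < 1) by (repeat apply Cmod_mult_lt_1; auto).
  set (x := (z * z * z)%C) in *; set (y := (w * w * w)%C) in *.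
  set (g := CPS cubicC z) in *; set (k := CPS cubicC w) in *.
  assert (Exy : x = y).
  { assert (Ex : (x = (z * g) * (z * g) * (z * g) * ((1 - x) * (1 - x)))%C).
    { transitivity (x * (g * g * g * ((1 - x) * (1 - x))))%C; [rewrite Ez; ring | unfold x; ring]. }
    assert (Ey : (y = (z * g) * (z * g) * (z * g) * ((1 - y) * (1 - y)))%C).
    { rewrite E; transitivity (y * (k * k * k * ((1 - y) * (1 - y))))%C; [rewrite Ew; ring | unfold y; ring]. }
    apply Ceq_minus, Cmult_zero_l with (1 - x * y)%C.
    - transitivity (x * ((1 - y) * (1 - y)) - y * ((1 - x) * (1 - x)))%C; [ring|].
      set (q := (z * g * (z * g) * (z * g))%C) in *.
      transitivity (q * ((1 - x) * (1 - x)) * ((1 - y) * (1 - y)) - q * ((1 - y) * (1 - y)) * ((1 - x) * (1 - x)))%C;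
        [rewrite <- Ex, <- Ey; ring | ring].
    - apply Cminus_1_neq_0, Cmod_mult_lt_1; auto. }
  assert (Egk : g = k) by (apply cubic_symmetry; exact Exy).
  apply Ceq_minus, Cmult_zero_l with g.
  - rewrite <- Egk in E; transitivity (z * g - w * g)%C; [ring | rewrite E; ring].
  - intros Hg; rewrite Hg in Ez.
    assert (X : RtoC 0 = RtoC 1) by (rewrite <- Ez; ring); apply RtoC_inj in X; lra.
Qed.

Lemma supS_ge H f a x : classS f a -> Cmod (H a) = x -> Rbar_le (Finite x) (supS H).
Proof.
  intros Hfa <-; apply (proj1 (Lub_Rbar_correct _)); exists f, a; auto.
Qed.

Lemma supS_le H x : (forall f a, classS f a -> Cmod (H a) <= x) -> Rbar_le (supS H) (Finite x).
Proof.
  intros Hb; apply (proj2 (Lub_Rbar_correct _)); intros y [f [a [Hfa ->]]]; apply (Hb f a Hfa).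
Qed.

Theorem theorem1 :
  let A : Rbar := supS hankel22 in
  let B : Rbar := supS hankel31 in
  (Rbar_le (Finite 1) A /\ Rbar_le A (Finite (11 / 3))) /\
  (Rbar_le (Finite (4 / 9)) B /\
   Rbar_le B (Finite ((32 + sqrt 285) / 15))).
Proof.
  intros A B; repeat split.
  - apply supS_ge with (1 := classS_evens).
    (* Here a_2 = a_4 = 0 and a_3 = 1. *)
    unfold hankel22, mulX, evens; simpl Nat.even; cbv iota.
    replace (0 * 0 - 1 * 1)%C with (- (1))%C by ring; apply Cmod_m1.
  - apply supS_le; intros f a Hfa; apply (classS_hankel_bounds f a Hfa).
  - apply supS_ge with (1 := classS_cubic).
    (* Here a_2 = a_3 = a_5 = 0 and a_4 = 2/3, so only -a_4^2 survives. *)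
    unfold hankel31, mulX, cubicC; simpl cubic.
    match goal with |- Cmod ?e = _ => replace e with (RtoC (- (4 / 9))) end.
    + rewrite Cmod_R, Rabs_Ropp, Rabs_pos_eq; lra.
    + apply injective_projections; simpl; field.
  - apply supS_le; intros f a Hfa; destruct (classS_hankel_bounds f a Hfa) as [_ H].
    (* The bound 1 already lies below 32/15. *)
    assert (P := sqrt_pos 285); lra.
Qed.
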